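(* Let $\mathbf M$ be the ordered matroid on a finite totally ordered set $S$ obtained from a representation $\phi:U\to W$ over a field $\Bbbk$. For each T-flat $A$ of $\mathbf M$, of level $l(A)$, there is a canonical isomorphism $$\theta|A:\ \widetilde H_{l(A)-1}\big(\overline{BC}((\mathbf M|A)^* );\Bbbk\big)\xrightarrow{\ \cong\ }T_A(\phi),$$ namely the linear map which sends $\overline\sigma_B\mapsto x_B^*\otimes e_A\otimes v_{A\setminus B}^*$ for every $B\in\beta\mathrm{nbc}((\mathbf M|A)^* )$, where $\{x_B^*\}$ is the basis of $S_A(\phi)^*$ dual to the basis $\{x_B\mid B\in \beta\mathrm{nbc}((\mathbf M|A)^* )\}$ of $S_A(\phi)$.
   Context: Setting: $U$ has basis $\{e_i\mid i\in S\}$, $\phi:U\to W$ is a linear map of finite dimensional $\Bbbk$-vector spaces; $I\subseteq S$ is independent in $\mathbf M$ iff $\phi(e_i)$, $i\in I$, are linearly independent. $U_I=\mathrm{span}\{e_i\mid i\in I\}$, $V_I=\mathrm{span}\{\phi(e_i)\mid i\in I\}$, $r(I)=\dim V_I$, $l(I)=|I|-r(I)-1$. A T-flat is a non-empty union of circuits. Fix a T-flat $A$; put $N=\mathbf M|A$ (restriction, with the induced order on $A$), $l=l(A)$ and $m=\min A$; $N^*$ is the dual matroid. Spaces: $S_A(\phi)\subseteq\mathrm{Sym}^l(V_A)$ is the span of all products $w_1\cdots w_l$ with $w_i\in V_{J_i\setminus J_{i-1}}\cap V_{J_{i-1}}$, over all chains $J_0\subset\cdots\subset J_l=A$ of T-flats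 with $l(J_i)=i$ (for $l=0$ it is $\Bbbk$). $T_A(\phi)=S_A(\phi)^*\otimes\bigwedge^{|A|}U_A\otimes\bigwedge^{r(A)}V_A^*$. Broken circuits: a broken circuit of $N^*$ is a circuit of $N^*$ with its smallest element removed. $\overline{BC}(N^* )$ (reduced broken circuit complex) is the simplicial complex of all subsets of $A\setminus\{m\}$ containing no broken circuit of $N^*$; the empty face is included and reduced homology is used. $\beta\mathrm{nbc}(N^* )$ is the set of bases $B$ of $N^*$ containing no broken circuit of $N^*$ (then $m\in B$) such that for every $b\in B\setminus\{m\}$, $b\ne\min c(B,b)$, where $c(B,b)$ is the unique circuit of $N$ contained in $(A\setminus B)\cup\{b\}$. Cycles $\overline\sigma_B$: for $B\in\beta\mathrm{nbc}(N^* )$ let $f(b)=\min c(B,b)\in A\setminus B$ for $b\in B\setminus\{m\}$. Let $t_1<\cdots<t_q$ be the elements of the image of $f$, and let $A_s=\{t_s\}\cup f^{-1}(t_s)=\{a^s_0<\cdots<a^s_{e_s}\}$. Then $\overline\sigma_B=\sum_{i_1=0}^{e_1}\cdots\sum_{i_q=0}^{e_q}(-1)^{i_1+\cdots+i_q}[A_1-a^1_{i_1},\dots,A_q-a^q_{i_q}]$, where the bracket is the oriented simplex whose vertices are listed by concatenating the increasing sequences $A_s\setminus\{a^s_{i_s}\}$ (and $\overline\sigma_B=[\emptyset]$ if $B=\{m\}$). These classes form a basis of $\widetilde H_{l-1}(\overline{BC}(N^* );\Bbbk)$ (Bj\''orner, Ziegler). Elements $x_B$: write $B=\{m<b_1<\cdots<b_l\}$,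 and let $J_i$ be the union of all circuits of $N$ contained in $A\setminus\{b_{i+1},\dots,b_l\}$; this gives a chain $J_0\subset\cdots\subset J_l=A$ of T-flats with $l(J_i)=i$ and $\min(J_i\setminus J_{i-1})=b_i$. With $p=\max(J_i\setminus J_{i-1})$, let $u_i=e_p+\sum_{j<p}x_je_j$ be the unique element of this form in $U_{J_i\setminus J_{i-1}}$ with $\phi(u_i)\in V_{J_i\setminus J_{i-1}}\cap V_{J_{i-1}}$. Set $x_B=\phi(u_1)\cdots\phi(u_l)$. Exterior elements: for $K=\{a_1<\cdots<a_q\}$, $e_K=e_{a_1}\wedge\cdots\wedge e_{a_q}$ and $v_K=\phi(e_{a_1})\wedge\cdots\wedge\phi(e_{a_q})$. If $K$ is a basis of $N$, $v_K^*\in\bigwedge^{r(A)}V_A^*$ is the element with $v_K^*(v_K)=1$. *)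

(* Defs.v *)
From HB Require Import structures.
From Stdlib Require Import ClassicalEpsilon.
From mathcomp Require Import all_boot all_order all_algebra.
From mathcomp.multinomials Require Import mpoly.

Set Implicit Arguments.
Unset Strict Implicit.
Unset Printing Implicit Defensive.

Import Order.TTheory GRing.Theory.
Local Open Scope ring_scope.

(* The span of an arbitrary, possibly infinite, set of vectors: the smallest  *)
(* subspace containing it, see [span_setP].                                   *)
Definition span_set (k : fieldType) (V : vectType k) (P : V -> Prop) :
  {vspace V} :=
  epsilon (inhabits 0%VS)
    (fun X : {vspace V} => forall Y : {vspace V},
       (X <= Y)%VS <-> (forall v, P v -> v \in Y)).

Lemma span_set_exists (k : fieldType) (V : vectType k) (P : V -> Prop) :
  exists X : {vspace V}, forall Y : {vspace V},
    (X <= Y)%VS <-> (forall v, P v -> v \in Y).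
Proof.
pose le_gen (X : {vspace V}) :=
  forall Y : {vspace V}, (forall v, P v -> v \in Y) -> (X <= Y)%VS.
suff [X XP minX] : exists2 X : {vspace V}, forall v, P v -> v \in X & le_gen X.
  by exists X => Y; split=> [/subvP XY v /XP/XY//|/minX].
have step n (X : {vspace V}) : (\dim {:V} - \dim X <= n)%N -> le_gen X ->
    exists2 X : {vspace V}, forall v, P v -> v \in X & le_gen X.
  elim: n X => [|n IHn] X dX minX.
    exists X => // v _; have /eqP-> : X == fullv by
      rewrite eqEdim subvf -subn_eq0 -leqn0.
    exact: memvf.
  have [allX|/not_all_ex_not[v vP]] := classic (forall v, P v -> v \in X).
    by exists X.
  have [Pv /negP vX] := imply_to_and _ _ vP.
  have ltd : (\dim X < \dim (X + <[v]>))%N.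
    rewrite (ltn_leqif (dimv_leqif_sup (addvSl X <[v]>))).
    by rewrite subv_add subvv /= -memvE.
  apply: (IHn (X + <[v]>)%VS) => [|Y PY].
    rewrite -ltnS (leq_trans _ dX)// ltn_sub2l//.
    by rewrite (leq_trans ltd)// dimvS ?subvf.
  by rewrite subv_add minX//= -memvE PY.
exact: (step (\dim {:V}) 0%VS (leq_subr _ _) (fun Y _ => sub0v Y)).
Qed.

Lemma span_setP (k : fieldType) (V : vectType k) (P : V -> Prop)
    (Y : {vspace V}) :
  (span_set P <= Y)%VS <-> (forall v, P v -> v \in Y).
Proof. exact: (epsilon_spec (inhabits 0%VS) _ (span_set_exists P)). Qed.


Section QuotientSpace.
Variables (k : fieldType) (V : vectType k) (X : {vspace V}).

Definition quotv : Type := Quotient.quot X.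

HB.instance Definition _ := GRing.Zmodule.on quotv.

Definition quotv_class (v : V) : quotv :=
  (\pi_(Quotient.quot X) v)%qT.

Lemma quotv_classK : cancel (@repr _ (Quotient.quot X)) quotv_class.
Proof. exact: reprK. Qed.

Lemma eq_quotv_class u v : (quotv_class u == quotv_class v) = (u - v \in X).
Proof. by rewrite Quotient.idealrBE. Qed.

Lemma quotv_classD : {morph quotv_class : u v / u + v}.
Proof. by move=> u v; rewrite /quotv_class raddfD. Qed.

Definition quotv_scale (a : k) (q : quotv) : quotv :=
  quotv_class (a *: repr (q : Quotient.quot X)).

Lemma quotv_classZ a v : quotv_class (a *: v) = quotv_scale a (quotv_class v).
Proof.
apply/eqP; rewrite eq_quotv_class -scalerBr memvZ//.
by rewrite -eq_quotv_class quotv_classK.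
Qed.

Fact quotv_scaleA a b q :
  quotv_scale a (quotv_scale b q) = quotv_scale (a * b) q.
Proof. by rewrite -[q]quotv_classK -!quotv_classZ scalerA. Qed.

Fact quotv_scale1 : left_id 1 quotv_scale.
Proof. by move=> q; rewrite -[q]quotv_classK -quotv_classZ scale1r. Qed.

Fact quotv_scaleDr : right_distributive quotv_scale +%R.
Proof.
move=> a q r; rewrite -[q]quotv_classK -[r]quotv_classK.
by rewrite -!(quotv_classD, quotv_classZ) scalerDr.
Qed.

Fact quotv_scaleDl q : {morph quotv_scale^~ q : a b / a + b}.
Proof.
move=> a b; rewrite -[q]quotv_classK.
by rewrite -!(quotv_classD, quotv_classZ) scalerDl.
Qed.

HB.instance Definition _ := GRing.Zmodule_isLmodule.Build k quotv
  quotv_scaleA quotv_scale1 quotv_scaleDr quotv_scaleDl.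

End QuotientSpace.

Definition dual (k : fieldType) (V : vectType k) : vectType k := 'Hom(V, k^o).

(* For finite dimensional spaces, V (x) W is Hom(V^*, W), with v (x) w the    *)
(* map f |-> f(v) w.                                                          *)
Section Tensor.
Variables (k : fieldType) (V W : vectType k).

Definition tensor : vectType k := 'Hom(dual V, W).

Definition tens (v : V) (w : W) : tensor :=
  linfun (fun f : 'Hom(V, k^o) => (f v : k) *: w).

Lemma tensE v w (f : 'Hom(V, k^o)) :
  (tens v w : 'Hom(dual V, W)) f = (f v : k) *: w.
Proof.
pose g (f : 'Hom(V, k^o)) := (f v : k) *: w.
have glin : linear g.
  by move=> a f1 f2; rewrite /g add_lfunE scale_lfunE scalerDl scalerA.
pose G : {linear 'Hom(V, k^o) -> W} :=
  HB.pack g (GRing.isLinear.Build _ _ _ _ g glin).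
exact: (lfunE G f).
Qed.

End Tensor.

(* The basis of V^* dual to a basis (x_i)_(i : I) of V.                       *)
Definition dual_basis (k : fieldType) (V : vectType k) (I : finType)
    (x : I -> V) (i : I) : dual V :=
  linfun (coord (codom_tuple x) (enum_rank i) : V -> k^o).

Lemma dual_basisE (k : fieldType) (V : vectType k) (I : finType) (x : I -> V)
    (i j : I) :
  free (codom_tuple x) ->
  (dual_basis x i : 'Hom(V, k^o)) (x j) = (i == j)%:R.
Proof.
move=> fx; rewrite /dual_basis.
rewrite (lfunE (coord (codom_tuple x) (enum_rank i) : {linear V -> k^o})).
have -> : x j = (codom_tuple x)`_(enum_rank j) by rewrite nth_codom enum_rankK.
by rewrite /= coord_free// (inj_eq (@enum_rank_inj I)) eq_sym.
Qed.

(* Sym^l V is the space of forms of degree l in the coordinates on V given by *)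
(* its standard basis.                                                        *)
Section SymmetricPower.
Variables (k : fieldType) (l : nat) (V : vectType k).

Local Notation n := (\dim {:V}).

Definition form : Type := dhomog n k l.

HB.instance Definition _ := GRing.Lmodule.on form.

Fact form_vect_axiom :
  Vector.axiom #|[set m : 'X_{1..n < l.+1} | mdeg m == l]| form.
Proof.
set M := [set _ | _].
exists (fun p : form => \row_(i < #|M|) (mpoly_of_dhomog p)@_(enum_val i)).
  by move=> a p q; apply/rowP=> i; rewrite !mxE mcoeffD mcoeffZ.
pose g (r : 'rV[k]_#|M|) : {mpoly k[n]} :=
  \sum_(i < #|M|) r 0 i *: 'X_[enum_val i].
have ghom r : g r \is l.-homog.
  apply: rpred_sum => i _; apply: rpredZ; rewrite dhomogX.
  by have := enum_valP i; rewrite /M inE.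
have coefg (r : 'rV[k]_#|M|) (i : 'I_#|M|) : (g r)@_(enum_val i) = r 0 i.
  rewrite raddf_sum (bigD1 i)//= mcoeffZ mcoeffX eqxx mulr1 big1 ?addr0// => j ji.
  by rewrite mcoeffZ mcoeffX !(inj_eq val_inj) (inj_eq enum_val_inj) (negPf ji) mulr0.
exists (fun r => DHomog (ghom r)) => [p|r].
  apply/val_inj/mpolyP=> m /=.
  have [dm|dm] := eqVneq (mdeg m) l; last first.
    by rewrite !(@dhomog_nemf_coeff _ _ mdeg l)//; case: p.
  have mP : (mdeg m < l.+1)%N by rewrite dm.
  have mM : BMultinom mP \in M by rewrite inE /= dm.
  have -> : m = enum_val (enum_rank_in mM (BMultinom mP)) by rewrite enum_rankK_in.
  by rewrite coefg mxE.
by apply/rowP=> i; rewrite mxE coefg.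
Qed.

HB.instance Definition _ := Lmodule_hasFinDim.Build k form form_vect_axiom.

Definition sympow : vectType k := form.

Definition linform (v : V) : {mpoly k[n]} :=
  \sum_(i < n) coord (vbasis {:V}) i v *: 'X_i.

Fact linform_prod_homog (w : 'I_l -> V) :
  \prod_(j < l) linform (w j) \is l.-homog.
Proof.
have lin1 v : linform v \is 1.-homog.
  by apply: rpred_sum => i _; apply: rpredZ; rewrite dhomogX/= mdeg1.
pose mt := [tuple linform (w j) | j < l].
have := @dhomog_prod n k mdeg l (nseq_tuple l 1%N) mt.
have -> : (\sum_(i <- nseq_tuple l 1) i = l)%N.
  by rewrite /= big_nseq iter_addn_0 mul1n.
rewrite big_tuple; under eq_bigr do rewrite tnth_mktuple.
by apply=> i; rewrite tnth_mktuple tnth_nseq.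
Qed.

Definition symprod (w : 'I_l -> V) : sympow := DHomog (linform_prod_homog w).

End SymmetricPower.

(* The exterior power has basis the products of increasing sequences of d     *)
(* vectors of the standard basis of V; the coordinates of w_1 /\ ... /\ w_d   *)
(* are the maximal minors of the matrix of coordinates of the w_i.            *)
Section ExteriorPower.
Variables (k : fieldType) (d : nat) (V : vectType k).

Local Notation n := (\dim {:V}).

Definition increasing (f : {ffun 'I_d -> 'I_n}) :=
  [forall i : 'I_d, forall j : 'I_d, (i < j)%N ==> (f i < f j)%N].

Definition extpow : vectType k := {ffun {f | increasing f} -> k^o}.

Definition wedge (w : 'I_d -> V) : extpow :=
  [ffun f : {f | increasing f} =>
     \det (\matrix_(i, j) coord (vbasis {:V}) (val f j) (w i)) : k^o].

End ExteriorPower.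

(* A matroid is given by its ground set and its independent sets. The axioms  *)
(* are not bundled: the only matroids considered are those represented by     *)
(* linear maps, their restrictions, and the duals of the latter.              *)
Record indep_system (S : finType) :=
  IndepSystem { ground : {set S}; indep : {set {set S}} }.

Section Matroid.
Variables (S : finType) (M : indep_system S).
Implicit Types A B C X : {set S}.

Definition bases : {set {set S}} :=
  [set B | maxset (fun X => (X \subset ground M) && (X \in indep M)) B].

Definition circuits : {set {set S}} :=
  [set C | minset (fun X => (X \subset ground M) && (X \notin indep M)) C].

Definition restriction A : indep_system S :=
  IndepSystem (ground M :&: A) [set X in indep M | X \subset A].

Definition dual_matroid : indep_system S :=
  IndepSystem (ground M)
    [set X : {set S} | [exists B in bases, X \subset ground M :\: B]].

Definition Tflat A : bool :=
  (A != set0) &&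
  [exists P : {set {set S}}, (P \subset circuits) && (A == cover P)].

Definition circuits_union X : {set S} :=
  \bigcup_(C in circuits | C \subset X) C.

End Matroid.

Section OrderedSets.
Variables (disp : Order.disp_t) (S : finOrderType disp).
Implicit Types X : {set S}.

Definition is_min (x : S) X := (x \in X) && [forall y in X, (x <= y)%O].
Definition is_max (x : S) X := (x \in X) && [forall y in X, (y <= x)%O].

Definition remove_min X : {set S} := [set x in X | ~~ is_min x X].

Definition sorted_elts X : seq S := sort <=%O (enum X).

End OrderedSets.

Section BrokenCircuits.
Variables (disp : Order.disp_t) (S : finOrderType disp) (N : indep_system S).
Implicit Types B : {set S}.

Definition broken_circuits : {set {set S}} :=
  [set remove_min C | C in circuits N].

Definition no_broken_circuit (X : {set S}) : bool :=
  [forall D in broken_circuits, ~~ (D \subset X)].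

Definition reduced_bc : {set {set S}} :=
  [set X : {set S} | (X \subset remove_min (ground N)) && no_broken_circuit X].

End BrokenCircuits.

Section BetaNbc.
Variables (disp : Order.disp_t) (S : finOrderType disp) (N : indep_system S).
Implicit Types B : {set S}.

(* c(B,b), when B is a basis of the dual of N.                                *)
Definition fund_circuit B (b : S) : {set S} :=
  odflt set0 [pick C in circuits N | C \subset b |: (ground N :\: B)].

(* This is beta nbc of the dual of N; B :&: remove_min (ground N) is B \ {m}. *)
Definition beta_nbc_dual : {set {set S}} :=
  [set B in bases (dual_matroid N) |
     no_broken_circuit (dual_matroid N) B &&
     [forall b in B :&: remove_min (ground N), ~~ is_min b (fund_circuit B b)]].

(* f(b) = min c(B,b); the default value b of the arg min belongs to c(B,b).   *)
Definition fund_min B (b : S) : S :=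
  [arg min_(x < b in fund_circuit B b) x]%O.

(* The sets A_1, ..., A_q, each listed in increasing order.                   *)
Definition blocks B : seq (seq S) :=
  let B' := B :&: remove_min (ground N) in
  [seq sorted_elts (t |: [set b in B' | fund_min B b == t])
     | t <- sorted_elts [set fund_min B b | b in B']].

(* The T-flat J_i, for B = {m < b_1 < ... < b_l}.                             *)
Definition Jchain B (i : nat) : {set S} :=
  circuits_union N (ground N :\: [set b in drop i.+1 (sorted_elts B)]).

End BetaNbc.

Section ReducedHomology.
Variables (k : fieldType) (disp : Order.disp_t) (S : finOrderType disp).

(* The augmented oriented chain complex of the full simplex on S, all degrees *)
(* together: the set F stands for the simplex [F] with its vertices listed in *)
(* increasing order, and has degree #|F| - 1.                                 *)
Definition chain : vectType k := {ffun {set S} -> k^o}.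

Definition face (F : {set S}) : chain := [ffun G => (G == F)%:R].

Definition bd_face (F : {set S}) : chain :=
  \sum_(v in F) (-1) ^+ #|[set w in F | (w < v)%O]| *: face (F :\ v).

Definition bd : 'End(chain) :=
  linfun (fun c : {ffun {set S} -> k^o} =>
            \sum_(F : {set S}) (c F : k) *: bd_face F).

Lemma bdE (c : {ffun {set S} -> k^o}) :
  bd c = \sum_(F : {set S}) (c F : k) *: bd_face F.
Proof.
pose g (c : {ffun {set S} -> k^o}) : chain :=
  \sum_(F : {set S}) (c F : k) *: bd_face F.
have glin : linear g.
  move=> a c1 c2; rewrite /g scaler_sumr -big_split; apply: eq_bigr => F _ /=.
  by rewrite !ffunE scalerDl scalerA.
pose G : {linear {ffun {set S} -> k^o} -> chain} :=
  HB.pack g (GRing.isLinear.Build _ _ _ _ g glin).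
exact: (lfunE G c).
Qed.

Lemma bd_faceE F : bd (face F) = bd_face F.
Proof.
rewrite bdE (bigD1 F)//= ffunE eqxx scale1r big1 ?addr0// => G GF.
by rewrite ffunE (negPf GF) scale0r.
Qed.

(* [v_0, ..., v_p] for an arbitrary listing of the vertices: the sign is that *)
(* of the permutation sorting the list.                                       *)
Fixpoint inversions (s : seq S) : nat :=
  if s is x :: s' then (count (fun y => (y < x)%O) s' + inversions s')%N
  else 0%N.

Definition simplex (s : seq S) : chain :=
  if uniq s then (-1) ^+ inversions s *: face [set x in s] else 0.

Variables (D : {set {set S}}) (i : int).

Definition chains (j : int) : {vspace chain} :=
  <<[seq face F | F in [set F in D | #|F|%:Z == j + 1]]>>.

Definition cycles : {vspace chain} := (chains i :&: lker bd)%VS.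
Definition boundaries : {vspace chain} := (bd @: chains (i + 1))%VS.

Definition homology : lmodType k :=
  @quotv k (subvs_of cycles) (linfun vsval @^-1: boundaries)%VS.

Definition homology_class (z : chain) : homology :=
  quotv_class _ (vsproj cycles z).

End ReducedHomology.

Section Cycles.
Variables (k : fieldType) (disp : Order.disp_t) (S : finOrderType disp).

(* The iterated sum over the vertex removed from each block, with the simplex *)
(* starting with prefix.                                                      *)
Fixpoint block_sum (prefix : seq S) (bs : seq (seq S)) : chain k S :=
  if bs is a :: bs' then
    \sum_(i < size a)
      (-1) ^+ i *: block_sum (prefix ++ take i a ++ drop i.+1 a) bs'
  else simplex k prefix.

Definition sigma (N : indep_system S) (B : {set S}) : chain k S :=
  block_sum [::] (blocks N B).

End Cycles.

Section Representation.
Variables (k : fieldType) (disp : Order.disp_t) (S : finOrderType disp).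
Variables (U W : vectType k) (e : S -> U) (phi : 'Hom(U, W)).
Implicit Types A B I J D K : {set S}.

Definition rep_matroid : indep_system S :=
  IndepSystem [set: S] [set I : {set S} | free [seq phi (e i) | i in I]].

Definition Uspan I : {vspace U} := <<[seq e i | i in I]>>%VS.
Definition Vspan I : {vspace W} := <<[seq phi (e i) | i in I]>>%VS.

Definition rk I : nat := \dim (Vspan I).
Definition level I : int := #|I|%:Z - (rk I)%:Z - 1.

Variable A : {set S}.

(* The level of a T-flat is nonnegative. *)
Local Notation lA := `|level A|%N.
Local Notation N := (restriction rep_matroid A).

Definition S_generator (x : sympow lA (subvs_of (Vspan A))) : Prop :=
  exists (J : nat -> {set S}) (w : 'I_lA -> subvs_of (Vspan A)),
    [/\ forall i, (i <= lA)%N -> Tflat rep_matroid (J i) /\ level (J i) = i%:Z,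
        forall i, (i < lA)%N -> J i \proper J i.+1,
        J lA = A,
        forall i : 'I_lA,
          vsval (w i) \in (Vspan (J i.+1 :\: J i) :&: Vspan (J i))%VS
      & x = symprod w].

Definition S_space : {vspace sympow lA (subvs_of (Vspan A))} :=
  span_set S_generator.

(* The last factor is the dual of the exterior power of V_A, on whose         *)
(* elements v_K^* is evaluated.                                               *)
Definition T_space : vectType k :=
  tensor
    (tensor (dual (subvs_of S_space)) (extpow #|A| (subvs_of (Uspan A))))
    (dual (extpow (rk A) (subvs_of (Vspan A)))).

(* The element u_i, for D = J_i \ J_(i-1) and J = J_(i-1).                    *)
Definition u_elt D J : U :=
  epsilon (inhabits 0) (fun u : U =>
    [/\ u \in Uspan D,
        exists (p : S) (x : S -> k),
          is_max p D /\ u = e p + \sum_(j : S | (j < p)%O) x j *: e j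
      & phi u \in (Vspan D :&: Vspan J)%VS]).

Definition x_elt B : sympow lA (subvs_of (Vspan A)) :=
  symprod (fun i : 'I_lA =>
    vsproj (Vspan A)
      (phi (u_elt (Jchain N B i.+1 :\: Jchain N B i) (Jchain N B i)))).

Definition x_dual (B : {B : {set S} | B \in beta_nbc_dual N}) :
    dual (subvs_of S_space) :=
  dual_basis (fun C : {C : {set S} | C \in beta_nbc_dual N} =>
                vsproj S_space (x_elt (val C))) B.

Definition e_wedge : extpow #|A| (subvs_of (Uspan A)) :=
  wedge (fun j : 'I_#|A| => [seq vsproj (Uspan A) (e a) | a <- sorted_elts A]`_j).

Definition v_wedge K : extpow (rk A) (subvs_of (Vspan A)) :=
  wedge (fun j : 'I_(rk A) =>
           [seq vsproj (Vspan A) (phi (e a)) | a <- sorted_elts K]`_j).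

Definition v_dual K : dual (extpow (rk A) (subvs_of (Vspan A))) :=
  dual_basis (fun _ : unit => v_wedge K) tt.

End Representation.

(* Main.v *)
(* Let v_a = phi(e_a), and let l be the level of A.                           *)

(* Both spaces have explicit bases indexed by beta nbc of the dual of M|A. Once this is known, theta
   is the linear map that matches the two bases, and [linear_bijection] gives its bijectivity and
   uniqueness.

   Homology. No face lies above degree l - 1, so the homology is the space of cycles
   ([boundaries_top]). A cycle sigma_B is a join of boundaries of simplices, hence closed
   ([bd_block_sum]), and it is supported on the complex ([sigma_face]). Evaluating chains at the
   faces B \ m, for B in beta nbc, is injective on cycles ([cycle_eq0]). By [sigma_lead] this
   evaluation is triangular with nonzero diagonal on the sigma_B, so they are independent
   ([sigma_tri]). A square system then shows that they span ([cycles_spanned]).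

   Target. The two exterior factors of T_A are lines, so it suffices that the x_B form a basis of
   S_A ([x_elt_basis]). Independence is [triangular_products_free], applied to factors led by
   distinct vectors ([step_vector]). For the upper bound, S_A consists of polynomials of slow growth
   ([S_space_slow]), whose dimension is bounded through deletion and contraction ([dim_slow]). The
   sets produced by that recursion belong to beta nbc ([beta_sets_beta]).

   Matroid conditions become linear algebra through the relations [kap b] supported on the circuits
   c(B,b). They form a basis of all linear relations on A ([fundamental_expand]), and they turn the
   broken circuit condition into [nbc_cobasisP]. *)
(*                                                                            *)
(* Homology. The reduced broken circuit complex has dimension l - 1, so its   *)
(* homology in that degree is the space of top cycles. A cycle that vanishes  *)
(* on all facets B \ m with B in beta nbc is zero: otherwise take a facet F   *)
(* of largest weight (the sum of the ranks of its elements) in its support    *)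
(* and put B = F + m; there is b in F with b = min c(B,b), and since the      *)
(* boundary vanishes at F - b the support has another facet F - b + c, with c *)
(* in c(B,b), so c > b, of larger weight. Conversely B \ m is the heaviest    *)
(* face of sigma_B, so the sigma_B are a basis of the cycles.                 *)
(*                                                                            *)
(* S_A(phi). For a linear form eta on V_A let m_eta be the number of a in A   *)
(* with eta(v_a) <> 0. Every f in S_A(phi) has degree at most m_eta - 2 along *)
(* each eta, as one sees on the generators. Let a = max A, neither a loop nor *)
(* a coloop. Modulo v_a, such an f satisfies the same bounds for the          *)
(* contraction by a; if it vanishes modulo v_a, then f = v_a g where g        *)
(* satisfies the bounds for the deletion of a. By induction the dimension is  *)
(* at most the number of B in beta nbc. The same induction shows that the x_B *)
(* are independent: modulo the v_a with a > b_i and a outside B, the factor   *)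
(* phi(u_i) is a nonzero multiple of v_(b_i).                                 *)
From HB Require Import structures.
From Stdlib Require Import Classical.
Require Import Defs.
From mathcomp Require Import all_boot all_order all_algebra.
From mathcomp.multinomials Require Import mpoly.

Set Implicit Arguments.
Unset Strict Implicit.
Unset Printing Implicit Defensive.

Import Order.TTheory GRing.Theory.
Local Open Scope ring_scope.

(** * Linear forms in the symmetric algebra *)

Section PolynomialMorphisms.
Variables (k : fieldType) (n : nat).

Lemma mpoly_rmorph_ext (R : comNzRingType) (f g : {rmorphism {mpoly k[n]} -> R}) :
    (forall c, f c%:MP = g c%:MP) -> (forall i, f 'X_i = g 'X_i) -> f =1 g.
Proof.
move=> fgC fgX p; rewrite [p]mpolyE !rmorph_sum; apply: eq_bigr => m _ /=.
rewrite -mul_mpolyC !rmorphM fgC mpolyXE_id !rmorph_prod /=; congr (_ * _).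
by apply: eq_bigr => i _; rewrite !rmorphXn fgX.
Qed.

End PolynomialMorphisms.

Section LinearForms.
Variables (k : fieldType) (W : vectType k).
Local Notation n := (\dim {:W}).
Local Notation b := (vbasis {:W}).
Local Notation P := {mpoly k[n]}.

Lemma linform_is_linear : linear (@linform k W).
Proof.
move=> a u v; rewrite /linform scaler_sumr -big_split; apply: eq_bigr => i _.
by rewrite linearP scalerDl scalerA.
Qed.

HB.instance Definition _ :=
  GRing.isLinear.Build k W P _ (@linform k W) linform_is_linear.

Lemma linform_vbasis (i : 'I_n) : linform b`_i = 'X_i.
Proof.
have /basis_free fb := vbasisP {:W}.
rewrite /linform (bigD1 i)//= coord_free// eqxx scale1r big1 ?addr0// => j ji.
by rewrite coord_free// eq_sym (negPf ji) scale0r.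
Qed.

Lemma linform_homog (v : W) : linform v \is 1.-homog.
Proof. by apply: rpred_sum => i _; apply: rpredZ; rewrite dhomogX/= mdeg1. Qed.

Lemma linform_eq0 (v : W) : (linform v == 0) = (v == 0).
Proof.
apply/eqP/eqP=> [v0|->]; last by rewrite linear0.
rewrite (coord_vbasis (memvf v)) big1// => i _.
suff -> : coord b i v = (linform v)@_U_(i) by rewrite v0 mcoeff0 scale0r.
rewrite raddf_sum (bigD1 i)//= mcoeffZ mcoeffX eqxx mulr1 big1 ?addr0// => j ji.
by rewrite mcoeffZ mcoeffX eq_mnm1 (negPf ji) mulr0.
Qed.

(** The algebra endomorphism of Sym(W) induced by g. *)
Definition push (g : 'End(W)) : P -> P :=
  mmap (@mpolyC n k) (fun i : 'I_n => linform (g b`_i)).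

HB.instance Definition _ g := GRing.RMorphism.on (push g).

Lemma pushC g c : push g c%:MP = c%:MP.
Proof. by rewrite /push mmapC. Qed.

Lemma push_linform g v : push g (linform v) = linform (g v).
Proof.
rewrite {1}/linform rmorph_sum /= [in RHS](coord_vbasis (memvf v)) !linear_sum.
apply: eq_bigr => i _.
by rewrite /push mmapZ mmapX mmap1U !linearZ_LR /= mul_mpolyC.
Qed.

Lemma push_comp g h p : push g (push h p) = push (g \o h)%VF p.
Proof.
apply: (mpoly_rmorph_ext (f := push g \o push h)) => [c|i] /=.
  by rewrite !pushC.
by rewrite -linform_vbasis !push_linform comp_lfunE.
Qed.

Lemma push_id p : push \1 p = p.
Proof.
apply: (mpoly_rmorph_ext (g := idfun)) => [c|i] /=; first by rewrite pushC.
by rewrite -linform_vbasis push_linform id_lfunE.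
Qed.

(* The polynomial p(x + t eta) in t. *)
Definition restr (eta : 'Hom(W, k^o)) : P -> {poly P} :=
  mmap (polyC \o @mpolyC n k)
    (fun i : 'I_n => ('X_i)%:P + ((eta b`_i : k)%:MP)%:P * 'X).

HB.instance Definition _ eta := GRing.RMorphism.on (restr eta).

Lemma restrC eta c : restr eta c%:MP = c%:MP%:P.
Proof. by rewrite /restr mmapC. Qed.

Lemma restr_linform eta v :
  restr eta (linform v) = (linform v)%:P + ((eta v : k)%:MP)%:P * 'X.
Proof.
rewrite {1}/linform rmorph_sum /= {2 3}(coord_vbasis (memvf v)) !linear_sum /=.
rewrite !rmorph_sum /= mulr_suml -big_split; apply: eq_bigr => i _ /=.
rewrite /restr mmapZ mmapX mmap1U !linearZ_LR /= linform_vbasis.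
by rewrite mulrDr -mul_mpolyC !rmorphM /= mulrA.
Qed.

End LinearForms.

Lemma hom_of_linear (k : fieldType) (V W : vectType k) (f : V -> W) :
  linear f -> exists h : 'Hom(V, W), forall x, h x = f x.
Proof.
move=> flin; pose F : {linear V -> W} := HB.pack f (GRing.isLinear.Build _ _ _ _ f flin).
by exists (linfun F) => x; rewrite lfunE.
Qed.

Lemma separating_functional (k : fieldType) (W : vectType k) (X : {vspace W}) v :
  v \notin X ->
  exists eta : 'Hom(W, k^o), (eta v : k) != 0 /\ {in X, forall x, (eta x : k) = 0}.
Proof.
move=> vX; set y := v - projv X v.
have y0 : y != 0.
  by apply: contraNneq vX => /eqP; rewrite subr_eq0 => /eqP ->; apply: memv_proj.
have [i yi] : exists i, coord (vbasis {:W}) i y != 0.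
  apply/existsP; apply: contraNT y0; rewrite negb_exists => /forallP y0.
  rewrite (coord_vbasis (memvf y)) big1// => i _.
  by move: (y0 i); rewrite negbK => /eqP ->; rewrite scale0r.
have [|eta etaE] :=
    @hom_of_linear k W k^o (fun x => coord (vbasis {:W}) i (x - projv X x)).
  move=> a u w.
  have -> : a *: u + w - projv X (a *: u + w) = a *: (u - projv X u) + (w - projv X w).
    by rewrite linearP scalerBr opprD addrACA.
  by rewrite linearD linearZ.
exists eta; split=> [|x xX]; first by rewrite etaE.
by rewrite etaE projv_id// subrr linear0.
Qed.

Section HomogeneousPush.
Variables (k : fieldType) (W : vectType k).
Local Notation n := (\dim {:W}).
Local Notation b := (vbasis {:W}).
Local Notation P := {mpoly k[n]}.

Lemma dhomog_prodX (R : nzRingType) N (I : finType) (h : I -> {mpoly R[N]}) (m : I -> nat) :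
    (forall i, h i \is 1.-homog) ->
  \prod_i h i ^+ m i \is (\sum_i m i).-homog.
Proof.
move=> h1; pose K (d : nat) (p : {mpoly R[N]}) := p \is d.-homog : Prop.
apply: (big_ind2 (fun p d => K d p)); first exact: dhomog1.
  by move=> ? ? ? ? ? ?; apply: dhomogM.
by move=> i _; have := dhomogMn (m i) (h1 i); rewrite mul1n.
Qed.

Lemma push_homog (g : 'End(W)) d p : p \is d.-homog -> push g p \is d.-homog.
Proof.
move=> hp; rewrite /push /mmap big_seq; apply: rpred_sum => m /(dhomog_mf hp) /= md.
rewrite mul_mpolyC; apply: rpredZ; rewrite -md mdegE.
by apply: dhomog_prodX => i; apply: linform_homog.
Qed.

(** The property passes to products, since p1 p2 - g(p1) g(p2) = (p1 - g(p1)) p2 + g(p1) (p2 -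
    g(p2)), so only the variables matter. The clause for [d = 0] is separate because [d.-1] is then
    0 too and would admit a nonzero constant q. *)
Lemma push_div (g : 'End(W)) v d p :
    (forall w, w - g w \in <[v]>%VS) -> p \is d.-homog ->
  exists q, [/\ p - push g p = linform v * q, q \is d.-1.-homog & d = 0%N -> q = 0].
Proof.
move=> gv.
pose K (d : nat) (p : P) := p \is d.-homog /\ exists q,
  [/\ p - push g p = linform v * q, q \is d.-1.-homog & d = 0%N -> q = 0].
have K1 : K 0%N 1.
  by split; [exact: dhomog1 | exists 0; rewrite rmorph1 subrr mulr0 rpred0].
have KM d1 p1 d2 p2 : K d1 p1 -> K d2 p2 -> K (d1 + d2)%N (p1 * p2).
  move=> [h1 [q1 [e1 hq1 z1]]] [h2 [q2 [e2 hq2 z2]]]; split; first exact: dhomogM.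
  exists (q1 * p2 + push g p1 * q2); split.
  - rewrite rmorphM mulrDr mulrA -e1 mulrCA -e2 mulrBl mulrBr addrA subrK //.
  - apply: rpredD.
      case: d1 h1 hq1 z1 => [|d1] h1 hq1 z1; last exact: dhomogM.
      by rewrite z1// mul0r rpred0.
    case: d2 h2 hq2 z2 => [|d2] h2 hq2 z2; last first.
      by rewrite addnS; apply: dhomogM => //; apply: push_homog.
    by rewrite z2// mulr0 rpred0.
  - move/eqP; rewrite addn_eq0 => /andP[/eqP/z1 -> /eqP/z2 ->].
    by rewrite mul0r mulr0 addr0.
have KX m : K (mdeg m) 'X_[m].
  rewrite mpolyXE_id mdegE; apply: (big_ind2 (fun p d => K d p)) => //.
    by move=> ? ? ? ?; apply: KM.
  move=> i _; elim: (m i) => [|e IHe]; first by rewrite expr0.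
  rewrite exprS -add1n; apply: KM IHe.
  split; first by rewrite dhomogX/= mdeg1.
  have /vlineP[c cE] := gv b`_i.
  exists c%:MP; rewrite -linform_vbasis push_linform -linearB cE linearZ /=.
  by rewrite mulrC mul_mpolyC; split=> //; rewrite -[c%:MP]mulr1 mul_mpolyC rpredZ ?dhomog1.
move=> hp; rewrite [p]mpolyE big_seq.
apply: (big_ind (fun p => exists q,
  [/\ p - push g p = linform v * q, q \is d.-1.-homog & d = 0%N -> q = 0])).
- by exists 0; rewrite rmorph0 subrr mulr0 rpred0.
- move=> p1 p2 [q1 [e1 hq1 z1]] [q2 [e2 hq2 z2]]; exists (q1 + q2); split.
  + by rewrite raddfD opprD addrACA e1 e2 mulrDr.
  + exact: rpredD.
  + by move=> d0; rewrite z1// z2// addr0.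
- move=> m /(dhomog_mf hp) /= md; have [_ [q [e hq z]]] := KX m.
  exists (p@_m *: q); split.
  + by rewrite -mul_mpolyC rmorphM /= pushC -mulrBr e mulrCA mul_mpolyC.
  + by rewrite -md rpredZ.
  + by move=> d0; rewrite z ?scaler0 ?md.
Qed.

Lemma restr_horner0 (eta : 'Hom(W, k^o)) p : (restr eta p).[0] = p.
Proof.
apply: (mpoly_rmorph_ext (f := horner_eval 0 \o restr eta) (g := idfun)) => [c|i] /=.
  by rewrite /horner_eval restrC hornerC.
rewrite /horner_eval -linform_vbasis restr_linform.
by rewrite hornerD hornerM hornerX mulr0 addr0 hornerC.
Qed.

Lemma restr_inj (eta : 'Hom(W, k^o)) p : restr eta p = 0 -> p = 0.
Proof. by move=> p0; rewrite -(restr_horner0 eta p) p0 horner0. Qed.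

(** A polynomial constant in t keeps its value when t is replaced by [- linform w], and this
    substitution turns [restr eta] into [push r]. *)
Lemma restr_size1 (eta : 'Hom(W, k^o)) p (r : 'End(W)) w :
    (forall x, r x = x - (eta x : k) *: w) -> (size (restr eta p) <= 1)%N ->
  push r p = p.
Proof.
move=> rE /size1_polyC p1.
transitivity (restr eta p).[- linform w]; last first.
  by rewrite p1 hornerC -[RHS](restr_horner0 eta) p1 hornerC coefC.
apply/esym.
apply: (mpoly_rmorph_ext (f := horner_eval (- linform w) \o restr eta) (g := push r)).
  by move=> c /=; rewrite /horner_eval restrC hornerC pushC.
move=> i /=; rewrite /horner_eval -linform_vbasis restr_linform push_linform rE.
by rewrite hornerD hornerM hornerX !hornerC linearB linearZ mulrN /= mul_mpolyC.
Qed.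

(* Invariance under every translation [b_i |-> b_i + t] allows sending the    *)
(* variables to 0 one at a time; derivatives would fail in characteristic p.  *)
Lemma restr_const d p : p \is d.-homog ->
    (forall eta : 'Hom(W, k^o), size (restr eta p) <= 1)%N ->
  p != 0 -> d = 0%N.
Proof.
move=> hp p1; apply: contra_neq_eq; rewrite -lt0n => d0.
have [r rp r0] : exists2 r : 'End(W), push r p = p & forall i : 'I_n, r b`_i = 0.
  suff /(_ n (leqnn n)) [r [rp r0]] : forall j, (j <= n)%N -> exists r : 'End(W),
      push r p = p /\ forall i : 'I_n, (i < j)%N -> r b`_i = 0.
    by exists r => // i; apply: r0.
  elim=> [_|j IHj jn]; first by exists \1%VF; rewrite push_id; split.
  have [r [rp r0]] := IHj (ltnW jn).
  pose i := Ordinal jn.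
  have [|eta etaE] := @hom_of_linear k W k^o (coord b i).
    by move=> a u v; rewrite linearD linearZ.
  have [|s sE] := @hom_of_linear k W W (fun x => x - (eta x : k) *: b`_i).
    move=> a u v /=; rewrite linearP scalerBr scalerDl scalerA.
    by rewrite opprD addrACA.
  exists (r \o s)%VF; split; first by rewrite -push_comp (restr_size1 sE)// p1.
  have fb := basis_free (vbasisP {:W}).
  move=> i'; rewrite ltnS leq_eqVlt comp_lfunE sE etaE coord_free//.
  have [->|i'i] := eqVneq i' i; first by rewrite scale1r subrr linear0.
  rewrite scale0r subr0 -[_ == _ :> nat]/(i' == i) (negPf i'i) /=; exact: r0.
(* Since r kills every basis vector, each monomial of positive degree is sent to 0. *)
rewrite -rp /push /mmap big_seq big1// => m /(dhomog_mf hp) /= md.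
have [i mi] : exists i, (0 < m i)%N.
  apply/existsP; move: d0; rewrite -md; apply: contraTT; rewrite negb_exists => /forallP m0.
  rewrite -leqNgt leqn0 mdegE sum_nat_eq0; apply/forallP=> i; apply/implyP=> _.
  by rewrite -leqn0 leqNgt m0.
by rewrite /mmap1 (bigD1 i)//= r0 linear0 expr0n gtn_eqF// mul0r mulr0.
Qed.

Lemma restr_push (eta : 'Hom(W, k^o)) (g : 'End(W)) p :
  restr eta (push g p) = map_poly (push g) (restr (eta \o g)%VF p).
Proof.
apply: (mpoly_rmorph_ext (f := restr eta \o push g)
   (g := map_poly (push g) \o restr (eta \o g)%VF)) => [c|i] /=.
  by rewrite pushC !restrC map_polyC /= pushC.
rewrite -linform_vbasis push_linform !restr_linform comp_lfunE.
by rewrite rmorphD rmorphM /= map_polyX !map_polyC /= push_linform pushC.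
Qed.

End HomogeneousPush.

(** * Polynomials of slow growth *)

Section Projection.
Variables (k : fieldType) (W : vectType k).

(** A model of the quotient by the line of u inside W itself, so that contracting an element again
    gives a configuration in W. *)
Definition quo (u : W) : 'End(W) := (\1 - projv <[u]>)%VF.

Lemma quoE u w : quo u w = w - projv <[u]> w.
Proof. by rewrite /quo add_lfunE opp_lfunE id_lfunE. Qed.

Lemma sub_quo u w : w - quo u w \in <[u]>%VS.
Proof. by rewrite quoE subKr memv_proj. Qed.

Lemma quo_id u : quo u u = 0.
Proof. by rewrite quoE projv_id ?subrr ?memv_line. Qed.

Lemma quo_eq0 u w : (quo u w == 0) = (w \in <[u]>%VS).
Proof.
apply/eqP/idP=> [w0|/vlineP[c ->]]; last by rewrite linearZ /= quo_id scaler0.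
by have := sub_quo u w; rewrite w0 subr0.
Qed.

Lemma dim_limg_quo u (X : {vspace W}) :
  u != 0 -> u \in X -> \dim (quo u @: X) = (\dim X).-1.
Proof.
move=> u0 uX; rewrite -(limg_ker_dim (quo u) X).
suff -> : (X :&: lker (quo u) = <[u]>)%VS by rewrite dim_vline u0.
apply/eqP; rewrite eqEsubv; apply/andP; split.
  by apply/subvP=> w; rewrite memv_cap memv_ker quo_eq0 => /andP[].
by rewrite -memvE memv_cap uX memv_ker quo_id eqxx.
Qed.

Lemma span_map_lfun (V : vectType k) (S : Type) (g : 'Hom(W, V)) (v : S -> W) (L : seq S) :
  <<[seq (g \o v) x | x <- L]>>%VS = (g @: <<[seq v x | x <- L]>>)%VS.
Proof. by rewrite limg_span -map_comp. Qed.

Lemma mem_quo_span (S : Type) (u w : W) (v : S -> W) (L : seq S) :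
  (quo u w \in <<[seq (quo u \o v) x | x <- L]>>%VS) =
  (w \in <<u :: [seq v x | x <- L]>>%VS).
Proof.
rewrite span_map_lfun span_cons; apply/idP/idP => [/memv_imgP[y yL quowy]|].
  rewrite -(subrK y w) memv_add//; first by rewrite -quo_eq0 linearB /= quowy subrr.
move=> /memv_addP[y yu [z zL ->]]; rewrite linearD /=.
by have := yu; rewrite -quo_eq0 => /eqP ->; rewrite add0r memv_img.
Qed.

End Projection.

Section SlowGrowth.
Variables (k : fieldType) (W : vectType k) (S : finType).
Local Notation n := (\dim {:W}).
Local Notation P := {mpoly k[n]}.
Implicit Types (v : S -> W) (L : seq S) (p q : P) (eta : 'Hom(W, k^o)).

Definition mcount eta v L : nat := count (fun x => (eta (v x) : k) != 0) L.

(* If m > 0 of the vectors [v x] are off the hyperplane [eta = 0], then [p]   *)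
(* has degree at most m - 2 along [eta]; for m = 1 this forces [p = 0]. The   *)
(* condition for m = 0 says that [p] is a polynomial in the vectors [v x].    *)
Definition slow v L p : Prop :=
  forall eta, (size (restr eta p) <= (mcount eta v L == 0) + (mcount eta v L).-1)%N.

(** A functional that is nonzero at [v a] and zero on the other vectors has count 1, for which the
    bound is 0. *)
Lemma slow_coloop v a L p :
  v a \notin <<[seq v x | x <- L]>>%VS -> slow v (a :: L) p -> p = 0.
Proof.
move=> /separating_functional[eta [etaa eta0]] /(_ eta).
rewrite /mcount /= etaa (eq_in_count (a2 := pred0)) ?count_pred0/=.
  by rewrite leqn0 size_poly_eq0 => /eqP/restr_inj.
by move=> x xL; rewrite eta0 ?eqxx// memv_span// map_f.
Qed.

Lemma slow_loop v a L p : v a = 0 -> slow v (a :: L) p -> slow v L p.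
Proof. by move=> a0 ps eta; have := ps eta; rewrite /mcount /= a0 linear0 eqxx. Qed.

(** A form on the contraction pulls back to one vanishing at [v a], so a drops out of the count. *)
Lemma slow_quo v a L p :
  slow v (a :: L) p -> slow (quo (v a) \o v) L (push (quo (v a)) p).
Proof.
move=> ps eta; have := ps (eta \o quo (v a))%VF.
rewrite /mcount /= comp_lfunE quo_id linear0 eqxx add0n.
under eq_count do rewrite comp_lfunE.
apply: leq_trans; rewrite restr_push map_polyE.
by apply: leq_trans (size_Poly _) _; rewrite size_map.
Qed.

(** If [eta (v a)] is nonzero, cancelling [v a] lowers both the degree along eta and the count by
    one; otherwise it changes neither. *)
Lemma slow_div v a L q :
  v a != 0 -> slow v (a :: L) (linform (v a) * q) -> slow v L q.
Proof.
move=> a0 qs eta; have [->|q0] := eqVneq q 0; first by rewrite rmorph0 size_poly0.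
have rq0 : restr eta q != 0 by apply: contra_neq q0; apply: restr_inj.
have := qs eta; rewrite rmorphM /= restr_linform /mcount /=.
set m := count _ L; set R := restr eta q.
have la0 : linform (v a) != 0 by rewrite linform_eq0.
case: (eqVneq (eta (v a) : k) 0) => [->|etaa] /=.
  rewrite mpolyC0 polyC0 mul0r addr0 add0n size_mul ?polyC_eq0//.
  by rewrite size_polyC la0.
have e0 : (eta (v a) : k)%:MP_[n] != 0 by rewrite mpolyC_eq0.
have sA : size ((linform (v a))%:P + (eta (v a) : k)%:MP%:P * 'X) = 2%N.
  by rewrite addrC size_MXaddC polyC_eq0 (negPf e0) size_polyC e0.
rewrite size_mul// ?sA; last by rewrite -size_poly_eq0 sA.
rewrite !add0n add2n /= => ltm; apply: leq_trans (leq_addl _ _).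
by rewrite -ltnS prednK// (leq_ltn_trans _ ltm).
Qed.

(** Nonzero slow polynomials have degree at most the level. The induction reduces modulo [v a], or
    divides by it when the reduction is 0. In [dim_slow] this disposes of loops, whose deletion
    lowers the level below d. *)
Lemma slow_degree L v d p :
    L != [::] -> p \is d.-homog -> p != 0 -> slow v L p ->
  (d + \dim <<[seq v x | x <- L]>> < size L)%N.
Proof.
elim: L v d p => // a L IHL v d p _ hp p0 ps.
have [aL|aL] := boolP (v a \in <<[seq v x | x <- L]>>%VS); last first.
  by rewrite (slow_coloop aL ps) eqxx in p0.
have spanaL : <<v a :: [seq v x | x <- L]>>%VS = <<[seq v x | x <- L]>>%VS.
  by rewrite span_cons; apply/addv_idPr; rewrite -memvE.
have [L0|L0] := eqVneq L [::].
  move: aL ps; rewrite L0 span_nil memv0 => /eqP a0 ps /=.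
  rewrite span_seq1 a0 dim_vline eqxx addn0 ltnS leqn0; apply/eqP.
  apply: (restr_const hp _ p0) => eta; have := ps eta.
  by rewrite /mcount/= a0 linear0 eqxx.
rewrite [map _ _]/= spanaL.
have [a0|a0] := eqVneq (v a) 0.
  by rewrite ltnS ltnW//; apply: IHL hp p0 (slow_loop a0 ps).
have [g0|g0] := eqVneq (push (quo (v a)) p) 0; last first.
  have := IHL _ _ _ L0 (push_homog (quo (v a)) hp) g0 (slow_quo ps).
  rewrite span_map_lfun dim_limg_quo//= -ltnS -addnS prednK//.
  by rewrite lt0n dimv_eq0; apply: contraNneq a0 => aL0; rewrite -memv0 -aL0.
have [q [pE hq qd]] := push_div (sub_quo (v a)) hp.
rewrite g0 subr0 in pE.
case: d hp hq qd => [|d] hp hq qd; first by rewrite pE qd// mulr0 eqxx in p0.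
rewrite addSn ltnS; apply: IHL hq _ _ => //.
  by apply: contraNneq p0 => q0; rewrite pE q0 mulr0.
by rewrite pE in ps; apply: slow_div ps.
Qed.

End SlowGrowth.

(** * Deletion and contraction: dimension bound and independence of products *)

Section BetaSets.
Variables (k : fieldType) (W : vectType k) (S : finType).
Implicit Types (v : S -> W) (L : seq S).

(* The recursion beta(N) = beta(N \ a) + beta(N / a), for [a] neither a loop  *)
(* nor a coloop; a set in the result contains [a] if [a] was deleted.         *)
Fixpoint beta_sets L v : seq {set S} :=
  if L isn't a :: L' then [::] else
  if v a \notin <<[seq v x | x <- L']>>%VS then [::] else
  if L' == [::] then [:: [set a]] else
  if v a == 0 then [::] else
  [seq a |: B | B <- beta_sets L' v] ++ beta_sets L' (quo (v a) \o v).

Lemma beta_sets_sub L v B : B \in beta_sets L v -> {subset B <= L}.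
Proof.
elim: L v B => //= a L IHL v B; case: ifP => // _.
case: eqP => [->|_]; first by rewrite mem_seq1 => /eqP -> x; rewrite !inE.
case: ifP => // _; rewrite mem_cat => /orP[/mapP[C CL ->] x|BL x xB].
  by rewrite 2!inE in_cons => /orP[->//|/(IHL _ _ CL) ->]; rewrite orbT.
by rewrite in_cons (IHL _ _ BL x xB) orbT.
Qed.

Lemma beta_sets_uniq L v : uniq L -> uniq (beta_sets L v).
Proof.
elim: L v => //= a L IHL v /andP[aL uL]; case: ifP => // _; case: ifP => // _.
case: ifP => // _; rewrite cat_uniq IHL// andbT; apply/andP; split.
  rewrite map_inj_in_uniq ?IHL// => B C BL CL /setP eqBC; apply/setP=> x.
  have := eqBC x; rewrite !inE; case: eqP => [-> _|//].
  have notin D : D \in beta_sets L v -> (a \in D) = false.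
    by move=> DL; apply: contraNF aL; apply: beta_sets_sub DL a.
  by rewrite !notin.
apply/hasPn => B BL; apply/mapP=> -[C _ BE].
by move: aL; rewrite (beta_sets_sub BL)// BE !inE eqxx.
Qed.

End BetaSets.

Section DimSlow.
Variables (k : fieldType) (W : vectType k) (S : finType).
Implicit Types (v : S -> W) (L : seq S).

(** Rank-nullity for reduction modulo [v a]: the image is slow for the contraction, and the kernel
    is [v a] times polynomials slow for the deletion. The assumption that d is at least the level
    survives, since contraction keeps the level and deletion lowers both the level and the degree by
    one. *)
Lemma dim_slow d L v (X : {vspace sympow d W}) :
    L != [::] -> (size L <= (d + \dim <<[seq v x | x <- L]>>).+1)%N ->
    {in X, forall x, slow v L (mpoly_of_dhomog x)} ->
  (\dim X <= size (beta_sets L v))%N.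
Proof.
elim: L v d X => // a L IHL v d X _ sL slowX.
have X0 : {in X, forall x, x = 0} -> (\dim X <= 0)%N.
  move=> x0; rewrite leqn0 dimv_eq0 -subv0; apply/subvP=> x /x0 ->.
  exact: mem0v.
rewrite /=; case: ifPn => [aL|]; first apply: X0 => x /slowX/(slow_coloop aL) x0.
  exact: val_inj.
rewrite negbK => aL.
have spanaL : <<v a :: [seq v x | x <- L]>>%VS = <<[seq v x | x <- L]>>%VS.
  by rewrite span_cons; apply/addv_idPr; rewrite -memvE.
rewrite [map _ _]/= spanaL /= ltnS in sL.
have [L0|L0] := eqVneq L [::].
  have [d0|d0] := posnP d.
    rewrite d0 in X slowX sL X0 *.
    pose one : sympow 0 W := DHomog (@dhomog1 _ k (mdeg : measure _)).
    apply: (leq_trans _ (leq_b1 (one != 0))); rewrite -dim_vline.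
    apply: dimvS; apply/subvP=> x _; apply/vlineP; exists (mpoly_of_dhomog x)@_0%MM.
    apply/val_inj/mpolyP=> m /=; rewrite mcoeffZ mcoeff1.
    have [->|m0] := eqVneq m 0%MM; first by rewrite mulr1.
    rewrite mulr0; apply: (dhomog_nemf_coeff (dhomog_is_dhomog x)).
    by rewrite /= mdeg_eq0.
  apply: leq_trans (leq0n _); apply: X0 => x /slowX slowx; apply/val_inj/eqP.
  apply: contraTT d0 => x0; rewrite -leqNgt leqn0; apply/eqP.
  apply: (restr_const (dhomog_is_dhomog x) _ x0) => eta; have := slowx eta.
  move: aL; rewrite L0 span_nil memv0 => /eqP a0.
  by rewrite /mcount/= a0 linear0 eqxx.
have [a0|a0] := eqVneq (v a) 0.
  apply: X0 => x /slowX/(slow_loop a0) slowx; apply/val_inj/eqP.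
  apply: contraTT sL => x0; rewrite -ltnNge.
  exact: slow_degree (dhomog_is_dhomog x) x0 slowx.
have [|F FE] := @hom_of_linear k (sympow d W) (sympow d W)
    (fun x => DHomog (push_homog (quo (v a)) (dhomog_is_dhomog x))).
  by move=> c x y; apply/val_inj; rewrite /= -mul_mpolyC rmorphD rmorphM /= pushC mul_mpolyC.
rewrite size_cat size_map -(limg_ker_dim F X) leq_add//; last first.
  apply: (IHL _ d) => // [|_ /memv_imgP[x xX ->]]; last first.
    by rewrite FE; apply/slow_quo/slowX.
  rewrite span_map_lfun dim_limg_quo// -addnS prednK//.
  by rewrite lt0n dimv_eq0; apply: contraNneq a0 => aL0; rewrite -memv0 -aL0.
(* In degree 0 the reduction is injective, so the kernel is zero. *)
case: d X slowX sL X0 F FE => [|d] X slowX sL X0 F FE.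
  suff -> : (X :&: lker F = 0)%VS by rewrite dimv0.
  apply/eqP; rewrite -subv0; apply/subvP=> x; rewrite memv_cap memv_ker FE memv0.
  move=> /andP[_ /eqP/(congr1 val)/= x0]; apply/eqP/val_inj => /=.
  have [q [pE _ qd]] := push_div (sub_quo (v a)) (dhomog_is_dhomog x).
  by rewrite x0 subr0 qd// mulr0 in pE.
have hmul (y : sympow d W) : linform (v a) * mpoly_of_dhomog y \is d.+1.-homog.
  by rewrite -add1n; apply: dhomogM (linform_homog _) (dhomog_is_dhomog y).
(* [G] is multiplication by [v a]. By [push_div] every kernel element lies in its image, so the
   preimage under [G] has at least the dimension of the kernel. *)
have [|G GE] := @hom_of_linear k (sympow d W) (sympow d.+1 W) (fun y => DHomog (hmul y)).
  by move=> c x y; apply/val_inj; rewrite /= mulrDr scalerAr.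
apply: (@leq_trans (\dim (G @^-1: (X :&: lker F)))%VS).
  rewrite -(limg_ker_dim G (G @^-1: _)); apply: leq_trans (leq_addl _ _).
  apply: dimvS; apply/subvP=> x xXF; have := xXF.
  rewrite memv_cap memv_ker FE => /andP[_ /eqP/(congr1 val)/= x0].
  have [q [pE hq _]] := push_div (sub_quo (v a)) (dhomog_is_dhomog x).
  rewrite x0 subr0 in pE.
  have xE : x = G (DHomog hq) by rewrite GE; apply/val_inj.
  by rewrite xE; apply: memv_img; rewrite -memv_preim -xE.
apply: (IHL _ d) => // y; rewrite -memv_preim memv_cap GE => /andP[/slowX slowy _].
exact: slow_div slowy.
Qed.

End DimSlow.

Section BetaSetsOrdered.
Variables (k : fieldType) (W : vectType k) (disp : Order.disp_t).
Variable S : finOrderType disp.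
Implicit Types (v : S -> W) (L : seq S) (B : {set S}).

(** When the recursion reaches a, the larger elements outside B have been contracted and those in B
    deleted. The two span conditions say that a is then not a loop, unless a = m, and not a coloop.
    The last element m has to be a loop. *)
Lemma beta_setsP L v B m :
    sorted >%O L -> B \in beta_sets L v -> m \in L -> {in L, forall x, (m <= x)%O} ->
  [/\ m \in B,
      {in L, forall a, a != m ->
         v a \notin <<[seq v x | x <- L & (a < x)%O && (x \notin B)]>>%VS}
    & {in L, forall a,
         v a \in <<[seq v x | x <- L & (x < a)%O || (a < x)%O && (x \notin B)]>>%VS}].
Proof.
elim: L v B => //= a L IHL v B; rewrite (path_sortedE (rev_trans lt_trans)).
move=> /andP[/allP/= aL sL].
case: ifPn => //; rewrite negbK => va; case: eqP => [L0|/eqP L0].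
  rewrite mem_seq1 => /eqP -> mL _; rewrite L0 in mL va *.
  have {mL}-> : m = a by apply/eqP; rewrite mem_seq1 in mL.
  rewrite span_nil memv0 in va.
  by split=> [|x|x]; rewrite ?inE// => /eqP ->; rewrite ?eqxx//= (eqP va) mem0v.
case: ifPn => // a0 BL mL minm.
have ma : m != a.
  case: L L0 aL minm {IHL sL va BL mL} => // c L _ aL minm.
  apply: contraTneq (minm c _) => [->|]; last by rewrite !inE eqxx orbT.
  by rewrite -ltNge aL// mem_head.
have {}mL : m \in L by move: mL; rewrite inE (negPf ma).
have {}minm : {in L, forall x, (m <= x)%O} by move=> x xL; rewrite minm// inE xL orbT.
have naL x : x \in L -> (x == a) = false.
  by move=> xL; apply: contraTF (aL _ xL) => /eqP ->; rewrite ltxx.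
have La x : x \in L -> (a < x)%O = false.
  by move=> xL; apply: lt_gtF; apply: aL.
have head_a : forall Q : pred S, (forall x, x \in L -> Q x = false) -> [seq x <- L | Q x] = [::].
  move=> Q QF; apply/eqP; rewrite -[_ == _]negbK -has_filter.
  by apply/hasPn => x /QF ->.
have spana : v a \in <<[seq v x | x <- [seq x <- L | (x < a)%O || (a < x)%O && (x \notin B)]]>>%VS.
  by rewrite (eq_in_filter (a2 := predT)) ?filter_predT// => x xL /=; rewrite aL.
move: BL; rewrite mem_cat => /orP[/mapP[C CL BE]|BL].
  have [mC E2 E3] := IHL _ _ sL CL mL minm.
  have BC x : x \in L -> (x \in B) = (x \in C) by move=> xL; rewrite BE !inE naL.
  have aB : a \in B by rewrite BE !inE eqxx.
  split=> [|c|c]; first by rewrite BC.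
    rewrite inE => /orP[/eqP -> _|cL cm].
      by rewrite ltxx /= head_a ?span_nil ?memv0// => x xL; rewrite La.
    rewrite aB andbF /= (eq_in_filter (a2 := fun x => (c < x)%O && (x \notin C))).
      exact: E2.
    by move=> x xL; rewrite BC.
  rewrite inE => /orP[/eqP ->|cL]; first by rewrite ltxx.
  rewrite aB andbF orbF La// (eq_in_filter
    (a2 := fun x => (x < c)%O || (c < x)%O && (x \notin C))); first exact: E3.
  by move=> x xL; rewrite BC.
have [mC E2 E3] := IHL _ _ sL BL mL minm.
have aB : a \notin B.
  by apply/negP => /(beta_sets_sub BL) aL'; have := naL _ aL'; rewrite eqxx.
split=> [//|c|c].
  rewrite inE => /orP[/eqP -> _|cL cm].
    by rewrite ltxx /= head_a ?span_nil ?memv0// => x xL; rewrite La.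
  by rewrite aL// aB /= -mem_quo_span E2.
rewrite inE => /orP[/eqP ->|cL]; first by rewrite ltxx.
by rewrite aL// aB orbT /= -mem_quo_span E3.
Qed.

(* Each [w B x] is led by [v x]: modulo the [v a] of largest [a], a product   *)
(* vanishes or not according to whether [a] is in [B], which separates the    *)
(* two kinds of products; then [v a] can be cancelled.                        *)
Lemma triangular_products_free L v (Bs : {set {set S}}) (w : {set S} -> S -> W)
    (c : {set S} -> k) :
    sorted >%O L ->
    {in Bs &, forall B C : {set S}, {in L, B =i C} -> B = C} ->
    {in Bs, forall B : {set S}, {in L, forall x, x \in B ->
       let X := <<[seq v y | y <- L & (x < y)%O && (y \notin B)]>>%VS in
       v x \notin X /\ exists2 d, d != 0 & w B x - d *: v x \in X}} ->
    \sum_(B in Bs) c B *: \prod_(x <- L | x \in B) linform (w B x) = 0 ->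
  {in Bs, forall B, c B = 0}.
Proof.
elim: L v Bs w c => [|a L IHL] v Bs w c.
  move=> _ BsI _ sum0 B BBs; move: sum0; rewrite (bigD1 B)//= big_nil.
  rewrite big1 => [|C /andP[CBs /negP]]; last by case; apply/eqP/BsI.
  rewrite addr0 => /eqP; rewrite -mul_mpolyC mulr1 mpolyC_eq0 => /eqP //.
rewrite /= (path_sortedE (rev_trans lt_trans)) => /andP[/allP/= aL sL] BsI wP sum0.
have naL x : x \in L -> (x == a) = false.
  by move=> xL; apply: contraTF (aL _ xL) => /eqP ->; rewrite ltxx.
have La x : x \in L -> (a < x)%O = false.
  by move=> xL; apply: lt_gtF; apply: aL.
have wa B : B \in Bs -> a \in B -> v a != 0 /\ exists2 d, d != 0 & w B a = d *: v a.
  move=> BBs aB; have := wP B BBs a (mem_head _ _) aB.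
  rewrite ltxx /= (_ : [seq y <- L | (a < y)%O && (y \notin B)] = [::]) ?span_nil.
    by rewrite !memv0 => -[? [d d0]]; rewrite memv0 subr_eq0 => /eqP; split=> //; exists d.
  apply/eqP; rewrite -[_ == _]negbK -has_filter; apply/hasPn => x xL.
  by rewrite La.
pose Bs1 := [set B in Bs | a \notin B]; pose Bs2 := [set B in Bs | a \in B].
have c1 : {in Bs1, forall B, c B = 0}.
  apply: (IHL (quo (v a) \o v) Bs1 (fun B x => quo (v a) (w B x)) c) => //.
  - move=> B C; rewrite !inE => /andP[BBs aB] /andP[CBs aC] BC; apply: BsI => // x.
    by rewrite inE => /orP[/eqP ->|/BC//]; rewrite (negPf aB) (negPf aC).
  - move=> B; rewrite inE => /andP[BBs aB] x xL xB.
    have := wP B BBs x; rewrite inE xL orbT aL//= aB => /(_ isT xB)[vx [d d0 wx]].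
    split; first by rewrite mem_quo_span.
    by exists d => //; rewrite /= -linearZ -linearB mem_quo_span.
  - have := congr1 (push (quo (v a))) sum0; rewrite rmorph0 rmorph_sum /=.
    rewrite (bigID (fun B : {set S} => a \in B))/= big1 ?add0r.
      move=> sum1; rewrite -[RHS]sum1; apply: eq_big => [B|B]; first by rewrite inE.
      rewrite inE => /andP[BBs aB]; rewrite big_cons (negPf aB).
      rewrite -!mul_mpolyC rmorphM /= pushC rmorph_prod; congr (_ * _).
      by apply: eq_bigr => x _; rewrite /= push_linform.
    move=> B /andP[BBs aB]; have [_ [d d0 waE]] := wa B BBs aB.
    rewrite big_cons aB -mul_mpolyC !rmorphM /= push_linform waE linearZ /= quo_id.
    by rewrite scaler0 linear0 mul0r mulr0.
have c2 : {in Bs2, forall B, c B = 0}.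
  have [->|[B0]] := set_0Vmem Bs2; first by move=> B; rewrite inE.
  rewrite inE => /andP[B0Bs aB0]; have [va0 _] := wa _ B0Bs aB0.
  have /fin_all_exists[d dP] (B : {set S}) : exists d, B \in Bs2 -> d != 0 /\ w B a = d *: v a.
    have [|] := boolP (B \in Bs2); last by exists 0.
    by rewrite inE => /andP[BBs aB]; have [_ [d d0 waE]] := wa B BBs aB; exists d.
  (* The leading scalars [d B] are absorbed into the coefficients, so that [v a] can be
     cancelled. *)
  suff cd : {in Bs2, forall B, c B * d B = 0}.
    move=> B BBs; have [d0 _] := dP B BBs.
    by have /eqP := cd B BBs; rewrite mulf_eq0 (negPf d0) orbF => /eqP.
  apply: (IHL v Bs2 w (fun B => c B * d B)) => //.
  - move=> B C; rewrite !inE => /andP[BBs aB] /andP[CBs aC] BC; apply: BsI => // x.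
    by rewrite inE => /orP[/eqP ->|/BC//]; rewrite aB aC.
  - move=> B; rewrite inE => /andP[BBs aB] x xL xB.
    by have := wP B BBs x; rewrite inE xL orbT /= aB andbF => /(_ isT xB).
  - move: sum0; rewrite (bigID (fun B : {set S} => a \in B))/= [X in _ + X]big1 ?addr0.
      move=> sum2; apply: (mulfI (x := linform (v a))); first by rewrite linform_eq0.
      rewrite mulr0 -[RHS]sum2 mulr_sumr; apply: eq_big => [B|B]; first by rewrite inE.
      move=> BBs2; have [_ waE] := dP B BBs2.
      move: BBs2; rewrite inE => /andP[BBs aB]; rewrite big_cons aB waE linearZ /=.
      by rewrite -scalerAl scalerA scalerAr.
    by move=> B BBs; rewrite c1 ?scale0r// inE.
move=> B BBs; have [aB|aB] := boolP (a \in B); [apply: c2|apply: c1]; by rewrite inE BBs.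
Qed.

End BetaSetsOrdered.

(** * Chains of a simplicial complex *)

Section AlternatingSums.
Variables (k : fieldType) (V : lmodType k) (T : eqType).
Implicit Types (s : seq T) (g : seq T -> V).

Definition del i s : seq T := take i s ++ drop i.+1 s.

(** The simplicial boundary formula for an arbitrary function of vertex lists; it serves for partial
    block sums as well as for simplices. *)
Definition altsum g s : V := \sum_(i < size s) (-1) ^+ i *: g (del i s).

Lemma altsum_cons g x s : altsum g (x :: s) = g s - altsum (g \o cons x) s.
Proof.
rewrite /altsum big_ord_recl /= scale1r /del /= drop0 -sumrN; congr (_ + _).
by apply: eq_bigr => i _; rewrite /= exprS mulN1r scaleNr.
Qed.

Lemma altsum_cat g p s :
  altsum g (p ++ s) =
  altsum (g \o cat^~ s) p + (-1) ^+ size p *: altsum (g \o cat p) s.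
Proof.
elim: p g => [|x p IHp] g; first by rewrite {2}/altsum big_ord0 add0r scale1r.
rewrite cat_cons !altsum_cons IHp /= opprD addrA; congr (_ + _).
by rewrite exprS mulN1r scaleNr.
Qed.

Lemma altsum_altsum g s : altsum (altsum g) s = 0.
Proof.
elim: s g => [|x s IHs] g; first by rewrite /altsum big_ord0.
rewrite altsum_cons; apply/eqP; rewrite subr_eq0; apply/eqP.
transitivity (altsum g s - altsum (altsum (g \o cons x)) s).
  by rewrite IHs subr0.
rewrite /altsum -sumrB; apply: eq_bigr => i _; rewrite -scalerBr; congr (_ *: _).
by rewrite /= -altsum_cons.
Qed.

Lemma perm_del x0 i s : (i < size s)%N -> perm_eq s (nth x0 s i :: del i s).
Proof.
move=> ltis; rewrite -{1}(cat_take_drop i s) (drop_nth x0 ltis).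
by rewrite -cat1s perm_catCA.
Qed.

Lemma del_subseq i s : subseq (del i s) s.
Proof.
rewrite -{2}(cat_take_drop i s) cat_subseq// -[i.+1]add1n -drop_drop.
exact: drop_subseq.
Qed.

End AlternatingSums.

Section Boundary.
Variables (k : fieldType) (disp : Order.disp_t) (S : finOrderType disp).
Implicit Types (s p : seq S) (bs : seq (seq S)).

(** Moving v to the front takes [index v s] transpositions, and in front it is inverted with exactly
    the smaller entries. *)
Lemma inversions_rem s v : uniq s -> v \in s ->
  odd (inversions s + count (fun y => (y < v)%O) s) = odd (index v s + inversions (rem v s)).
Proof.
elim: s => //= x s IHs /andP[xs us]; rewrite inE.
case: (eqVneq v x) => [-> _|vx /= vs]; first by rewrite ltxx ?eqxx add0n !oddD addbAC addbb.
rewrite /=.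
have := IHs us vs; rewrite !oddD (permP (perm_to_rem vs) (fun y => (y < x)%O)) /= oddD => IH.
have -> : (x < v)%O = ~~ (v < x)%O by rewrite -leNgt le_eqVlt eq_sym (negPf vx).
move: IH; move: (odd (count (fun y => (y < v)%O) s)) (odd (count _ (rem v s))).
move: (odd (inversions s)) (odd (index v s)) (odd (inversions (rem v s))).
by case: (v < x)%O => -[] [] [] [] [].
Qed.

Lemma index_rem_del x0 i s : uniq s -> (i < size s)%N -> del i s = rem (nth x0 s i) s.
Proof. by move=> us ltis; rewrite remE index_uniq. Qed.

(** Reconciles the sign of [bd_face], given by rank in the order of S, with the sign given by
    position in the list. *)
Lemma bd_simplex s : uniq s -> bd k S (simplex k s) = altsum (@simplex k disp S) s.
Proof.
move=> us; rewrite {1}/simplex us linearZ /= bd_faceE /bd_face scaler_sumr.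
case: s us => [|x0 s0]; first by rewrite /altsum big_ord0 big1// => x; rewrite inE.
set s := x0 :: s0 => us.
transitivity (\sum_(v <- s) (-1) ^+ index v s *: simplex k (rem v s)); last first.
  rewrite (big_nth x0) big_mkord /altsum; apply: eq_bigr => i _.
  by rewrite -index_rem_del// index_uniq.
rewrite [RHS]big_uniq//.
rewrite big_mkcond [RHS]big_mkcond; apply: eq_bigr => v _; rewrite inE.
case: ifPn => // vs; rewrite /simplex rem_uniq// !scalerA -!exprD.
rewrite -[X in X *: _ = _]signr_odd -[X in _ = X *: _]signr_odd.
rewrite -inversions_rem//; congr (_ *: _).
  congr (_ ^+ _); congr (nat_of_bool (odd (_ + _))).
  rewrite -size_filter cardE; apply/perm_size/uniq_perm; rewrite ?enum_uniq ?filter_uniq//.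
  by move=> y; rewrite mem_enum mem_filter !inE andbC.
by congr face; apply/setP=> y; rewrite !inE mem_rem_uniq// inE.
Qed.

(** The block sum joins the simplex on the prefix with the boundaries of the blocks. The part of the
    boundary falling on a block is an [altsum] of an [altsum], hence 0; with an empty prefix nothing
    remains. *)
Lemma bd_block_sum p bs : uniq (p ++ flatten bs) ->
  bd k S (block_sum k p bs) = altsum (fun q => block_sum k q bs) p.
Proof.
elim: bs p => [|a bs IHbs] p /= u; first by rewrite cats0 in u; apply: bd_simplex.
have -> : \sum_(i < size a) (-1) ^+ i *: block_sum k (p ++ del i a) bs =
          altsum (fun q => block_sum k (p ++ q) bs) a by [].
rewrite linear_sum /=.
under eq_bigr => i _.
  rewrite linearZ /= IHbs; last first.
    rewrite -catA; apply: subseq_uniq u; rewrite cat_subseq// cat_subseq//.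
    exact: del_subseq.
  rewrite altsum_cat scalerDr; over.
rewrite big_split /= [X in _ + X](_ : _ = 0) ?addr0.
  rewrite /altsum; under eq_bigr do rewrite scaler_sumr.
  rewrite exchange_big; apply: eq_bigr => j _; rewrite scaler_sumr.
  by apply: eq_bigr => i _; rewrite !scalerA mulrC.
under eq_bigr do rewrite scalerA mulrC -scalerA.
rewrite -scaler_sumr.
rewrite (_ : \sum_i _ = 0) ?scaler0//.
exact: (altsum_altsum (fun q => block_sum k (p ++ q) bs) a).
Qed.

Definition weight (F : {set S}) : nat := \sum_(x in F) #|[set y : S | (y < x)%O]|.

Lemma weight_mono (x y : S) : (x < y)%O ->
  (#|[set z : S | (z < x)%O]| < #|[set z : S | (z < y)%O]|)%N.
Proof.
move=> xy; apply/proper_card/properP; split.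
  by apply/subsetP=> z; rewrite !inE => /lt_trans; apply.
by exists x; rewrite !inE ?ltxx.
Qed.

Lemma weight_seq s : uniq s ->
  weight [set x in s] = (\sum_(x <- s) #|[set y : S | (y < x)%O]|)%N.
Proof. by move=> us; rewrite big_uniq//=; apply: eq_bigl => x; rewrite inE. Qed.

Lemma simplexE s G : uniq s -> simplex k s G = (-1) ^+ inversions s * (G == [set x in s])%:R.
Proof. by move=> us; rewrite /simplex us !ffunE. Qed.

(** In [sigma_face] the size of q makes the face a facet, and the vertex missed in each block serves
    to exclude broken circuits. *)
Lemma block_sum_support p bs G : uniq (p ++ flatten bs) -> block_sum k p bs G != 0 ->
  exists q, [/\ G = [set x in p ++ q], uniq (p ++ q), {subset q <= flatten bs},
    size q = (\sum_(a <- bs) (size a).-1)%N &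
    forall a, a \in bs -> exists2 x, x \in a & x \notin q].
Proof.
elim: bs p => [|a bs IHbs] p /=.
  rewrite cats0 => up; rewrite simplexE// mulf_eq0 negb_or => /andP[_].
  case: (eqVneq G) => [-> _|_]; last by rewrite eqxx.
  by exists [::]; split=> //=; rewrite ?cats0 ?big_nil.
move=> u; rewrite sum_ffunE => sum0.
have [i] : exists i : 'I_(size a), block_sum k (p ++ del i a) bs G != 0.
  apply/existsP; apply: contraNT sum0; rewrite negb_exists => /forallP G0.
  rewrite big1// => i _; rewrite ffunE; have := G0 i; rewrite negbK => /eqP ->.
  exact: mulr0.
case: a i u {sum0} => [[]//|x0 a0]; set a := x0 :: a0 => i u.
have pa := perm_del x0 (ltn_ord i).
move=> /IHbs[|q [-> uq sq szq missq]].
  by rewrite -catA; apply: subseq_uniq u; rewrite !cat_subseq ?del_subseq.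
have [ua disj] : uniq a /\ {in flatten bs, forall x, x \notin a}.
  by move: u; rewrite !cat_uniq => /and5P[_ _ ua /hasPn].
have e : p ++ del i a ++ q = (p ++ del i a) ++ q by rewrite catA.
exists (del i a ++ q); rewrite e; split=> //.
- move=> x; rewrite mem_cat => /orP[/(mem_subseq (del_subseq i a)) xa|/sq xq].
    by rewrite mem_cat xa.
  by rewrite mem_cat xq orbT.
- rewrite size_cat szq big_cons; congr (_ + _)%N.
  by have := perm_size pa; rewrite /= => -[].
- move=> c; rewrite inE => /orP[/eqP ->|cbs].
    exists (nth x0 a i); first exact: mem_nth.
    rewrite mem_cat negb_or; apply/andP; split.
      by move: ua; rewrite (perm_uniq pa) => /andP[].
    by apply/negP => /sq/disj; rewrite mem_nth.
  have [x xc xq] := missq c cbs; exists x; rewrite // mem_cat negb_or xq andbT.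
  apply/negP => /(mem_subseq (del_subseq i a)); apply/negP/disj.
  by apply/flattenP; exists c.
Qed.

(** The first vertex of a sorted block has the smallest rank, so omitting it from every block gives
    the heaviest face. All other choices are strictly lighter and cannot cancel its coefficient. *)
Lemma block_sum_lead p bs : uniq (p ++ flatten bs) ->
    {in bs, forall a, a != [::] /\ sorted <%O a} ->
  let F := [set x in p ++ flatten [seq behead a | a <- bs]] in
  block_sum k p bs F != 0 /\
  forall G, block_sum k p bs G != 0 -> G = F \/ (weight G < weight F)%N.
Proof.
elim: bs p => [|a bs IHbs] p /=.
  rewrite cats0 => up _; rewrite simplexE// eqxx mulr1 signr_eq0; split=> // G.
  by rewrite simplexE//; case: (eqVneq G) => [->|]; [left | rewrite mulr0 eqxx].
move=> u bsP; have [] := bsP a (mem_head _ _).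
case: a u bsP => // t a u bsP _ sa.
have ub i : uniq ((p ++ del i (t :: a)) ++ flatten bs).
  by rewrite -catA; apply: subseq_uniq u; rewrite !cat_subseq ?del_subseq.
have IH i := IHbs _ (ub i) (fun c cbs => bsP c (mem_behead (s := (t :: a) :: bs) cbs)).
set q := flatten _ in IH *; have IH0 := IH 0%N; rewrite /del /= drop0 in IH0.
have ltF (i : 'I_(size a)) G : block_sum k (p ++ del i.+1 (t :: a)) bs G != 0 ->
    (weight G < weight [set x in p ++ a ++ q])%N.
  have uq : uniq (p ++ (t :: a) ++ q).
    apply: subseq_uniq u; rewrite !cat_subseq// /q;
      elim: bs {IHbs bsP ub IH IH0 q} => //= c bs IH.
    by rewrite cat_subseq//; case: c => //= x c; apply: subseq_cons.
  have pa := perm_del t (ltn_ord i : (i.+1 < size (t :: a))%N).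
  move=> /(proj2 (IH i.+1)) leF.
  apply: (@leq_ltn_trans (weight [set x in (p ++ del i.+1 (t :: a)) ++ q])).
    by case: leF => [->|/ltnW].
  rewrite !weight_seq; last 2 first.
  - by apply: subseq_uniq uq; rewrite cat_subseq ?subseq_cons.
  - by rewrite -catA; apply: subseq_uniq uq; rewrite !cat_subseq ?del_subseq.
  move: (del _ _) pa => d pa; rewrite !big_cat /= -addnA ltn_add2l ltn_add2r.
  have := perm_big _ pa (x := 0%N) (op := addn) (P := predT)
    (F := fun x : S => #|[set y : S | (y < x)%O]|).
  rewrite [LHS]big_cons [RHS]big_cons /= => eqa.
  rewrite -(ltn_add2l #|[set y : S | (y < t)%O]|) eqa ltn_add2r; apply: weight_mono.
  have /allP := order_path_min lt_trans sa; apply.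
  by rewrite mem_nth.
rewrite big_ord_recl /= scale1r ?take0 ?drop0 /=.

rewrite -catA in IH0.
split=> [|G].
  rewrite ffunE sum_ffunE big1 ?addr0; first exact: (proj1 IH0).
  move=> i _; rewrite ffunE; apply/eqP; rewrite mulf_eq0; apply/orP; right.
  by apply: contraT => /ltF; rewrite ltnn.
rewrite ffunE sum_ffunE.
have [G0|G0 _] := eqVneq (block_sum k (p ++ a) bs G) 0; last exact: (proj2 IH0).
rewrite G0 add0r => sum0; right.
have [i] : exists i : 'I_(size a), block_sum k (p ++ del i.+1 (t :: a)) bs G != 0.
  apply/existsP; apply: contraNT sum0; rewrite negb_exists => /forallP G0'.
  rewrite big1// => i _; rewrite ffunE; have := G0' i; rewrite negbK => /eqP E.
  by apply/eqP; rewrite mulf_eq0 -E eqxx orbT.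
exact: ltF.
Qed.

Lemma mem_span_face (X : {set {set S}}) (c : chain k S) :
  (c \in <<[seq face k F | F in X]>>%VS) = [forall G, (c G != 0) ==> (G \in X)].
Proof.
apply/idP/forallP => [/coord_span cE G|cX].
  apply/implyP; apply: contraNT => GX; rewrite cE sum_ffunE big1// => i _.
  have iX : (i < size (enum X))%N by rewrite -cardE.
  rewrite ffunE (nth_map set0)// ffunE; case: (eqVneq G) => [GE|_]; last exact: mulr0.
  by move: GX; rewrite GE -mem_enum mem_nth.
have -> : c = \sum_(G : {set S}) (c G : k) *: face k G.
  apply/ffunP=> G; rewrite sum_ffunE (bigD1 G)//= !ffunE eqxx big1 ?addr0.
    by rewrite /GRing.scale /= mulr1.
  move=> F FG; rewrite !ffunE eq_sym (negPf FG).
  by rewrite /GRing.scale /= mulr0.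
apply: rpred_sum => G _; have [->|cG] := eqVneq (c G : k) 0; first by rewrite scale0r mem0v.
by rewrite memvZ// memv_span//; apply: image_f; apply: implyP (cX G) cG.
Qed.

End Boundary.

(** * Vector configurations and represented matroids *)

Section VectorConfigurations.
Variables (k : fieldType) (W : vectType k) (S : finType) (v : S -> W).
Implicit Types (X Y C : {set S}) (mu : S -> k).

Definition spn X : {vspace W} := <<[seq v i | i in X]>>%VS.
Definition indp X : bool := free [seq v i | i in X].

Definition relation X mu := (forall i, i \notin X -> mu i = 0) /\ \sum_i mu i *: v i = 0.

Lemma mem_spn i X : i \in X -> v i \in spn X.
Proof. by move=> iX; apply/memv_span/image_f. Qed.

Lemma spn_sub X (Y : {vspace W}) : {in X, forall i, v i \in Y} -> (spn X <= Y)%VS.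
Proof. by move=> XY; apply/span_subvP => _ /imageP[i iX ->]; apply: XY. Qed.

Lemma spnS X Y : X \subset Y -> (spn X <= spn Y)%VS.
Proof. by move=> /subsetP XY; apply: spn_sub => i /XY; apply: mem_spn. Qed.

Lemma sum_supp X mu : (forall i, i \notin X -> mu i = 0) ->
  \sum_i mu i *: v i = \sum_(i in X) mu i *: v i.
Proof.
move=> mu0; rewrite [RHS]big_mkcond; apply: eq_bigr => i _.
by case: ifPn => // /mu0 ->; rewrite scale0r.
Qed.

Lemma memv_spn_sum X mu : (forall i, i \notin X -> mu i = 0) -> \sum_i mu i *: v i \in spn X.
Proof.
move=> mu0; rewrite (sum_supp mu0); apply: rpred_sum => i iX.
by rewrite memvZ// mem_spn.
Qed.

Lemma spnP X w : w \in spn X ->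
  exists2 mu, forall i, i \notin X -> mu i = 0 & w = \sum_i mu i *: v i.
Proof.
pose Y : {vspace W} := (\sum_(i in X) <[v i]>)%VS.
have sub : (spn X <= Y)%VS.
  by apply: spn_sub => i iX; apply: (subvP (sumv_sup i iX (subvv _))); rewrite memv_line.
move=> /(subvP sub) /memv_sumP[u uP ->].
have /fin_all_exists[c cP] (i : S) : exists c, i \in X -> u i = c *: v i.
  have [iX|_] := boolP (i \in X); last by exists 0.
  by have /vlineP[c ->] := uP i iX; exists c.
exists (fun i => if i \in X then c i else 0); first by move=> i /negPf ->.
rewrite big_mkcond; apply: eq_bigr => i _; case: ifP => [/cP //|_].
by rewrite scale0r.
Qed.

Lemma indpP X : reflect (forall mu, relation X mu -> forall i, mu i = 0) (indp X).
Proof.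
rewrite /indp; apply: (iffP idP) => [fX mu [mu0 sum0] i|H].
  have [iX|/mu0//] := boolP (i \in X).
  move: sum0; rewrite (sum_supp mu0) big_enum_val => sum0.
  have /freeP/(_ (fun j => mu (enum_val j))) := fX : free (image_tuple v X).
  rewrite -(enum_rankK_in iX iX); apply; rewrite -[RHS]sum0; apply: eq_bigr => j _.
  by rewrite /= (nth_map i) -?cardE// -/(enum_val _) -enum_val_nth.
suff: free (image_tuple v X) by [].
apply/freeP => c sum0 j.
pose mu i := if insub (index i (enum X)) is Some j then c j else 0 : k.
have muE j' : mu (enum_val j') = c j'.
  by rewrite /mu (enum_val_nth (enum_val j')) index_uniq ?enum_uniq -?cardE// valK.
rewrite -muE; apply: H; split=> [i iX|].
  by rewrite /mu insubN// -leqNgt cardE memNindex ?mem_enum.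
rewrite (sum_supp (X := X)); last first.
  by move=> i iX; rewrite /mu insubN// -leqNgt cardE memNindex ?mem_enum.
rewrite big_enum_val -[RHS]sum0; apply: eq_bigr => j' _; rewrite muE.
by rewrite /= (nth_map (enum_val j')) -?cardE// -enum_val_nth.
Qed.

Lemma indpS X Y : X \subset Y -> indp Y -> indp X.
Proof.
move=> /subsetP XY /indpP fY; apply/indpP => mu [mu0 sum0]; apply: fY.
by split=> // i iY; apply: mu0; apply: contra iY => /XY.
Qed.

Lemma relationS X Y mu : X \subset Y -> relation X mu -> relation Y mu.
Proof.
by move=> /subsetP XY [mu0 sum0]; split=> // i iY; apply: mu0; apply: contra iY => /XY.
Qed.

Lemma relation_supp X mu : relation X mu -> relation [set i | mu i != 0] mu.
Proof. by move=> [_ sum0]; split=> // i; rewrite inE negbK => /eqP. Qed.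

Lemma relation_spn X mu a : relation X mu -> mu a != 0 -> v a \in spn (X :\ a).
Proof.
move=> [mu0 sum0] a0.
have -> : v a = \sum_i (if i == a then 0 else - (mu a)^-1 * mu i) *: v i.
  move: sum0; rewrite (bigD1 a)//= => /(canRL (addrK _)); rewrite sub0r => E.
  rewrite [RHS](bigD1 a)//= eqxx scale0r add0r; apply: (scalerI a0).
  rewrite E scaler_sumr -sumrN; apply: eq_bigr => i /negPf ->.
  by rewrite scalerA mulrA mulrN mulfV// mulN1r scaleNr.
apply: memv_spn_sum => i; rewrite !inE negb_and negbK; case: eqP => //= _ /mu0 ->.
by rewrite mulr0.
Qed.

Lemma spn_relation X a : a \notin X -> v a \in spn X ->
  exists2 mu, relation (a |: X) mu & mu a = 1.
Proof.
move=> aX /spnP[mu mu0 vaE].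
exists (fun i => if i == a then 1 else - mu i); last by rewrite eqxx.
split=> [i|].
  by rewrite !inE negb_or => /andP[/negPf -> /mu0 ->]; rewrite oppr0.
rewrite (bigD1 a)//= eqxx scale1r vaE [X in X + _](bigD1 a)//= (mu0 a aX) scale0r add0r.
by rewrite -big_split big1// => i /negPf -> /=; rewrite scaleNr subrr.
Qed.

Lemma indpU1 X a : a \notin X -> indp X -> v a \notin spn X -> indp (a |: X).
Proof.
move=> aX fX va; apply/indpP => mu mur.
have a0 : mu a = 0.
  by apply: contraNeq va => /(relation_spn mur); rewrite setU1K.
case: mur => mu0 sum0; apply/(indpP _ fX); split=> // i iX.
by have [->//|ia] := eqVneq i a; apply: mu0; rewrite !inE negb_or ia.
Qed.

Lemma indp_dim X : indp X -> \dim (spn X) = #|X|.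
Proof. by move=> /eqP ->; rewrite size_map -cardE. Qed.

Lemma dim_spn_le X : (\dim (spn X) <= #|X|)%N.
Proof. by apply: leq_trans (dim_span _) _; rewrite size_map -cardE. Qed.

Lemma indp_extend X Y : X \subset Y -> indp X ->
  exists Z : {set S}, [/\ X \subset Z, Z \subset Y, indp Z & spn Z = spn Y].
Proof.
move=> XY fX.
have [|Z /maxsetP[/andP[ZY fZ] maxZ] XZ] :=
  @maxset_exists _ (fun X => (X \subset Y) && indp X) X; first exact/andP.
exists Z; split=> //; apply/eqP; rewrite eqEsubv spnS//=.
apply: spn_sub => i iY; have [/mem_spn //|iZ] := boolP (i \in Z).
apply: contraNT iZ => vi; rewrite -[in X in _ \in X](maxZ (i |: Z)) ?setU11 ?subsetU1//.
by rewrite subUset sub1set iY ZY indpU1//; apply: contra vi => /mem_spn.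
Qed.

(** A nonzero relation on C vanishing at some i in C would live on [C :\ i], which is independent by
    minimality. *)
Lemma minset_relation C : minset (fun X => ~~ indp X) C ->
  exists mu, relation C mu /\ forall i, (mu i != 0) = (i \in C).
Proof.
move=> /minsetP[/indpP nC minC].
have [mu H] := not_all_ex_not _ _ nC.
have [murel {}H] := imply_to_and _ _ H; have [a a0] := not_all_ex_not _ _ H.
exists mu; split=> // i; apply/idP/idP; first by apply: contraR => /(proj1 murel) ->.
apply: contraTneq => i0; apply/negP => iC; move: (iC).
rewrite -(minC (C :\ i)) ?subD1set ?setD11//; apply/indpP => fC.
apply: a0; apply: fC; split; last by case: murel.
move=> j; rewrite !inE negb_and negbK => /orP[/eqP -> //|].
by case: murel => mu0 _ /mu0.
Qed.

End VectorConfigurations.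

Section OrderedSetLemmas.
Variables (disp : Order.disp_t) (S : finOrderType disp).
Implicit Types (x m : S) (X : {set S}).

Lemma is_minP x X : reflect (x \in X /\ {in X, forall y, (x <= y)%O}) (is_min x X).
Proof.
by apply: (iffP andP) => -[xX /forall_inP minx].
Qed.

Lemma is_min_exists X : X != set0 -> exists m, is_min m X.
Proof.
move=> /set0Pn[x xX]; case: (arg_minP id xX) => m mX minm.
by exists m; apply/is_minP; split=> // y /minm.
Qed.

Lemma remove_minE m X : is_min m X -> remove_min X = X :\ m.
Proof.
move=> /is_minP[mX minm]; apply/setP=> x; rewrite !inE andbC.
have [xX|] := boolP (x \in X); rewrite ?andbT ?andbF//=; congr (~~ _).
apply/is_minP/eqP => [[_ minx]|->//].
by apply/le_anti; rewrite minx// minm.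
Qed.

Lemma mem_sorted_elts x X : (x \in sorted_elts X) = (x \in X).
Proof. by rewrite mem_sort mem_enum. Qed.

Lemma sorted_elts_uniq X : uniq (sorted_elts X).
Proof. by rewrite sort_uniq enum_uniq. Qed.

Lemma sorted_elts_lt X : sorted <%O (sorted_elts X).
Proof. by rewrite lt_sorted_uniq_le sorted_elts_uniq sort_le_sorted. Qed.

Lemma size_sorted_elts X : size (sorted_elts X) = #|X|.
Proof. by rewrite size_sort cardE. Qed.

Lemma sorted_eltsU1 m X : {in X, forall x, (m < x)%O} ->
  sorted_elts (m |: X) = m :: sorted_elts X.
Proof.
move=> ltm; apply: lt_sorted_eq.
- exact: sorted_elts_lt.
- rewrite /= (path_sortedE lt_trans) sorted_elts_lt andbT.
  by apply/allP=> x; rewrite mem_sorted_elts => /ltm.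
- by move=> x; rewrite mem_sorted_elts !inE mem_sorted_elts.
Qed.

End OrderedSetLemmas.

(** * The represented matroid and its dual in terms of spans *)

Section RepresentedMatroid.
Variables (k : fieldType) (disp : Order.disp_t) (S : finOrderType disp).
Variables (U W : vectType k) (e : S -> U) (phi : 'Hom(U, W)) (A : {set S}).
Local Notation M := (rep_matroid e phi).
Local Notation N := (restriction M A).
Local Notation v := (fun i => phi (e i)).
Implicit Types (X B C : {set S}).

Lemma ground_restriction : ground N = A.
Proof. by rewrite /= setTI. Qed.

Lemma indep_restriction X : (X \in indep N) = indp v X && (X \subset A).
Proof. by rewrite !inE. Qed.

Lemma circuits_repP C : (C \in circuits M) = minset (fun X => ~~ indp v X) C.
Proof. by rewrite inE; apply: minset_eq => X; rewrite subsetT inE. Qed.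

Lemma circuitsP C : (C \in circuits N) = (C \subset A) && minset (fun X => ~~ indp v X) C.
Proof.
rewrite inE; apply/minsetP/andP => [[]|[CA /minsetP[nC minC]]].
  rewrite ?ground_restriction indep_restriction => /andP[CA]; rewrite CA andbT => nC minC.
  split=> //; apply/minsetP; split=> // X nX XC; apply: minC => //.
  by rewrite ?ground_restriction indep_restriction (subset_trans XC CA) andbT.
rewrite ?ground_restriction indep_restriction CA andbT; split=> // X.
by rewrite ?ground_restriction indep_restriction => /andP[->]; rewrite andbT => /minC.
Qed.

Lemma basesP B : reflect [/\ B \subset A, indp v B & spn v B = spn v A] (B \in bases N).
Proof.
rewrite inE; apply: (iffP idP) => [/maxsetP[]|[BA fB sB]]; last apply/maxsetP.
  rewrite ?ground_restriction indep_restriction => /and3P[BA fB _] maxB.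
  have [X [BX XA fX sX]] := indp_extend BA fB.
  have <- : X = B by apply: maxB => //; rewrite ?ground_restriction indep_restriction XA fX.
  by split.
rewrite ?ground_restriction indep_restriction BA fB; split=> // X.
rewrite ?ground_restriction indep_restriction => /and3P[XA fX _] BX.
apply/esym/eqP; rewrite eqEcard BX -!(@indp_dim _ _ _ v)// sB dimvS//.
exact: spnS.
Qed.

Lemma dual_indepP X : X \subset A ->
  (X \in indep (dual_matroid N)) = (spn v (A :\: X) == spn v A).
Proof.
move=> XA; rewrite inE; apply/existsP/eqP => [[B /andP[/basesP[BA fB sB] XB]]|sX].
  apply/eqP; rewrite eqEsubv spnS ?subsetDl//= -sB spnS//.
  apply/subsetP=> x xB; rewrite inE (subsetP BA x xB) andbT.
  by apply: contraTN xB => /(subsetP XB); rewrite !inE => /andP[].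
have [|B [_ BX fB sB]] := @indp_extend _ _ _ v set0 (A :\: X) (sub0set _).
  by apply/indpP => mu [mu0 _] i; apply: mu0; rewrite inE.
exists B; apply/andP; split; first by apply/basesP; split;
  rewrite ?sB// (subset_trans BX) ?subsetDl.
rewrite ?ground_restriction subsetD XA disjoint_sym.
by apply: disjointWl BX _; rewrite disjoints_subset setDE subsetIr.
Qed.

Definition cobasis B := [/\ B \subset A, indp v (A :\: B) & spn v (A :\: B) = spn v A].

Lemma dual_basesP B : reflect (cobasis B) (B \in bases (dual_matroid N)).
Proof.
have gd : ground (dual_matroid N) = A by rewrite /= setTI.
rewrite inE; apply: (iffP idP) => [/maxsetP[]|[BA fB sB]]; last apply/maxsetP.
  rewrite ?gd => /andP[BA Bi] maxB; have := Bi.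
  rewrite inE => /existsP[B0 /andP[B0b]]; rewrite ?ground_restriction => BB0.
  have [B0A fB0 sB0] := basesP _ B0b.
  have DDB0 : A :\: (A :\: B0) = B0 by rewrite setDDr setDv set0U (setIidPr B0A).
  have EB : A :\: B0 = B.
    apply: maxB => //; rewrite ?gd subsetDl/= inE; apply/existsP; exists B0.
    by rewrite B0b /= ?setTI subxx.
  by rewrite /cobasis -EB DDB0; split=> //; apply: subsetDl.
rewrite ?gd BA dual_indepP// sB eqxx; split=> // X.
rewrite ?gd => /andP[XA]; rewrite dual_indepP// => /eqP sX BX.
apply/esym/eqP; rewrite eqEsubset BX /=; apply/subsetP=> x xX.
apply: contraT => xB; have xA := subsetP XA x xX.
have := mem_spn v xA; rewrite -sX => /(subvP (spnS v _)) vx.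
have {}vx : v x \in spn v ((A :\: B) :\ x).
  apply: vx; apply/subsetP=> y; rewrite !inE => /andP[yX ->]; rewrite andbT.
  by apply/andP; split; [apply: contraNneq yX => -> | apply: contra yX => /(subsetP BX)].
have [mu mur mux] := spn_relation (negbT (setD11 _ _)) vx.
have xAB : x \in A :\: B by rewrite inE xB.
rewrite setD1K// in mur; have := indpP _ _ fB _ mur x.
by rewrite mux => /eqP; rewrite oner_eq0.
Qed.

Lemma dual_circuitsP C : (C \in circuits (dual_matroid N)) =
  minset (fun X => (X \subset A) && (spn v (A :\: X) != spn v A)) C.
Proof.
rewrite inE; apply: minset_eq => X; rewrite (_ : ground _ = A); last by rewrite /= setTI.
by have [XA|//] := boolP (X \subset A); rewrite dual_indepP.
Qed.

End RepresentedMatroid.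

(** * The relations attached to a basis of the dual *)

Section FundamentalRelations.
Variables (k : fieldType) (disp : Order.disp_t) (S : finOrderType disp).
Variables (U W : vectType k) (e : S -> U) (phi : 'Hom(U, W)) (A : {set S}).
Local Notation M := (rep_matroid e phi).
Local Notation N := (restriction M A).
Local Notation v := (fun i => phi (e i)).
Implicit Types (X B C : {set S}) (kap : S -> S -> k).

(* The support of [kap b] is the fundamental circuit c(B,b). *)
Definition fundamental B kap := {in B, forall b,
  relation v (b |: (A :\: B)) (kap b) /\ kap b b = 1}.

Lemma fundamental_exists B : cobasis e phi A B -> exists kap, fundamental B kap.
Proof.
move=> [BA fB sB].
have /fin_all_exists[kap kapP] b : exists mu : S -> k, b \in B ->
    relation v (b |: (A :\: B)) mu /\ mu b = 1.
  have [bB|] := boolP (b \in B); last by exists (fun=> 0).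
  have [||mu] := @spn_relation _ _ _ v (A :\: B) b.
  - by rewrite inE bB.
  - by rewrite sB mem_spn// (subsetP BA).
  - by exists mu.
by exists kap => b; apply: kapP.
Qed.

Variables (B : {set S}) (kap : S -> S -> k).
Hypotheses (cB : cobasis e phi A B) (kapP : fundamental B kap).

Lemma fundamental_sub b : b \in B -> b |: (A :\: B) \subset A.
Proof.
by case: cB => BA _ _ bB; rewrite subUset sub1set (subsetP BA)//= subsetDl.
Qed.

Lemma fundamental_relation b : b \in B -> relation v A (kap b).
Proof.
by move=> bB; have [/relationS + _] := kapP bB; apply; apply: fundamental_sub.
Qed.

Lemma fundamental_offdiag b b' : b \in B -> b' \in B -> b' != b -> kap b b' = 0.
Proof.
move=> bB b'B b'b; have [[kap0 _] _] := kapP bB; apply: kap0.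
by rewrite !inE negb_or b'b b'B.
Qed.

(** The [kap b] are a basis of the relations on A, with the values on B as coordinates: the
    difference of the two sides is a relation on the independent set [A :\: B]. *)
Lemma fundamental_expand mu : relation v A mu ->
  forall a, mu a = \sum_(b in B) mu b * kap b a.
Proof.
move=> murel a; apply/eqP; rewrite -subr_eq0; apply/eqP.
pose nu a := mu a - \sum_(b in B) mu b * kap b a.
case: cB => BA /indpP/(_ nu) + _; apply; split=> [i|].
  rewrite !inE negb_and negbK /nu => /orP[iB|iA].
    rewrite (bigD1 i)//= (proj2 (kapP iB)) mulr1 big1 ?addr0 ?subrr// => b /andP[bB bi].
    by rewrite fundamental_offdiag ?mulr0// eq_sym.
  case: murel => mu0 _; rewrite mu0// big1 ?subr0// => b bB.
  by rewrite (proj1 (fundamental_relation bB))// mulr0.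
rewrite /nu; under eq_bigr do rewrite scalerBl.
rewrite sumrB (proj2 murel) sub0r; under eq_bigr do rewrite scaler_suml.
rewrite exchange_big big1 ?oppr0// => b bB /=; under eq_bigr do rewrite -scalerA.
by rewrite -scaler_sumr (proj2 (fundamental_relation bB)) scaler0.
Qed.

Lemma relation_at_b b mu : b \in B -> relation v (b |: (A :\: B)) mu ->
  forall a, mu a = mu b * kap b a.
Proof.
move=> bB murel a; rewrite (fundamental_expand (relationS (fundamental_sub bB) murel)).
rewrite (bigD1 b)//= big1 ?addr0// => c /andP[cB' cb]; rewrite (proj1 murel) ?mul0r//.
by rewrite !inE negb_or cb cB'.
Qed.

Lemma fund_circuit_in b : b \in B ->
  fund_circuit N B b \in circuits N /\ fund_circuit N B b \subset b |: (A :\: B).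
Proof.
move=> bB; rewrite /fund_circuit ground_restriction; case: pickP => [C /andP[] //|noC].
have [krel kb1] := kapP bB.
have [|C minC Csub] := @minset_exists _ (fun X => ~~ indp v X) (b |: (A :\: B)).
  apply/negP => /indpP/(_ _ krel b) kb0; move/eqP: kb1.
  by rewrite kb0 eq_sym oner_eq0.
have /= := noC C; rewrite circuitsP minC Csub !andbT.
by rewrite (subset_trans Csub (fundamental_sub bB)).
Qed.

Lemma fund_circuitE b : b \in B -> fund_circuit N B b = [set a | kap b a != 0].
Proof.
move=> bB; have [] := fund_circuit_in bB; move: (fund_circuit _ _ _) => C.
rewrite circuitsP => /andP[_ minC] CbA; have [mu [murel muC]] := minset_relation minC.
have muE := relation_at_b bB (relationS CbA murel).
have b0 : mu b != 0.
  apply/eqP => b0; have /minsetP[/negP + _] := minC; apply; apply/indpP.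
  suff C0 : C = set0 by move=> nu [nu0 _] i; rewrite nu0// C0 inE.
  by apply/setP=> a; rewrite -muC muE b0 mul0r eqxx inE.
by apply/setP=> a; rewrite -muC muE mulf_eq0 negb_or b0 inE.
Qed.

Lemma fund_circuit_circuit b : b \in B -> [set a | kap b a != 0] \in circuits N.
Proof. by move=> bB; rewrite -fund_circuitE//; case: (fund_circuit_in bB). Qed.

(** If a is outside B, the dual circuit through a inside B + a has a smaller element b, else B would
    contain its broken circuit. Conversely, let C be a dual circuit with C - c0 inside B, where c0 =
    min C. A circuit c(B,b) through c0 with b < c0 would meet C in c0 alone, which is impossible. *)
Lemma nbc_cobasisP :
  reflect {in A :\: B, forall a, exists b, [/\ b \in B, (b < a)%O & kap b a != 0]}
    (no_broken_circuit (dual_matroid N) B).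
Proof.
case: (cB) => BA fB sB.
apply: (iffP forall_inP) => [nbcB a aAB|nbcB _ /imsetP[C Cc ->]].
  have [aA aB] : a \in A /\ a \notin B by move: aAB; rewrite inE => /andP[].
  (* X is dependent in the dual: a relation through a is nonzero at some b in B with a in c(B,b). *)
  pose X := a |: [set b in B | kap b a != 0].
  have XA : X \subset A.
    rewrite subUset sub1set aA; apply/subsetP=> b; rewrite inE => /andP[bB _].
    exact: (subsetP BA).
  have nX : spn v (A :\: X) != spn v A.
    apply: contraTN (mem_spn v aA) => /eqP <-; apply/negP => va.
    have [|nu nurel nua] := spn_relation _ va; first by rewrite !inE eqxx.
    have subA : a |: (A :\: X) \subset A by rewrite subUset sub1set aA subsetDl.
    have := fundamental_expand (relationS subA nurel) a; rewrite nua big1.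
      by move/eqP; rewrite oner_eq0.
    move=> b bB; have [->|kb] := eqVneq (kap b a) 0; first by rewrite mulr0.
    rewrite (proj1 nurel) ?mul0r// !inE bB kb orbT /= orbF.
    by apply: contraNneq aB => <-.
  have [|C minC CX] := @minset_exists _
      (fun X => (X \subset A) && (spn v (A :\: X) != spn v A)) X; first by rewrite XA.
  have Cc : C \in circuits (dual_matroid N) by rewrite dual_circuitsP.
  have aC : a \in C.
    apply: contraTT minC => aC; apply/negP => /minsetP[/andP[_ /negP +] _]; apply.
    rewrite eqEsubv spnS ?subsetDl//= -sB spnS// setDS//; apply/subsetP=> x xC.
    have := subsetP CX x xC; rewrite !inE => /orP[/eqP xa|/andP[]//].
    by rewrite -xa xC in aC.
  have [/existsP[b /andP[bC ba]]|] := boolP [exists b, (b \in C) && (b < a)%O].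
    exists b; have := subsetP CX b bC; rewrite !inE => /orP[/eqP ab|/andP[bB kb]].
      by rewrite ab ltxx in ba.
    by split.
  rewrite negb_exists => /forallP mina.
  have /negP[] := nbcB _ (imset_f _ Cc); rewrite (@remove_minE _ _ a); last first.
    apply/is_minP; split=> // y yC; have := mina y; rewrite yC /=.
    by rewrite -leNgt.
  apply/subsetP=> x; rewrite !inE => /andP[xa /(subsetP CX)].
  by rewrite !inE (negPf xa) => /andP[].
apply/negP => CB.
move: Cc; rewrite dual_circuitsP => /minsetP[/andP[CA nC] _].
have C0 : C != set0 by apply: contraNneq nC => ->; rewrite setD0.
have [c0 /[dup] c0min /is_minP[c0C minc0]] := is_min_exists C0.
rewrite (remove_minE c0min) in CB.
have CD : A :\: B :\ c0 \subset A :\: C.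
  apply/subsetP=> x; rewrite !inE => /and3P[xc0 xB ->]; rewrite andbT.
  by apply: contra xB => xC; apply: (subsetP CB); rewrite !inE xc0.
have c0B : c0 \notin B.
  apply: contra nC => c0B; rewrite eqEsubv spnS ?subsetDl//= -sB spnS//.
  by apply: setDS; rewrite -(setD1K c0C) subUset sub1set c0B.
have c0AB : c0 \in A :\: B by rewrite inE c0B (subsetP CA).
have [b [bB bc0 kb]] := nbcB c0 c0AB.
have bC : b \notin C by apply: contraTN bc0 => bC; rewrite -leNgt minc0.
have vc0 : v c0 \in spn v (A :\: C).
  have := relation_spn (proj1 (kapP bB)) kb; apply/subvP/spnS/subsetP => x.
  rewrite !inE => /andP[xc0 /orP[/eqP ->|/andP[xB]]].
    by rewrite bC (subsetP BA).
  move=> xA; have : x \in A :\: C by apply: (subsetP CD); rewrite !inE xc0 xB.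
  by rewrite !inE.
move/negP: nC; apply; rewrite eqEsubv spnS ?subsetDl//= -sB.
apply: spn_sub => x xAB; have [->//|xc0] := eqVneq x c0.
by apply: mem_spn; apply: (subsetP CD); rewrite in_setD1 xc0.
Qed.

End FundamentalRelations.

(** * Membership in beta nbc and faces of the reduced complex *)

Section BetaNbcBases.
Variables (k : fieldType) (disp : Order.disp_t) (S : finOrderType disp).
Variables (U W : vectType k) (e : S -> U) (phi : 'Hom(U, W)) (A : {set S}) (m : S).
Local Notation M := (rep_matroid e phi).
Local Notation N := (restriction M A).
Local Notation v := (fun i => phi (e i)).
Implicit Types (X B C F : {set S}) (kap : S -> S -> k).
Hypothesis mP : is_min m A.

Lemma min_le a : a \in A -> (m <= a)%O.
Proof. by case/is_minP: mP => _; apply. Qed.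

Lemma min_in : m \in A.
Proof. by case/is_minP: mP. Qed.

Lemma remove_min_dual : remove_min (ground (dual_matroid N)) = A :\ m.
Proof. by rewrite -(remove_minE mP) /= setTI. Qed.

Lemma beta_nbc_dualP B :
  reflect [/\ cobasis e phi A B, no_broken_circuit (dual_matroid N) B
            & {in B, forall b, b != m -> ~~ is_min b (fund_circuit N B b)}]
          (B \in beta_nbc_dual N).
Proof.
have gN : remove_min (ground N) = A :\ m by rewrite -(remove_minE mP) ground_restriction.
rewrite inE gN; apply: (iffP and3P) => -[].
  move=> /dual_basesP cB nbcB /forall_inP beta; split=> // b bB bm; apply: beta.
  by rewrite !inE bB bm; case: cB => /subsetP/(_ _ bB).
move=> cB nbcB beta; split=> //; first exact/dual_basesP.
by apply/forall_inP => b; rewrite !inE => /and3P[bB bm _]; apply: beta.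
Qed.

Lemma nbc_min B : cobasis e phi A B -> no_broken_circuit (dual_matroid N) B -> m \in B.
Proof.
move=> cB; have [kap kapP] := fundamental_exists cB; move=> /(nbc_cobasisP cB kapP) nbcB.
apply: contraT => nmB; have [|b [bB]] := nbcB m; first by rewrite inE nmB min_in.
by rewrite ltNge min_le//; case: cB => /subsetP/(_ _ bB).
Qed.

Lemma beta_not_min B kap b : fundamental e phi A B kap -> B \in beta_nbc_dual N ->
  b \in B -> b != m -> exists2 a, (a < b)%O & kap b a != 0.
Proof.
move=> kapP /beta_nbc_dualP[cB _ beta] bB bm; have := beta b bB bm.
rewrite (fund_circuitE cB kapP bB) => bmin; apply: NNPP => noa; move/negP: bmin; apply.
apply/is_minP; rewrite inE (proj2 (kapP b bB)) oner_eq0; split=> // a.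
by rewrite inE leNgt => ka; apply/negP => ab; apply: noa; exists a.
Qed.

(** A relation expressing [v b] by larger elements outside B would be a multiple of [kap b], making
    b the minimum of c(B,b). *)
Lemma beta_notin_span B b : B \in beta_nbc_dual N -> b \in B -> b != m ->
  v b \notin spn v [set x in A | (b < x)%O && (x \notin B)].
Proof.
move=> Bb bB bm; have /beta_nbc_dualP[cB _ _] := Bb.
have [kap kapP] := fundamental_exists cB; have [a ab ka] := beta_not_min kapP Bb bB bm.
apply/negP => /spn_relation[|mu murel mub]; first by rewrite !inE ltxx andbF.
have murel' : relation v (b |: (A :\: B)) mu.
  apply: relationS murel; apply/subsetP=> x; rewrite !inE.
  by case: eqP => //= _ /and3P[-> _ ->].
move: ka; rewrite -[kap b a]mul1r -mub -(relation_at_b cB kapP bB murel').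
rewrite (proj1 murel) ?eqxx// !inE negb_or negb_and (lt_eqF ab) /=.
by rewrite lt_gtF ?orbT.
Qed.

(** The hypotheses are what [beta_setsP] delivers. The first makes [A :\: B] independent, as seen at
    the smallest element of a relation, and forbids b = min c(B,b). The second makes [A :\: B]
    spanning, as seen at the smallest counterexample, and excludes broken circuits. *)
Lemma beta_nbc_dualI B : B \subset A ->
    {in A, forall a, a != m -> v a \notin spn v [set x in A | (a < x)%O && (x \notin B)]} ->
    {in A, forall a, v a \in spn v [set x in A | (x < a)%O || (a < x)%O && (x \notin B)]} ->
  m \in B -> B \in beta_nbc_dual N.
Proof.
move=> BA nospan inspan mB.
have fAB : indp v (A :\: B).
  apply/indpP => mu murel i; apply/eqP; apply: contraT => mui.
  have [|c /is_minP[]] := @is_min_exists _ _ [set a | mu a != 0].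
    by apply/set0Pn; exists i; rewrite inE.
  rewrite inE => muc minc.
  have cAB : c \in A :\: B by apply: contraR muc => /(proj1 murel) ->.
  have [cA cB] : c \in A /\ c \notin B by move: cAB; rewrite inE => /andP[].
  have cm : c != m by apply: contraNneq cB => ->.
  have /negP[] := nospan c cA cm.
  have := relation_spn (relation_supp murel) muc; apply/subvP/spnS/subsetP => x.
  rewrite !inE lt_neqAle eq_sym => /andP[-> mux]; rewrite minc ?inE//= andbC.
  have : x \in A :\: B by apply: contraR mux => /(proj1 murel) ->.
  by rewrite inE.
have sAB : spn v (A :\: B) = spn v A.
  apply/eqP; rewrite eqEsubv spnS ?subsetDl//=; apply: spn_sub => a aA.
  apply: contraT => va.
  have [|c /is_minP[]] := @is_min_exists _ _ [set a in A | v a \notin spn v (A :\: B)].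
    by apply/set0Pn; exists a; rewrite inE aA.
  rewrite inE => /andP[cA /negP vc] minc; case: vc; have := inspan c cA.
  apply/subvP/spn_sub => x; rewrite inE => /andP[xA /orP[xc|/andP[_ xB]]].
    by apply: contraTT xc => vx; rewrite -leNgt minc// inE xA.
  by apply: mem_spn; rewrite inE xB.
have cB : cobasis e phi A B by [].
have [kap kapP] := fundamental_exists cB.
apply/beta_nbc_dualP; split=> //.
  apply/(nbc_cobasisP cB kapP) => a aAB; apply: NNPP => nob.
  have aA : a \in A by move: aAB; rewrite inE => /andP[].
  have [|mu murel mua] := @spn_relation _ _ _ v (A :\: B :\ a) a (negbT (setD11 _ _)).
    have := inspan a aA; apply/subvP/spn_sub => x; rewrite inE.
    move=> /andP[xA]; have [xB|xB] := boolP (x \in B); last first.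
      rewrite andbT => xa; apply: mem_spn; rewrite !inE xB xA !andbT.
      by apply: contraTneq xa => ->; rewrite ltxx.
    rewrite andbF orbF => xa.
    have [krel kx1] := kapP x xB; have kx0 : kap x x != 0 by rewrite kx1 oner_eq0.
    have := relation_spn (relation_supp krel) kx0; apply/subvP/spnS/subsetP => y.
    rewrite !inE => /andP[yx ky]; have : y \in x |: (A :\: B).
      by apply: contraR ky => /(proj1 krel) ->.
    rewrite !inE (negPf yx) /= => ->; rewrite andbT.
    by apply: contraNneq ky => ya; apply/eqP; apply: NNPP => kxa; case: nob; exists x;
      split=> //; rewrite -ya; apply/eqP.
  rewrite setD1K// in murel; have := indpP _ _ fAB _ murel a.
  by rewrite mua => /eqP; rewrite oner_eq0.
move=> b bB bm; apply: contra (nospan b (subsetP BA b bB) bm) => /is_minP[_].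
rewrite (fund_circuitE cB kapP bB) => minb.
have [krel kb1] := kapP b bB; have kb0 : kap b b != 0 by rewrite kb1 oner_eq0.
have := relation_spn (relation_supp krel) kb0; apply/subvP/spnS/subsetP => y.
rewrite !inE => /andP[yb ky]; rewrite lt_neqAle eq_sym yb minb ?inE//=.
have : y \in b |: (A :\: B) by apply: contraR ky => /(proj1 krel) ->.
by rewrite !inE (negPf yb) /= andbC.
Qed.

(** A dual circuit through m has m as its minimum, so no broken circuit contains m, and m can be
    adjoined to any face. *)
Lemma reduced_bc_dual_indep F : F \in reduced_bc (dual_matroid N) ->
  [/\ F \subset A :\ m, spn v (A :\: (m |: F)) = spn v A
    & no_broken_circuit (dual_matroid N) (m |: F)].
Proof.
rewrite inE remove_min_dual => /andP[FA /forall_inP nbcF].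
have mFA : m |: F \subset A.
  by rewrite subUset sub1set min_in (subset_trans FA) ?subsetDl.
have min_circ C : C \in circuits (dual_matroid N) -> m \in C -> is_min m C.
  rewrite dual_circuitsP => /minsetP[/andP[/subsetP CA _] _] mC.
  by apply/is_minP; split=> // x /CA; apply: min_le.
split=> //.
  apply/eqP; apply: contraT => nX.
  have [|C minC CX] := @minset_exists _
      (fun X => (X \subset A) && (spn v (A :\: X) != spn v A)) (m |: F); first by rewrite mFA.
  have Cc : C \in circuits (dual_matroid N) by rewrite dual_circuitsP.
  have /negP[] := nbcF _ (imset_f _ Cc); have [mC|mC] := boolP (m \in C).
    by rewrite (remove_minE (min_circ C Cc mC)) subDset.
  apply/subsetP=> x; rewrite inE => /andP[xC _]; have := subsetP CX x xC.
  by rewrite !inE; case: eqP => // xm; rewrite -xm xC in mC.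
apply/forall_inP => _ /imsetP[C Cc ->]; apply: contra (nbcF _ (imset_f _ Cc)).
move=> /subsetP CmF; apply/subsetP=> x xC; have := CmF x xC.
rewrite !inE; case: eqP => // xm; move: xC; rewrite inE xm => /andP[mC].
by rewrite min_circ.
Qed.

End BetaNbcBases.

(** * Top cycles of the reduced broken circuit complex *)

Section TopHomology.
Variables (k : fieldType) (disp : Order.disp_t) (S : finOrderType disp).
Variables (U W : vectType k) (e : S -> U) (phi : 'Hom(U, W)) (A : {set S}) (m : S).
Variable l : nat.
Local Notation M := (rep_matroid e phi).
Local Notation N := (restriction M A).
Local Notation v := (fun i => phi (e i)).
Local Notation Delta := (reduced_bc (dual_matroid N)).
Implicit Types (X B C F : {set S}) (kap : S -> S -> k).
Hypothesis mP : is_min m A.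
Hypothesis card_A : #|A| = (rk e phi A + l).+1.

Lemma cobasis_card B : cobasis e phi A B -> #|B| = l.+1.
Proof.
move=> [BA fB sB]; have := cardsID B A; rewrite (setIidPr BA) -(indp_dim fB) sB card_A.
by rewrite -[rk e phi A]/(\dim (spn v A)) addnC -addnS => /addnI.
Qed.

Lemma facet_cobasis F : F \in Delta -> #|F| = l ->
  [/\ m \notin F, cobasis e phi A (m |: F) & no_broken_circuit (dual_matroid N) (m |: F)].
Proof.
move=> /(reduced_bc_dual_indep mP)[FA sF nbcF] cardF.
have mF : m \notin F by apply/negP => /(subsetP FA); rewrite !inE eqxx.
have mFA : m |: F \subset A.
  by rewrite subUset sub1set (min_in mP) (subset_trans FA) ?subsetDl.
split=> //; split=> //; rewrite /indp /free.
have := cardsID (m |: F) A; rewrite (setIidPr mFA) cardsU1 mF cardF card_A.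
rewrite -[rk e phi A]/(\dim (spn v A)) add1n addSn addnC => -[/addIn cardAF].
by rewrite -/(spn _ _) sF size_map -cardE cardAF.
Qed.

(** Adjoining m to such a face would leave fewer elements of A than its rank, while they still have
    to span. This makes top boundaries vanish. *)
Lemma reduced_bc_card F : F \in Delta -> #|F| != l.+1.
Proof.
move=> /(reduced_bc_dual_indep mP)[FA sF _]; apply/eqP => cardF.
have mF : m \notin F by apply/negP => /(subsetP FA); rewrite !inE eqxx.
have mFA : m |: F \subset A.
  by rewrite subUset sub1set (min_in mP) (subset_trans FA) ?subsetDl.
have := dim_spn_le v (A :\: (m |: F)); rewrite sF.
have := cardsID (m |: F) A; rewrite (setIidPr mFA) cardsU1 mF cardF card_A.
rewrite -[rk e phi A]/(\dim (spn v A)) add1n !addSn => -[E].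
have <- : #|A :\: (m |: F)|.+1 = \dim (spn v A).
  by apply: (@addnI l); rewrite addnS E addnC.
by rewrite ltnn.
Qed.

Lemma bd_faceE_coef G F : (bd_face k G F : k) != 0 -> exists2 x, x \in G & F = G :\ x.
Proof.
rewrite /bd_face sum_ffunE => s0; have [x] : exists x, (x \in G) && (F == G :\ x).
  apply/existsP; apply: contraNT s0; rewrite negb_exists => /forallP no.
  rewrite big1// => x xG; rewrite !ffunE.
  by have := no x; rewrite xG /= => /negPf ->; exact: mulr0.
by move=> /andP[xG /eqP]; exists x.
Qed.

(* A coface [G] of [F :\ b], with [b] the minimum of c(B,b), replaces [b] by  *)
(* another, hence larger, element of c(B,b).                                  *)
Lemma cycle_eq0 (z : chain k S) :
    (forall G, z G != 0 -> G \in Delta /\ #|G| = l) -> bd k S z = 0 ->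
    {in beta_nbc_dual N, forall B, z (B :\ m) = 0} ->
  z = 0.
Proof.
move=> zsupp bdz zbeta; apply/ffunP=> G0; rewrite [RHS]ffunE; apply/eqP.
apply: contraT => zG0; have [F zF maxF] := @arg_maxnP _ G0 (fun F => z F != 0) (@weight _ S) zG0.
have [FD cardF] := zsupp F zF; have [mF cB nbcB] := facet_cobasis FD cardF.
have [/subsetP FA _ _] := reduced_bc_dual_indep mP FD.
have Bbeta : m |: F \notin beta_nbc_dual N.
  by apply: contraNN zF => /zbeta; rewrite setU1K// => ->.
have [b bF bmin] : exists2 b, b \in F & is_min b (fund_circuit N (m |: F) b).
  apply: NNPP => nob; move/negP: Bbeta; apply; apply/(beta_nbc_dualP e phi mP); split=> //.
  move=> b; rewrite !inE => /orP[->//|bF] bm; apply/negP => bmin.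
  by apply: nob; exists b.
have bB : b \in m |: F by rewrite inE bF orbT.
have [kap kapP] := fundamental_exists cB.
(* The boundary of z vanishes at F - b, so F is not the only facet of the support containing F -
   b. *)
have [G [zG GF]] : exists G, z G != 0 /\ exists2 x, x != b & x \in G /\ F :\ b = G :\ x.
  apply: NNPP => noG; have := congr1 (fun c : chain k S => c (F :\ b)) bdz.
  rewrite bdE sum_ffunE (bigD1 F)//= big1 => [|G GF]; last first.
    rewrite ffunE; apply/eqP; rewrite mulf_eq0; apply/orP.
    have [zG|zG] := eqVneq (z G) 0; [by left; apply/eqP | right].
    apply: contraT => /bd_faceE_coef[x xG FG]; case: noG; exists G; split=> //.
    exists x => //; apply: contraNneq GF => xb.
    by rewrite -(setD1K bF) FG -xb setD1K.
  rewrite addr0 !ffunE => /eqP; rewrite mulf_eq0 (negPf zF) /=.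
  rewrite /bd_face sum_ffunE (bigD1 b)//= !ffunE eqxx [_ *: _]mulr1 big1 ?addr0.
    by rewrite signr_eq0.
  move=> x /andP[xF xb]; rewrite !ffunE; case: eqP => [/setP/(_ x)|_]; last exact: mulr0.
  by rewrite !inE eqxx xb xF.
case: GF => x xb [xG FG].
have [GD cardG] := zsupp G zG; have [mG cG _] := facet_cobasis GD cardG.
have xF : x \notin F.
  by apply/negP => xF; have /setP/(_ x) := FG; rewrite !inE xb xF eqxx.
have GE : G = x |: (F :\ b) by rewrite FG setD1K.
(* Otherwise c(B,b) would lie in the complement of m + G, which is independent. *)
have kx : kap b x != 0.
  apply/eqP => kx; have [krel kb1] := kapP b bB.
  have [_ fG _] := cG.
  suff /(indpP _ _ fG)/(_ b)/eqP : relation v (A :\: (m |: G)) (kap b).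
    by rewrite kb1 oner_eq0.
  split; last by case: krel.
  move=> y; apply: contraNeq => ky; have : y \in b |: (A :\: (m |: F)).
    by apply: contraR ky => /(proj1 krel) ->.
  have bx : (b == x) = false by rewrite eq_sym (negPf xb).
  have yx : y != x by apply: contraNneq ky => ->; rewrite kx.
  rewrite GE !inE (negPf yx) /=; have [->|yb] /= := eqVneq y b.
    by move=> _; rewrite orbF; have := FA b bF; rewrite !inE => /andP[-> ->].
  done.
have bx : (b < x)%O.
  move: bmin => /is_minP[_]; rewrite (fund_circuitE cB kapP bB) => /(_ x).
  by rewrite inE kx => /(_ isT) lebx; rewrite lt_neqAle lebx eq_sym xb.
have := maxF G zG; rewrite /= GE leqNgt => /negP[].
rewrite /weight (big_setD1 b)//= [X in (_ < X)%N]big_setU1/=;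
  last by rewrite !inE (negPf xF) andbF.
by rewrite ltn_add2r weight_mono.
Qed.

(** If the support of mu met C in t alone, [v t] would be spanned by [A :\: C]. Then C - t would
    also have a non-spanning complement, against minimality. *)
Lemma dual_circuit_orthogonal C mu t : C \in circuits (dual_matroid N) ->
  relation v A mu -> t \in C -> mu t != 0 -> exists y, [/\ y \in C, y != t & mu y != 0].
Proof.
rewrite dual_circuitsP => /minsetP[/andP[CA nC] minC] murel tC mut.
apply: NNPP => noy; move/negP: nC; apply; rewrite eqEsubv spnS ?subsetDl//=.
have vt : v t \in spn v (A :\: C).
  have := relation_spn (relation_supp murel) mut; apply/subvP/spnS/subsetP => y.
  rewrite !inE => /andP[yt muy]; apply/andP; split.
    by apply/negP => yC; apply: noy; exists y.
  by apply: contraR muy => /(proj1 murel) ->.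
have Ct : C :\ t \subset A by rewrite (subset_trans _ CA) ?subsetDl.
have sCt : spn v (A :\: (C :\ t)) = spn v A.
  apply/eqP; apply: contraT => nCt; have := minC (C :\ t); rewrite Ct nCt subsetDl.
  by move=> /(_ isT isT) E; rewrite -E !inE eqxx in tC.
rewrite -sCt; apply: spn_sub => y; rewrite !inE negb_and negbK => /andP[/orP[/eqP ->//|yC] yA].
by apply: mem_spn; rewrite inE yC.
Qed.

End TopHomology.

Lemma uniq_flatten_map (T1 T2 : eqType) (g : T1 -> seq T2) (h : T2 -> T1) (s : seq T1) :
    uniq s -> {in s, forall t, uniq (g t)} -> {in s, forall t, {in g t, forall x, h x = t}} ->
  uniq (flatten [seq g t | t <- s]).
Proof.
elim: s => //= t s IHs /andP[ts us] ug hg; rewrite cat_uniq ug ?mem_head//=.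
rewrite IHs// => [|t' t's|t' t's]; last 2 first.
- by apply: ug; rewrite inE t's orbT.
- by apply: hg; rewrite inE t's orbT.
rewrite andbT; apply/hasPn => x /flatten_mapP[t' t's xt']; apply: contra ts => xt.
by rewrite -(hg t (mem_head _ _) x xt) (hg t' _ x xt')// inE t's orbT.
Qed.

(** * The cycle attached to a set of beta nbc *)

Section SigmaCycles.
Variables (k : fieldType) (disp : Order.disp_t) (S : finOrderType disp).
Variables (U W : vectType k) (e : S -> U) (phi : 'Hom(U, W)) (A : {set S}) (m : S).
Variables (l : nat) (B : {set S}).
Local Notation M := (rep_matroid e phi).
Local Notation N := (restriction M A).
Local Notation v := (fun i => phi (e i)).
Local Notation Delta := (reduced_bc (dual_matroid N)).
Hypothesis mP : is_min m A.
Hypothesis card_A : #|A| = (rk e phi A + l).+1.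
Hypothesis Bbeta : B \in beta_nbc_dual N.

Local Notation f := (fund_min N B).
Local Notation fiber t := [set b in B :\ m | f b == t].
Local Notation T := [set f b | b in B :\ m].

Lemma beta_cobasis : cobasis e phi A B.
Proof. by have /(beta_nbc_dualP e phi mP)[] := Bbeta. Qed.

Lemma beta_min_in : m \in B.
Proof.
by have /(beta_nbc_dualP e phi mP)[cB nbcB _] := Bbeta; apply: (nbc_min mP cB nbcB).
Qed.

Lemma fund_minP kap b : fundamental e phi A B kap -> b \in B :\ m ->
  [/\ kap b (f b) != 0, f b \in A :\: B, (f b < b)%O
    & forall a, kap b a != 0 -> (f b <= a)%O].
Proof.
move=> kapP; rewrite !inE => /andP[bm bB]; have cB := beta_cobasis.
have [krel kb1] := kapP b bB; have kb0 : kap b b != 0 by rewrite kb1 oner_eq0.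
rewrite /fund_min (fund_circuitE cB kapP bB); case: arg_minP; first by rewrite inE.
move=> t; rewrite inE => kt mint; have [a ab ka] := beta_not_min mP kapP Bbeta bB bm.
have tb : (t < b)%O by apply: le_lt_trans ab; apply: mint; rewrite inE.
split=> //; last by move=> c kc; apply: mint; rewrite inE.
have : t \in b |: (A :\: B) by apply: contraR kt => /(proj1 krel) ->.
by rewrite !inE (lt_eqF tb).
Qed.

Lemma fund_min_lt b : b \in B :\ m -> (f b < b)%O.
Proof.
have [kap kapP] := fundamental_exists beta_cobasis.
by move=> bB; have [] := fund_minP kapP bB.
Qed.

Lemma fund_min_in b : b \in B :\ m -> f b \in A :\: B.
Proof.
have [kap kapP] := fundamental_exists beta_cobasis.
by move=> bB; have [] := fund_minP kapP bB.
Qed.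

Lemma blocksE : blocks N B = [seq t :: sorted_elts (fiber t) | t <- sorted_elts T].
Proof.
have BE : B :&: remove_min (ground N) = B :\ m.
  rewrite ground_restriction (remove_minE mP); apply/setP=> x; rewrite !inE.
  have [xB|] := boolP (x \in B); rewrite ?andbT ?andbF//=.
  by have [/subsetP/(_ x xB) ->] := beta_cobasis; rewrite andbT.
rewrite /blocks BE; apply/eq_in_map => t _; apply: sorted_eltsU1 => b.
by rewrite inE => /andP[/fund_min_lt + /eqP <-].
Qed.

Lemma blocks_uniq : uniq (flatten (blocks N B)).
Proof.
(* The label t of the block containing x is [f x] if x is in B, and x itself otherwise. *)
rewrite blocksE; apply: (@uniq_flatten_map _ _ _ (fun x => if x \in B then f x else x)).
- exact: sorted_elts_uniq.
- move=> t _ /=; rewrite sorted_elts_uniq andbT mem_sorted_elts.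
  by apply/negP; rewrite inE => /andP[/fund_min_lt + /eqP]; rewrite lt_neqAle => /andP[/eqP].
- move=> t; rewrite mem_sorted_elts => /imsetP[b bB ->] x.
  rewrite inE => /orP[/eqP ->|].
    by have := fund_min_in bB; rewrite inE => /andP[/negPf ->].
  by rewrite mem_sorted_elts !inE => /andP[/andP[_ ->] /eqP].
Qed.

Lemma blocks_sorted : {in blocks N B, forall a, a != [::] /\ sorted <%O a}.
Proof.
rewrite blocksE => _ /mapP[t _ ->]; split=> //=.
rewrite (path_sortedE lt_trans) sorted_elts_lt andbT; apply/allP => b.
by rewrite mem_sorted_elts inE => /andP[/fund_min_lt + /eqP <-].
Qed.

Lemma blocks_behead : [set x in flatten [seq behead a | a <- blocks N B]] = B :\ m.
Proof.
apply/setP=> x; rewrite inE blocksE -map_comp; apply/flatten_mapP/idP => [[t _ /=]|xB].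
  by rewrite mem_sorted_elts inE => /andP[].
exists (f x); first by rewrite mem_sorted_elts imset_f.
by rewrite /= mem_sorted_elts inE xB eqxx.
Qed.

Lemma size_blocks : (\sum_(a <- blocks N B) (size a).-1 = l)%N.
Proof.
have := cobasis_card card_A beta_cobasis.
rewrite (cardsD1 m) beta_min_in add1n => -[<-]; rewrite -blocks_behead cardsE.
rewrite (card_uniqP _); first by rewrite size_flatten sumnE !big_map;
  under [RHS]eq_bigr do rewrite size_behead.
apply: subseq_uniq blocks_uniq; elim: (blocks N B) => //= a s IHs.
by rewrite cat_subseq//; case: a => //= x a; apply: subseq_cons.
Qed.

Lemma blocks_sub x : x \in flatten (blocks N B) -> x \in A :\ m /\ (x \in T \/ x \in B :\ m).
Proof.
rewrite blocksE => /flatten_mapP[t]; rewrite mem_sorted_elts => tT.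
rewrite inE => /orP[/eqP ->|].
  split; last by left.
  case/imsetP: tT => b /fund_min_in + ->; rewrite !inE => /andP[fB ->]; rewrite andbT.
  by apply: contraNneq fB => ->; apply: beta_min_in.
rewrite mem_sorted_elts inE => /andP[xB _]; split; last by right.
by move: xB; rewrite !inE => /andP[-> xB]; have [/subsetP ->] := beta_cobasis.
Qed.

(* If [remove_min C] is contained in a face, let [t] be its largest element   *)
(* in the image of [f]. The face misses some [b'] with [f b' = t], and C      *)
(* meets c(B,b') in [t], so in another element, larger than [t]: impossible.  *)
(* Hence [remove_min C] is contained in B.                                    *)
Lemma sigma_face G : sigma k N B G != 0 -> G \in Delta /\ #|G| = l.
Proof.
have uB : uniq ([::] ++ flatten (blocks N B)) by exact: blocks_uniq.
move=> /(block_sum_support uB)[q [-> uq sq szq missq]]; split; last first.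
  by rewrite cardsE (card_uniqP uq) szq size_blocks.
have [kap kapP] := fundamental_exists beta_cobasis.
rewrite inE (remove_min_dual e phi mP); apply/andP; split.
  by apply/subsetP=> x; rewrite inE => /sq/blocks_sub[].
have /(beta_nbc_dualP e phi mP)[_ /forall_inP nbcB _] := Bbeta.
apply/forall_inP => _ /imsetP[C Cc ->]; apply/negP => Cq.
have C0 : C != set0.
  apply: contraNneq (nbcB _ (imset_f _ Cc)) => ->; apply/subsetP=> x.
  by rewrite !inE.
have [c0 /[dup] c0min /is_minP[c0C minc0]] := is_min_exists C0.
have {}nbcB := nbcB _ (imset_f _ Cc); rewrite (remove_minE c0min) in Cq nbcB.
suff noT : {in C :\ c0, forall t, t \notin T}.
  case/negP: nbcB; apply/subsetP=> x xC; have := subsetP Cq x xC.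
  rewrite inE => /sq/blocks_sub[_ [xT|]]; first by have := noT x xC; rewrite xT.
  by rewrite inE => /andP[].
apply: NNPP => noT; have [t0 H] := not_all_ex_not _ _ noT.
have [t0C /negP] := imply_to_and _ _ H; rewrite negbK => t0T.
have [|t /andP[tC tT] maxt] := @arg_maxP _ _ _ t0 (fun t => (t \in C :\ c0) && (t \in T)) id.
  by rewrite t0C.
have tq : t \in q by have := subsetP Cq t tC; rewrite inE.
have [b' bB [bt bq]] : exists2 b, b \in B :\ m & f b = t /\ b \notin q.
  have [|x] := missq (t :: sorted_elts (fiber t)).
    by rewrite blocksE map_f// mem_sorted_elts.
  rewrite inE => /orP[/eqP ->|]; first by rewrite tq.
  by rewrite mem_sorted_elts inE => /andP[xB /eqP xt] xq; exists x.
have [kt tAB _ mint] := fund_minP kapP bB; rewrite bt in kt tAB mint.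
have [bm bB'] : b' != m /\ b' \in B by move: bB; rewrite !inE => /andP[].
have [tc0 tC'] : t != c0 /\ t \in C by move: tC; rewrite !inE => /andP[].
have [y [yC yt ky]] :=
  dual_circuit_orthogonal Cc (fundamental_relation beta_cobasis kapP bB') tC' kt.
have ty : (t < y)%O by rewrite lt_neqAle eq_sym yt mint.
have yc0 : y != c0.
  by apply: contraTneq ty => ->; rewrite -leNgt minc0.
have yq : y \in q by have := subsetP Cq y; rewrite !inE yc0 yC => /(_ isT).
have yb : y != b' by apply: contraNneq bq => <-.
have yB : y \notin B.
  have : y \in b' |: (A :\: B) by apply: contraR ky => /(proj1 (proj1 (kapP _ bB'))) ->.
  by rewrite !inE (negPf yb) => /andP[].
have [_ [yT|]] := blocks_sub (sq y yq); last by rewrite !inE (negPf yB) andbF.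
have := maxt y; rewrite !inE yc0 yC => /(_ yT).
by rewrite /= leNgt ty.
Qed.

Lemma bd_sigma : bd k S (sigma k N B) = 0.
Proof.
have uB : uniq ([::] ++ flatten (blocks N B)) by exact: blocks_uniq.
by have := bd_block_sum k uB; rewrite /altsum big_ord0.
Qed.

(** Each block begins with its label t outside B; omitting all the labels leaves exactly B \ m. *)
Lemma sigma_lead : sigma k N B (B :\ m) != 0 /\
  forall G, sigma k N B G != 0 -> G = B :\ m \/ (weight G < weight (B :\ m))%N.
Proof.
have uB : uniq ([::] ++ flatten (blocks N B)) by exact: blocks_uniq.
have := block_sum_lead k uB blocks_sorted.
by rewrite cat0s blocks_behead.
Qed.

End SigmaCycles.

(** * The basis of S_A(phi) *)

Section FlatChain.
Variables (k : fieldType) (disp : Order.disp_t) (S : finOrderType disp).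
Variables (U W : vectType k) (e : S -> U) (phi : 'Hom(U, W)) (A : {set S}) (m : S).
Variables (l : nat) (B : {set S}) (kap : S -> S -> k).
Local Notation M := (rep_matroid e phi).
Local Notation N := (restriction M A).
Local Notation v := (fun i => phi (e i)).
Local Notation bs := (sorted_elts B).
Local Notation J := (Jchain N B).
Hypothesis e_free : indp e [set: S].
Hypothesis mP : is_min m A.
Hypothesis card_A : #|A| = (rk e phi A + l).+1.
Hypothesis Bbeta : B \in beta_nbc_dual N.
Hypothesis kapP : fundamental e phi A B kap.

Let cB : cobasis e phi A B := beta_cobasis mP Bbeta.

Lemma mem_take_sorted i b : b \in take i bs -> b \in B.
Proof. by move=> /mem_take; rewrite mem_sorted_elts. Qed.

Lemma mem_drop_take i b : b \in B -> (b \in drop i bs) = (b \notin take i bs).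
Proof.
move=> bB; have := sorted_elts_uniq B; have : b \in bs by rewrite mem_sorted_elts.
rewrite -[X in b \in X -> _](cat_take_drop i bs) -[X in uniq X](cat_take_drop i bs).
rewrite mem_cat cat_uniq => /orP[bt|bd] /and3P[_ /hasPn nh _].
  by rewrite bt; apply: contraTF bt => /nh.
by rewrite bd; apply/esym/nh.
Qed.

Lemma size_bs : size bs = l.+1.
Proof. by rewrite size_sorted_elts (cobasis_card card_A cB). Qed.

(** J_i is the union of the c(B,b) over the first i + 1 elements b of B, m included: a circuit
    avoiding the later elements expands in these by [fundamental_expand]. *)
Lemma mem_JchainP i a :
  reflect (exists2 b, b \in take i.+1 bs & kap b a != 0) (a \in J i).
Proof.
rewrite /Jchain /circuits_union ground_restriction;
  apply: (iffP bigcupP) => [[C /andP[]]|[b bt kb]].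
  rewrite circuitsP => /andP[CA minC] CX aC; have [mu [murel muC]] := minset_relation minC.
  have muE := fundamental_expand cB kapP (relationS CA murel) a.
  have [b /and3P[bB mub kb]] : exists b, [&& b \in B, mu b != 0 & kap b a != 0].
    apply/existsP; apply: contraTT aC; rewrite negb_exists -muC negbK => /forallP no.
    rewrite muE big1// => b bB; apply/eqP; rewrite mulf_eq0.
    by have := no b; rewrite bB /= negb_and !negbK.
  exists b => //; move: mub; rewrite muC => /(subsetP CX).
  by rewrite !inE mem_drop_take// negbK => /andP[].
have bB := mem_take_sorted bt.
exists [set a | kap b a != 0]; last by rewrite inE.
rewrite (fund_circuit_circuit cB kapP bB) /=; apply/subsetP=> x; rewrite inE => kx.
have : x \in b |: (A :\: B) by apply: contraR kx => /(proj1 (proj1 (kapP bB))) ->.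
rewrite !inE => /orP[/eqP ->|/andP[xB xA]].
  by rewrite mem_drop_take// bt /=; have [/subsetP ->] := cB.
by rewrite xA andbT; apply: contra xB => /mem_drop; rewrite mem_sorted_elts.
Qed.

Lemma Jchain_sub i : J i \subset A.
Proof.
apply/subsetP => a /mem_JchainP[b /mem_take_sorted bB]; apply: contraR.
by move/(proj1 (fundamental_relation cB kapP bB)) ->.
Qed.

Lemma mem_Jchain_basis i b : b \in B -> (b \in J i) = (b \in take i.+1 bs).
Proof.
move=> bB; apply/mem_JchainP/idP => [[c ct]|bt].
  have [->//|bc] := eqVneq b c.
  by rewrite (fundamental_offdiag kapP (mem_take_sorted ct) bB bc) eqxx.
by exists b; rewrite // (proj2 (kapP bB)) oner_eq0.
Qed.

Lemma Jchain_last : J l = A.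
Proof.
apply/eqP; rewrite eqEsubset Jchain_sub; apply/subsetP => a aA; apply/mem_JchainP.
rewrite take_oversize ?size_bs//.
have [aB|aB] := boolP (a \in B).
  by exists a; rewrite ?mem_sorted_elts// (proj2 (kapP aB)) oner_eq0.
have /(beta_nbc_dualP e phi mP)[_ /(nbc_cobasisP cB kapP)/(_ a) + _] := Bbeta.
by case=> [|b [bB _ kb]]; [rewrite inE aB | exists b; rewrite ?mem_sorted_elts].
Qed.

Lemma bs_head : nth m bs 0 = m.
Proof.
have := sorted_elts_lt B; have := mem_sorted_elts m B; rewrite (beta_min_in mP Bbeta).
have : {subset bs <= A}.
  by move=> x; rewrite mem_sorted_elts; have [/subsetP + _ _] := cB; apply.
case: bs => //= b s sA; rewrite inE => /orP[/eqP //|ms].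
rewrite (path_sortedE lt_trans) => /andP[/allP/(_ m ms) bm _].
by move: bm; rewrite ltNge (min_le mP)// sA ?mem_head.
Qed.

Section Step.
Variable i : nat.
Hypothesis lti : (i < l)%N.
Local Notation b := (nth m bs i.+1).
Local Notation D := (J i.+1 :\: J i).

Lemma step_in : b \in B.
Proof. by rewrite -mem_sorted_elts mem_nth// size_bs ltnS. Qed.

Lemma take_step : take i.+2 bs = rcons (take i.+1 bs) b.
Proof. by rewrite -take_nth// size_bs ltnS. Qed.

Lemma step_notin_take : b \notin take i.+1 bs.
Proof.
rewrite -mem_drop_take ?step_in// (drop_nth m) ?mem_head//.
by rewrite size_bs ltnS.
Qed.

Lemma Jchain_subS : J i \subset J i.+1.
Proof.
apply/subsetP => a /mem_JchainP[c ct kc]; apply/mem_JchainP; exists c => //.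
by rewrite take_step mem_rcons inE ct orbT.
Qed.

Lemma step_mem : b \in D.
Proof.
rewrite inE !mem_Jchain_basis ?step_in// step_notin_take take_step.
by rewrite mem_rcons mem_head.
Qed.

Lemma step_kap a : a \in D -> kap b a != 0.
Proof.
rewrite inE => /andP[/mem_JchainP aJ /mem_JchainP[c]].
rewrite take_step mem_rcons inE => /orP[/eqP ->//|ct kc].
by case: aJ; exists c.
Qed.

Lemma step_kap0 a c : a \in D -> c \in take i.+1 bs -> kap c a = 0.
Proof.
rewrite inE => /andP[/mem_JchainP aJ _] ct; apply/eqP; apply: contraT => kc.
by case: aJ; exists c.
Qed.

Lemma step_basis a : a \in D -> a \in B -> a = b.
Proof.
rewrite inE => /andP[aJ aJ'] aB; move: aJ aJ'; rewrite !mem_Jchain_basis//.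
by rewrite take_step mem_rcons inE => /negPf ->; rewrite orbF => /eqP.
Qed.

(** As B contains no broken circuit, a lies in some c(B,c) with c < a. Since a is not in J_i, c is
    not among the first i + 1 elements of B, so c is at least b. *)
Lemma step_min a : a \in D -> a != b -> (b < a)%O /\ a \notin B.
Proof.
move=> aD ab; have aB : a \notin B by apply: contra ab => /(step_basis aD) ->.
split=> //; have /(beta_nbc_dualP e phi mP)[_ /(nbc_cobasisP cB kapP)/(_ a) + _] := Bbeta.
case=> [|c [cB' ca kc]].
  by rewrite inE aB; move: aD; rewrite inE => /andP[_ /(subsetP (Jchain_sub _))].
apply: le_lt_trans ca; have : c \in drop i.+1 bs.
  by rewrite mem_drop_take//; apply: contra_neqN kc; apply: step_kap0.
have := drop_sorted i.+1 (sorted_elts_lt B).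
rewrite (drop_nth m) ?size_bs ?ltnS//= (path_sortedE lt_trans) => /andP[/allP ltb _].
by rewrite inE => /orP[/eqP ->//|/ltb/ltW].
Qed.

Local Notation u := (u_elt e phi D (J i)).

(** The predicate under [epsilon] in [u_elt], named so that [epsilon_spec] applies. *)
Definition leading_form (w : U) := [/\ w \in Uspan e D,
  exists (p : S) (x : S -> k), is_max p D /\ w = e p + \sum_(j : S | (j < p)%O) x j *: e j
  & phi w \in (Vspan e phi D :&: Vspan e phi (J i))%VS].

Lemma leading_form_exists : exists w, leading_form w.
Proof.
have [p pD maxp] := @arg_maxP _ _ _ b (fun x => x \in D) id step_mem.
have kp := step_kap pD; have bB := step_in.
(* The relation [kap b] is cut down to D and scaled to 1 at p. The discarded part is supported in
   J_i, which puts the image under phi in V_(J_i). *)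
pose y a := if a \in D then (kap b p)^-1 * kap b a else 0.
have y0 a : a \notin D -> y a = 0 by rewrite /y => /negPf ->.
exists (\sum_a y a *: e a); split.
- exact: (memv_spn_sum e y0).
- exists p, y; split; first by apply/andP; split=> //; apply/forall_inP.
  rewrite (bigD1 p)//= {1}/y pD mulVf// scale1r; congr (_ + _).
  rewrite big_mkcond [RHS]big_mkcond; apply: eq_bigr => a _.
  rewrite lt_neqAle; have [//|ap /=] := eqVneq a p.
  by have [/maxp /= ->//|/y0 ->] := boolP (a \in D); rewrite scale0r; case: ifP.
- rewrite linear_sum; under eq_bigr do rewrite linearZ; rewrite memv_cap.
  rewrite -[Vspan e phi D]/(spn v D) -[Vspan e phi (J i)]/(spn v (J i)).
  rewrite (@memv_spn_sum _ _ _ v D y y0) /=.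
  have krel := fundamental_relation cB kapP bB.
  have -> : \sum_a y a *: phi (e a) =
      \sum_a ((y a - (kap b p)^-1 * kap b a)) *: phi (e a).
    under [RHS]eq_bigr do rewrite scalerBl -scalerA.
    by rewrite sumrB -scaler_sumr (proj2 krel) scaler0 subr0.
  apply: (@memv_spn_sum _ _ _ v) => a aJ; rewrite /y inE aJ /=.
  case: ifPn => [|/mem_JchainP nJ]; first by rewrite subrr.
  suff -> : kap b a = 0 by rewrite mulr0 subr0.
  apply/eqP; apply: contraT => ka; case: nJ; exists b => //.
  by rewrite take_step mem_rcons mem_head.
Qed.

Lemma u_eltP : exists y : S -> k,
  [/\ forall a, a \notin D -> y a = 0, u = \sum_a y a *: e a, y b != 0
    & phi u \in (Vspan e phi D :&: Vspan e phi (J i))%VS].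
Proof.
have [uD [p [x [/andP[pD _] uE]]] phiu] : leading_form u.
  exact: (ClassicalEpsilon.epsilon_spec (inhabits 0) leading_form leading_form_exists).
have [y y0 uy] := spnP uD; exists y; split=> //.
move: phiu; rewrite memv_cap => /andP[_ /spnP[z z0 phiuz]].
(* The expressions of [phi u] over D and over J_i differ by a relation on J_(i+1), which on D must
   be a multiple of [kap b]. *)
have Jrel : relation v (J i.+1) (fun a => y a - z a).
  split=> [a aJ|].
    rewrite y0 ?z0 ?subrr// ?inE ?negb_and ?aJ ?orbT//.
    by apply: contra aJ; apply: (subsetP Jchain_subS).
  under eq_bigr do rewrite scalerBl; rewrite sumrB -phiuz uy linear_sum.
  by under [X in _ - X]eq_bigr do rewrite linearZ; rewrite subrr.
have bB := step_in; have yz a : a \in D -> y a - z a = y a.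
  by rewrite inE => /andP[aJ _]; rewrite z0// subr0.
have yE a : a \in D -> y a = y b * kap b a.
  move=> aD; rewrite -(yz a aD) (fundamental_expand cB kapP (relationS (Jchain_sub _) Jrel)).
  rewrite (bigD1 b)//= yz ?step_mem// big1 ?addr0// => c /andP[cB' cb].
  have [ct|ct] := boolP (c \in take i.+1 bs); first by rewrite (step_kap0 aD ct) mulr0.
  rewrite (proj1 Jrel) ?mul0r// mem_Jchain_basis// take_step mem_rcons inE.
  by rewrite (negPf cb).
(* If [y b] vanished then u would be 0, against its coefficient 1 at p and the independence of the
   [e]. *)
apply/eqP => yb0; have u0 : u = 0.
  rewrite uy big1// => a _; have [/yE ->|/y0 ->] := boolP (a \in D).
    by rewrite yb0 mul0r scale0r.
  by rewrite scale0r.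
move: uE; rewrite u0 => /esym uE.
pose mu a := if a == p then 1 else if (a < p)%O then x a else 0.
have /indpP/(_ mu) mu0 := e_free.
suff /mu0/(_ p)/eqP : relation e [set: S] mu by rewrite /mu eqxx oner_eq0.
split=> [a|]; first by rewrite inE.
rewrite -[RHS]uE (bigD1 p)//= {1}/mu eqxx scale1r; congr (_ + _).
rewrite big_mkcond [RHS]big_mkcond; apply: eq_bigr => a _; rewrite /mu lt_neqAle.
by case: eqP => //= _; case: ifP => // _; rewrite scale0r.
Qed.

Lemma step_vector : exists c, c != 0 /\
  phi u - c *: phi (e b) \in spn v [set x in A | (b < x)%O && (x \notin B)].
Proof.
have [y [y0 uy yb _]] := u_eltP; exists (y b); split=> //.
rewrite uy linear_sum (bigD1 b)//= linearZ /= addrAC subrr add0r; apply: rpred_sum => a ab.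
have [aD|/y0 ->] := boolP (a \in D); last by rewrite scale0r linear0 mem0v.
have [ba aB] := step_min aD ab.
have aA : a \in A by move: aD; rewrite inE => /andP[_ /(subsetP (Jchain_sub _))].
by rewrite linearZ memvZ// (mem_spn v)// inE aA ba aB.
Qed.

End Step.

Lemma circuits_sub C : C \in circuits N -> C \in circuits M.
Proof. by rewrite circuitsP circuits_repP => /andP[]. Qed.

(** Removing the first i + 1 elements of B from J_i leaves a basis of V_(J_i). *)
Lemma Jchain_level i : (i <= l)%N -> level e phi (J i) = i%:Z.
Proof.
move=> il; have [BA fB _] := cB; pose Bi := [set b in take i.+1 bs].
have BiJ : Bi \subset J i.
  apply/subsetP => b; rewrite inE => bt; rewrite mem_Jchain_basis//.
  exact: mem_take_sorted bt.
have JB : J i :\: Bi \subset A :\: B.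
  apply/subsetP => a; rewrite !inE => /andP[at_ aJ].
  rewrite (subsetP (Jchain_sub i))// andbT; apply: contra at_ => aB.
  by rewrite -mem_Jchain_basis.
have fJB := indpS JB fB.
have sJB : spn v (J i :\: Bi) = spn v (J i).
  apply/eqP; rewrite eqEsubv spnS ?subsetDl//=; apply: spn_sub => b bJ.
  have [bt|bt] := boolP (b \in Bi); last by apply: mem_spn; rewrite inE bt.
  rewrite inE in bt; have bB := mem_take_sorted bt; have [krel kb1] := kapP bB.
  have kb0 : kap b b != 0 by rewrite kb1 oner_eq0.
  have := relation_spn (relation_supp krel) kb0; apply/subvP/spnS/subsetP => a.
  rewrite in_setD1 inE => /andP[ab ka]; rewrite inE; apply/andP; split; last first.
    by apply/mem_JchainP; exists b.
  rewrite inE; apply: contra ka => /mem_take_sorted aB.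
  by rewrite (fundamental_offdiag kapP bB aB ab).
have cBi : #|Bi| = i.+1.
  rewrite cardsE (card_uniqP _) ?take_uniq ?sorted_elts_uniq//.
  by rewrite size_take size_bs ltnS; case: ltngtP il => // ->.
have cJ := cardsID Bi (J i); rewrite (setIidPr BiJ) cBi -(indp_dim fJB) sJB in cJ.
rewrite /level -cJ -[rk e phi (J i)]/(\dim (spn v (J i))) PoszD addrK.
by rewrite -addn1 PoszD addrK.
Qed.

Lemma Jchain_Tflat i : Tflat M (J i).
Proof.
apply/andP; split.
  apply/set0Pn; exists m; have mB := beta_min_in mP Bbeta.
  rewrite mem_Jchain_basis// -{1}bs_head.
  have : (0 < size bs)%N by rewrite size_bs.
  by case: bs => //= c s _; rewrite mem_head.
apply/existsP; exists [set C in circuits N | C \subset ground N :\: [set b in drop i.+1 bs]].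
apply/andP; split.
  by apply/subsetP => C; rewrite inE => /andP[/circuits_sub].
by rewrite /cover /Jchain /circuits_union; apply/eqP/eq_bigl => C; rewrite [RHS]inE.
Qed.

End FlatChain.

(** [span_set] is characterized through subspaces, so Q has to be replaced by one: a subspace on
    which Q holds is enlarged until it contains P, and the dimension bounds the number of steps. *)
Lemma span_set_ind (k : fieldType) (V : vectType k) (P Q : V -> Prop) :
    Q 0 -> (forall a x y, Q x -> Q y -> Q (a *: x + y)) -> (forall x, P x -> Q x) ->
  {in span_set P, forall x, Q x}.
Proof.
move=> Q0 Qlin PQ.
suff [Y PY YQ] : exists2 Y : {vspace V}, forall x, P x -> x \in Y & {in Y, forall x, Q x}.
  have sub : (span_set P <= Y)%VS by apply/span_setP.
  by move=> x /(subvP sub)/YQ.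
have step n (Y : {vspace V}) : (\dim {:V} - \dim Y <= n)%N -> {in Y, forall x, Q x} ->
    exists2 Y : {vspace V}, forall x, P x -> x \in Y & {in Y, forall x, Q x}.
  elim: n Y => [|n IHn] Y dY YQ.
    exists Y => // x _; have /eqP-> : Y == fullv by rewrite eqEdim subvf -subn_eq0 -leqn0.
    exact: memvf.
  have [PY|nPY] := classic (forall x, P x -> x \in Y); first by exists Y.
  have [x xP] := not_all_ex_not _ _ nPY; have [Px /negP xY] := imply_to_and _ _ xP.
  apply: (IHn (Y + <[x]>)%VS) => [|_ /memv_addP[y yY [_ /vlineP[a ->] ->]]].
    have ltd : (\dim Y < \dim (Y + <[x]>))%N.
      by rewrite (ltn_leqif (dimv_leqif_sup (addvSl Y <[x]>))) subv_add subvv /= -memvE.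
    by rewrite -ltnS (leq_trans _ dY)// ltn_sub2l// (leq_trans ltd)// dimvS ?subvf.
  by rewrite addrC; apply: Qlin; [apply: PQ | apply: YQ].
by apply: (step (\dim {:V}) 0%VS (leq_subr _ _)) => x; rewrite memv0 => /eqP ->.
Qed.

Lemma slow_lin (k : fieldType) (W : vectType k) (S : finType) (v : S -> W) L a p q :
  slow v L p -> slow v L q -> slow v L (a *: p + q).
Proof.
move=> sp sq eta; rewrite -mul_mpolyC rmorphD rmorphM /= restrC mul_polyC.
apply: leq_trans (size_polyD _ _) _; rewrite geq_max sq andbT.
exact: leq_trans (size_scale_leq _ _) (sp eta).
Qed.

Lemma span_filterE (k : fieldType) (W : vectType k) (S : finType) (v : S -> W)
    (L : seq S) (P : pred S) (X : {set S}) :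
  (forall x, (P x && (x \in L)) = (x \in X)) -> <<[seq v x | x <- L & P x]>>%VS = spn v X.
Proof.
move=> PX; apply: eq_span => y; apply/mapP/imageP => -[x xX ->]; exists x => //.
  by rewrite -PX -mem_filter.
by rewrite mem_filter PX.
Qed.

(** * Slow growth of the elements of S_A *)

Section GeneratorsSlow.
Variables (k : fieldType) (disp : Order.disp_t) (S : finOrderType disp).
Variables (U W : vectType k) (e : S -> U) (phi : 'Hom(U, W)) (A : {set S}).
Local Notation M := (rep_matroid e phi).
Local Notation N := (restriction M A).
Local Notation v := (fun i => phi (e i)).
Local Notation V := (subvs_of (Vspan e phi A)).
Local Notation vs := (fun i => vsproj (Vspan e phi A) (phi (e i))).
Local Notation l := `|level e phi A|%N.

Lemma vsprojK_gen a : a \in A -> vsval (vs a) = phi (e a).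
Proof. by move=> aA; rewrite vsprojK// mem_spn. Qed.

Lemma vsproj_spn (X : {set S}) w : w \in spn v X -> vsproj (Vspan e phi A) w \in spn vs X.
Proof.
move=> /spnP[y y0 ->]; rewrite linear_sum; under eq_bigr do rewrite linearZ.
exact: memv_spn_sum y0.
Qed.

Lemma vsproj_mem_spn (X : {set S}) a : X \subset A -> a \in A ->
  (vs a \in spn vs X) = (v a \in spn v X).
Proof.
move=> /subsetP XA aA; apply/idP/idP; last exact: vsproj_spn.
move=> /spnP[y y0 /(congr1 vsval)]; rewrite vsprojK_gen// => ->; rewrite linear_sum.
rewrite [X in X \in _](_ : _ = \sum_i y i *: v i); first exact: memv_spn_sum y0.
apply: eq_bigr => i _; rewrite linearZ /=;
  have [/XA/vsprojK_gen ->//|/y0 ->] := boolP (i \in X).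
by rewrite !scale0r.
Qed.

Section Count.
Variable eta : 'Hom(V, k^o).
Local Notation g := (fun a => eta (vs a) : k).
Local Notation nz X := [set a in X | g a != 0%R].

Lemma eta_relation X mu : relation v X mu -> \sum_a mu a * g a = 0.
Proof.
move=> [_ /(congr1 (eta \o vsproj (Vspan e phi A)))] /=.
rewrite !linear0 !linear_sum /= => mu0; rewrite -[RHS]mu0.
by apply: eq_bigr => a _; rewrite !linearZ.
Qed.

(** Applying eta to the relation of a circuit gives a vanishing sum, which cannot have exactly one
    nonzero term. *)
Lemma Tflat_count (J : {set S}) : Tflat M J ->
  #|nz J| != 0%N -> (1 < #|nz J|)%N.
Proof.
move=> /andP[_ /existsP[P /andP[/subsetP Pc /eqP JE]]].
rewrite cards_eq0 => /set0Pn[a]; rewrite inE {1}JE => /andP[/bigcupP[C CP aC] ga].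
have := Pc C CP; rewrite circuits_repP => /minset_relation[mu [murel muC]].
have [c [cC ca gc]] : exists c, [/\ c \in C, c != a & g c != 0].
  apply: NNPP => noc; have /eqP := eta_relation murel; rewrite (bigD1 a)//= big1.
    by rewrite addr0 mulf_eq0 (negPf ga) orbF => /eqP mua; have := muC a; rewrite mua eqxx aC.
  move=> c ca; have [cC|] := boolP (c \in C); last first.
    by rewrite -muC negbK => /eqP ->; rewrite mul0r.
  apply/eqP; apply: contraT; rewrite mulf_eq0 negb_or => /andP[_ gc].
  by case: noc; exists c.
have inJ x : x \in C -> x \in J by move=> xC; rewrite JE; apply/bigcupP; exists C.
have <- : #|[set a; c]| = 2%N by rewrite cards2 eq_sym ca.
apply/subset_leq_card/subsetP => x; rewrite !inE => /orP[/eqP ->|/eqP ->].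
  by rewrite inJ.
by rewrite inJ.
Qed.

(* If [eta (w i) != 0], then some element of J_(i+1) \ J_i is off the         *)
(* hyperplane [eta = 0]. The first J_i with elements off the hyperplane has   *)
(* two of them, and contributes no [w], as w_(i-1) is in V_(J_(i-1)).         *)
Lemma chain_count (J : nat -> {set S}) (w : nat -> V) n :
    (forall i, (i <= n)%N -> Tflat M (J i)) ->
    (forall i, (i < n)%N -> J i \subset J i.+1) ->
    (forall i, (i < n)%N ->
       vsval (w i) \in (Vspan e phi (J i.+1 :\: J i) :&: Vspan e phi (J i))%VS) ->
  let c := #|nz (J n)| in
  (\sum_(i < n) ((eta (w i) : k) != 0%R) < (c == 0) + c.-1)%N.
Proof.
move=> JT Jsub wJ.
have eta0 i (X : {set S}) : vsval (w i) \in spn v X -> #|nz X| = 0%N -> (eta (w i) : k) = 0.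
  move=> /vsproj_spn; rewrite vsvalK => /spnP[y y0 ->] /eqP.
  rewrite cards_eq0 => /eqP/setP gX; rewrite linear_sum big1// => a _.
  have [aX|/y0 ->] := boolP (a \in X); last by rewrite scale0r linear0.
  by have := gX a; rewrite !inE aX /= => /negbFE/eqP ga; rewrite linearZ /= ga scaler0.
have pos X : Tflat M X -> (0 < (#|nz X| == 0) + #|nz X|.-1)%N.
  by move=> /Tflat_count; case: #|_| => [|[|c]] // /(_ isT).
elim: n JT Jsub wJ => [|n IHn] JT Jsub wJ /=; first by rewrite big_ord0 pos// JT.
have {IHn} /= IH := IHn (fun i lti => JT i (leqW lti)) (fun i lti => Jsub i (ltnW lti))
  (fun i lti => wJ i (ltnW lti)).
rewrite big_ord_recr /=; have := wJ n (ltnSn n); rewrite memv_cap => /andP[wD wJn].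
have cE : #|nz (J n.+1)| =
   (#|nz (J n)| + #|nz (J n.+1 :\: J n)|)%N.
  rewrite -(cardsID (J n)); congr (_ + _)%N; apply: eq_card => a; rewrite !inE.
    have [/(subsetP (Jsub n (ltnSn n))) ->|] := boolP (a \in J n); rewrite ?andbT ?andbF//.
  by rewrite andbA andbC.
have [c0|c0] := eqVneq #|nz (J n)| 0%N.
  move: IH; rewrite c0 /= ltnS leqn0 => /eqP ->.
  by rewrite (eta0 n _ wJn c0) eqxx; apply/pos/JT.
have := Tflat_count (JT n (leqnSn n)) c0; move: IH; rewrite cE (negPf c0) add0n.
have eD : ((eta (w n) : k) != 0%R <= #|nz (J n.+1 :\: J n)|)%N.
  have [D0|D0] := eqVneq #|nz (J n.+1 :\: J n)| 0%N; last first.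
    by apply: leq_trans (leq_b1 _) _; rewrite lt0n.
  by rewrite (eta0 n _ wD D0) eqxx.
move: eD; do [move: #|nz (J n)| => c; move: #|nz (_ :\: _)| => d].
by case: c => [|[|c]] //= eD IH _; rewrite ?addSn /= ?add0n ltnS leq_add.
Qed.

End Count.
Lemma size_restr_prod (eta : 'Hom(V, k^o)) (w : nat -> V) n :
  (size (restr eta (\prod_(i < n) linform (w i))) <=
   (\sum_(i < n) ((eta (w i) : k) != 0%R)).+1)%N.
Proof.
elim: n => [|n IHn]; first by rewrite !big_ord0 rmorph1 size_poly1.
rewrite !big_ord_recr /= rmorphM /=; apply: leq_trans (size_polyMleq _ _) _.
rewrite restr_linform; set c := (eta (w n) : k).
have : (size ((linform (w n))%:P + c%:MP%:P * 'X)%R <= (c != 0%R).+1)%N.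
  have [->|c0] := eqVneq c 0.
    by rewrite mpolyC0 polyC0 mul0r addr0 size_polyC leq_b1.
  apply: leq_trans (size_polyD _ _) _; rewrite geq_max.
  rewrite (leq_trans (size_polyC_leq1 _))//=.
  apply: leq_trans (size_polyMleq _ _) _; rewrite size_polyX addn2 /= ltnS.
  exact: size_polyC_leq1.
move=> sc; rewrite -subn1 leq_subLR; apply: leq_trans (leq_add IHn sc) _.
by rewrite addSn addnS add1n.
Qed.

Local Notation L := (rev (sorted_elts A)).

Lemma mcount_card (eta : 'Hom(V, k^o)) :
  mcount eta vs L = #|[set a in A | (eta (vs a) : k) != 0%R]|.
Proof.
rewrite /mcount -size_filter -(card_uniqP _) ?filter_uniq ?rev_uniq ?sorted_elts_uniq//.
by apply: eq_card => a; rewrite mem_filter mem_rev mem_sorted_elts !inE andbC.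
Qed.

Lemma S_generator_slow (x : sympow l V) : S_generator x -> slow vs L (mpoly_of_dhomog x).
Proof.
move=> [J [w [JP Jsub JA wJ ->]]] eta /=.
(* [chain_count] takes a family indexed by nat; the default 0 occurs only from index l on. *)
pose ww i := if insub i is Some j then w j else 0.
have wwE (i : 'I_l) : ww i = w i by rewrite /ww valK.
rewrite (eq_bigr (fun i : 'I_l => linform (ww i))) => [|i _]; last by rewrite wwE.
apply: leq_trans (size_restr_prod _ _ _) _; rewrite mcount_card.
have := @chain_count eta J ww l; rewrite JA; apply.
- by move=> i /JP[].
- by move=> i /Jsub/proper_sub.
- by move=> i il; have := wJ (Ordinal il); rewrite -wwE.
Qed.

Lemma S_space_slow : {in S_space e phi A, forall x, slow vs L (mpoly_of_dhomog x)}.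
Proof.
apply: span_set_ind => [|a x y|x]; last exact: S_generator_slow.
  by move=> eta; rewrite /= rmorph0 size_poly0.
exact: slow_lin.
Qed.

End GeneratorsSlow.

(** * The elements x_B form a basis of S_A *)

Section BasisOfS.
Variables (k : fieldType) (disp : Order.disp_t) (S : finOrderType disp).
Variables (U W : vectType k) (e : S -> U) (phi : 'Hom(U, W)) (A : {set S}) (m : S).
Local Notation M := (rep_matroid e phi).
Local Notation N := (restriction M A).
Local Notation v := (fun i => phi (e i)).
Local Notation V := (subvs_of (Vspan e phi A)).
Local Notation vs := (fun i => vsproj (Vspan e phi A) (phi (e i))).
Local Notation l := `|level e phi A|%N.
Local Notation L := (rev (sorted_elts A)).

(** A T-flat contains a circuit, so it is dependent and has nonnegative level; the absolute value
    taken in the definitions is harmless. *)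
Lemma Tflat_card : Tflat M A ->
  level e phi A = l%:Z /\ #|A| = (rk e phi A + l).+1.
Proof.
move=> /andP[A0 /existsP[P /andP[/subsetP Pc /eqP AE]]].
have ltA : (rk e phi A < #|A|)%N.
  rewrite ltn_neqAle [X in _ && X](dim_spn_le v A) andbT.
  apply: contra_neqN A0 => /eqP rkA; apply/setP => a; rewrite [RHS]inE.
  have /indpP fA : indp v A.
    by rewrite /indp /free -/(spn v A) [\dim _]rkA size_map -cardE.
  apply/negP => aA; have := aA; rewrite {1}AE => /bigcupP[C CP aC].
  have := Pc C CP; rewrite circuits_repP => /minset_relation[mu [murel muC]].
  have CA : C \subset A by rewrite AE; apply: bigcup_sup.
  by have := muC a; rewrite (fA _ (relationS CA murel)) eqxx aC.
have levelE : level e phi A = (#|A| - (rk e phi A).+1)%N%:Z.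
  by rewrite /level -subzn// -addn1 PoszD opprD addrA.
split; first by rewrite levelE.
by rewrite levelE absz_nat -addSn subnKC.
Qed.

Hypothesis e_free : indp e [set: S].
Hypothesis mP : is_min m A.
Hypothesis card_A : #|A| = (rk e phi A + l).+1.
Hypothesis A_nonempty : A != set0.

(* The factor phi(u_j) of x_B, for x = b_j; [index] counts m = b_0. *)
Definition xvec (B : {set S}) (x : S) : V :=
  let i := (index x (sorted_elts B)).-1 in
  vsproj (Vspan e phi A) (phi (u_elt e phi (Jchain N B i.+1 :\: Jchain N B i) (Jchain N B i))).

(** Rewrites x_B as a product over B \ m in decreasing order, the order in which
    [triangular_products_free] peels off vectors. *)
Lemma x_eltE B : B \in beta_nbc_dual N ->
  mpoly_of_dhomog (x_elt e phi A B) =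
  \prod_(x <- rev (sorted_elts (A :\ m)) | x \in B) linform (xvec B x).
Proof.
move=> Bb; have cB := beta_cobasis mP Bb; have sz := size_bs mP card_A Bb.
have [BA _ _] := cB; have mB := beta_min_in mP Bb.
have bs0 := bs_head mP Bb; have us := sorted_elts_uniq B.
rewrite /= -[RHS]big_filter [RHS](perm_big (behead (sorted_elts B))) /=.
  rewrite [RHS](big_nth m) size_behead sz /= [RHS]big_mkord; apply: eq_bigr => i _.
  rewrite nth_behead /xvec index_uniq// sz ltnS.
  exact: ltn_ord.
apply: uniq_perm; first by rewrite filter_uniq// rev_uniq sorted_elts_uniq.
  by move: us; case: (sorted_elts B) => //= c s /andP[].
move=> x; rewrite mem_filter mem_rev mem_sorted_elts !inE.
have -> : (x \in behead (sorted_elts B)) = (x != m) && (x \in B).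
  rewrite -(mem_sorted_elts x B); case: (sorted_elts B) bs0 us sz => //= c s -> /andP[cs _] _.
  by rewrite inE; case: eqP => // ->; apply/negbTE.
have [xB|//] := boolP (x \in B); last by rewrite andbF.
by rewrite (subsetP BA x xB) /= andbT.
Qed.

(** By [step_vector] the factor at b_i is a nonzero multiple of v_(b_i) modulo larger vectors
    outside B. As m contributes no factor, the list of vectors is A \ m. *)
Lemma x_elt_free : indp (x_elt e phi A) (beta_nbc_dual N).
Proof.
apply/indpP => c [c0 sum0]; suff cb : {in beta_nbc_dual N, forall B, c B = 0}.
  by move=> B; have [/cb//|/c0] := boolP (B \in beta_nbc_dual N).
apply: (@triangular_products_free _ _ _ _ (rev (sorted_elts (A :\ m))) vs _ xvec).
- by rewrite rev_sorted sorted_elts_lt.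
- move=> B C Bb Cb BC; apply/setP => x; have [xA|xA] := boolP (x \in A); last first.
    have [/subsetP BA _ _] := beta_cobasis mP Bb; have [/subsetP CA _ _] := beta_cobasis mP Cb.
    by rewrite (contraNF (BA x))// (contraNF (CA x)).
  have [->|xm] := eqVneq x m; first by rewrite (beta_min_in mP Bb) (beta_min_in mP Cb).
  by apply: BC; rewrite mem_rev mem_sorted_elts !inE xm.
- move=> B Bb x; rewrite mem_rev mem_sorted_elts !inE => /andP[xm xA] xB.
  pose Y := [set y in A | (x < y)%O && (y \notin B)].
  have -> : <<[seq vs y | y <- rev (sorted_elts (A :\ m)) & (x < y)%O && (y \notin B)]>>%VS
     = spn vs Y.
    apply: span_filterE => y; rewrite mem_rev mem_sorted_elts !inE.
    have [->|ym] := eqVneq y m; last by rewrite /= andbC.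
    by rewrite /= andbF ltNge (min_le mP xA) andbF.
  have YA : Y \subset A by apply/subsetP=> y; rewrite inE => /andP[].
  split; first by rewrite vsproj_mem_spn// (beta_notin_span mP Bb xB xm).
  have [kap kapP] := fundamental_exists (beta_cobasis mP Bb).
  have sz := size_bs mP card_A Bb; have bs0 := bs_head mP Bb.
  have xbs : x \in sorted_elts B by rewrite mem_sorted_elts.
  have ix : (index x (sorted_elts B)).-1.+1 = index x (sorted_elts B).
    rewrite prednK// lt0n; apply: contra_neq xm => ix.
    by rewrite -bs0 -ix nth_index.
  have il : ((index x (sorted_elts B)).-1 < l)%N by rewrite -ltnS ix -sz index_mem.
  have [d [d0]] := step_vector e_free mP card_A Bb kapP il.
  rewrite ix nth_index// => wd; exists d => //; rewrite /xvec ix -linearZ -linearB.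
  exact: vsproj_spn wd.
- rewrite (sum_supp (x_elt e phi A) c0) in sum0.
  have := congr1 (@mpoly_of_dhomog _ _ _) sum0; rewrite raddf_sum /= => sum1.
  by rewrite -[RHS]sum1; apply: eq_bigr => B Bb; rewrite -x_eltE.
Qed.

Lemma x_elt_S_space B : B \in beta_nbc_dual N -> x_elt e phi A B \in S_space e phi A.
Proof.
move=> Bb; have [kap kapP] := fundamental_exists (beta_cobasis mP Bb).
have /span_setP := subvv (S_space e phi A); apply.
exists (Jchain N B); eexists; split=> [i il|i il||i|]; last by [].
- by split; [apply: (Jchain_Tflat mP card_A Bb kapP)|apply: (Jchain_level mP card_A Bb kapP)].
- apply/properP; split; first exact: (Jchain_subS mP card_A Bb kapP il).
  have := step_mem mP card_A Bb kapP il; rewrite inE => /andP[b1 b2].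
  by exists (nth m (sorted_elts B) i.+1).
- exact: (Jchain_last mP card_A Bb kapP).
- have [y [_ _ _ phiu]] := u_eltP e_free mP card_A Bb kapP (ltn_ord i).
  rewrite vsprojK//; move: phiu; rewrite memv_cap => /andP[_].
  by apply/subvP/spnS/(Jchain_sub mP Bb kapP).
Qed.

Lemma beta_sets_beta B : B \in beta_sets L vs -> B \in beta_nbc_dual N.
Proof.
move=> BL; have [|||mB E2 E3] := @beta_setsP _ _ _ _ L vs B m _ BL.
- by rewrite rev_sorted sorted_elts_lt.
- by rewrite mem_rev mem_sorted_elts (min_in mP).
- by move=> x; rewrite mem_rev mem_sorted_elts; apply: min_le.
have BA : B \subset A.
  by apply/subsetP => x /(beta_sets_sub BL); rewrite mem_rev mem_sorted_elts.
have memL x : (x \in L) = (x \in A) by rewrite mem_rev mem_sorted_elts.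
have spL (P : pred S) : <<[seq vs x | x <- L & P x]>>%VS = spn vs [set x in A | P x].
  by apply: span_filterE => x; rewrite memL inE andbC.
have subA (P : pred S) : [set x in A | P x] \subset A.
  by apply/subsetP => x; rewrite inE => /andP[].
apply: (beta_nbc_dualI mP BA) => // a aA.
  by move=> am; have := E2 a; rewrite memL => /(_ aA am); rewrite spL vsproj_mem_spn.
by have := E3 a; rewrite memL => /(_ aA); rewrite spL vsproj_mem_spn.
Qed.

(** [dim_slow] counts the sets of the recursion on A in decreasing order; they are distinct and lie
    in beta nbc. *)
Lemma dim_S_space : (\dim (S_space e phi A) <= #|beta_nbc_dual N|)%N.
Proof.
apply: leq_trans (dim_slow _ _ (@S_space_slow _ _ _ _ _ e phi A)) _.
- by rewrite -size_eq0 size_rev size_sorted_elts cards_eq0.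
- rewrite size_rev size_sorted_elts card_A ltnS addnC leq_add2l.
  have -> : <<[seq vs x | x <- L]>>%VS = spn vs A.
    by rewrite -(@span_filterE _ _ _ vs L predT A) ?filter_predT// => x;
      rewrite mem_rev mem_sorted_elts.
  suff : (Vspan e phi A <= linfun vsval @: spn vs A)%VS.
    move=> /dimvS/leq_trans; apply; rewrite -(limg_ker_dim (linfun vsval) (spn vs A)).
    exact: leq_addl.
  apply: spn_sub => a aA; rewrite -[X in X \in _](vsprojK_gen e phi aA).
  by rewrite -[vsval _](lfunE (vsval : {linear _ -> _})) memv_img// mem_spn.
rewrite cardE; apply: uniq_leq_size;
  first by rewrite beta_sets_uniq// rev_uniq sorted_elts_uniq.
by move=> B /beta_sets_beta; rewrite mem_enum.
Qed.

Lemma x_elt_basis :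
  basis_of (S_space e phi A) [seq x_elt e phi A B | B in beta_nbc_dual N].
Proof.
rewrite basisEfree; apply/and3P; split; first exact: x_elt_free.
  by apply/span_subvP => _ /imageP[B Bb ->]; apply: x_elt_S_space.
by rewrite size_map -cardE dim_S_space.
Qed.

End BasisOfS.

(** * The space T_A(phi) and the isomorphism *)

Section TopExteriorPower.
Variables (k : fieldType) (V : vectType k).

Lemma increasing_ge (n : nat) (f : 'I_n -> 'I_n) :
  (forall i j : 'I_n, (i < j)%N -> (f i < f j)%N) -> forall i : 'I_n, (i <= f i)%N.
Proof.
move=> finc [i]; elim: i => [|i IHi] lti //=.
apply: leq_ltn_trans (IHi (ltnW lti)) _; exact: finc.
Qed.

(** [i <= f i] termwise, while both sides have the same sum because f is a permutation. *)
Lemma increasing_id (n : nat) (f : 'I_n -> 'I_n) :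
  (forall i j : 'I_n, (i < j)%N -> (f i < f j)%N) -> forall i : 'I_n, f i = i.
Proof.
move=> finc; have fi : injective f.
  move=> i j fij; apply/val_inj/eqP; case: ltngtP => // /finc; rewrite fij ltnn//.
have := @leqif_sum _ xpredT (fun i : 'I_n => i == f i :> nat) (fun i : 'I_n => nat_of_ord i)
  (fun i => nat_of_ord (f i)) (fun i _ => leqif_eq (increasing_ge finc i)).
have -> : (\sum_(i < n) f i = \sum_(i < n) i)%N by rewrite [RHS](reindex_inj fi).
move=> /leqif_refl/forallP id_f i.
by apply/val_inj/esym/eqP/(implyP (id_f i)).
Qed.

Lemma increasing_top (f : {ffun 'I_(\dim {:V}) -> 'I_(\dim {:V})}) :
  increasing f = (f == [ffun i => i]).
Proof.
apply/idP/eqP => [/forallP finc|->].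
  apply/ffunP => i; rewrite ffunE; apply: increasing_id => a b ab.
  by have /forallP/(_ b)/implyP := finc a; apply.
by apply/forallP => i; apply/forallP => j; apply/implyP; rewrite !ffunE.
Qed.

Lemma dim_extpow_top d : d = \dim {:V} -> \dim {: extpow d V} = 1%N.
Proof.
move=> ->; rewrite dimvf /dim /= muln1 card_sig.
by rewrite (eq_card (B := pred1 [ffun i => i])) ?card1// => f; apply: increasing_top.
Qed.

(** In top degree the only minor is the determinant of the full coordinate matrix. *)
Lemma wedge_neq0 d (w : 'I_d -> V) : d = \dim {:V} ->
  (forall c : 'I_d -> k, \sum_i c i *: w i = 0 -> forall i, c i = 0) -> wedge w != 0.
Proof.
move=> dV; rewrite dV in w * => wfree.
have id_inc : increasing [ffun i : 'I_(\dim {:V}) => i] by rewrite increasing_top.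
apply/eqP => /ffunP/(_ (exist (fun f => increasing (V := V) f) _ id_inc));
  rewrite !ffunE /= => /eqP/det0P[r r0 rA].
move/negP: r0; apply; apply/eqP/rowP => i; rewrite mxE.
apply: (wfree (fun i => r 0 i)); rewrite (coord_vbasis (memvf (\sum_i _))).
rewrite big1// => j _; rewrite linear_sum; apply/eqP; rewrite scaler_eq0; apply/orP; left.
have /rowP/(_ j) := rA; rewrite !mxE => rA0; apply/eqP; rewrite -[RHS]rA0;
  apply: eq_bigr => a _.
by rewrite linearZ !mxE ffunE.
Qed.

Lemma free_nth_sum d (s : seq V) : free s -> d = size s ->
  forall c : 'I_d -> k, \sum_i c i *: s`_i = 0 -> forall i, c i = 0.
Proof. by move=> fs ->; apply/(@freeP _ _ _ (in_tuple s)). Qed.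

End TopExteriorPower.

Lemma dim_hom (k : fieldType) (V W : vectType k) :
  \dim {:'Hom(V, W)} = (\dim {:V} * \dim {:W})%N.
Proof. by rewrite !dimvf. Qed.

Lemma tens_sum_eq0 (k : fieldType) (V W : vectType k) (I : finType) (v : I -> V)
    (w : I -> W) (h : 'Hom(V, k^o)) (c : I -> k) j :
    \sum_i c i *: tens (v i) (w i) = 0 -> (forall i, i != j -> (h (v i) : k) = 0) ->
  (c j * h (v j)) *: w j = 0.
Proof.
move=> sum0 hv; have : (\sum_i c i *: tens (v i) (w i) : 'Hom(dual V, W)) h = 0.
  by rewrite sum0 zero_lfunE.
rewrite sum_lfunE (bigD1 j)//= big1 => [|i ij].
  by rewrite addr0 scale_lfunE tensE scalerA.
by rewrite scale_lfunE tensE hv// scale0r scaler0.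
Qed.

Section TensorBasis.
Variables (k : fieldType) (X E Lam : vectType k) (I : finType).
Variables (x : I -> X) (eps : E) (nu : I -> Lam).
Hypothesis x_free : free (codom_tuple x).
Hypothesis eps_neq0 : eps != 0.
Hypothesis nu_neq0 : forall i, nu i != 0.

(** Pairing the first two factors with x_j and with a functional nonzero at [eps] isolates the j-th
    term. *)
Lemma tens_dual_free (c : I -> k) :
  \sum_i c i *: tens (tens (dual_basis x i) eps) (nu i) = 0 -> forall i, c i = 0.
Proof.
move=> sum0 j.
have [|delta [delta0 _]] := @separating_functional _ E 0%VS eps; first by rewrite memv0.
have [|ev evE] := @hom_of_linear k 'Hom(X, k^o) k^o (fun h => h (x j)).
  by move=> a h1 h2; rewrite add_lfunE scale_lfunE.
have [|F FE] := @hom_of_linear k 'Hom('Hom('Hom(X, k^o), k^o), E) k^o (fun h => delta (h ev)).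
  by move=> a h1 h2; rewrite add_lfunE scale_lfunE linearP.
have FtE i : F (tens (dual_basis x i) eps) = (i == j)%:R * delta eps.
  by rewrite FE tensE evE dual_basisE// linearZ.
have hF i : i != j -> (F (tens (dual_basis x i) eps) : k) = 0.
  by move=> ij; rewrite FtE (negPf ij) mul0r.
have /eqP := tens_sum_eq0 (h := F) sum0 hF.
by rewrite FtE eqxx mul1r scaler_eq0 (negPf (nu_neq0 j)) orbF mulf_eq0 (negPf delta0) orbF => /eqP.
Qed.

End TensorBasis.

Section LinearExtension.
Variables (k : fieldType) (I : finType).

Definition spans (V : lmodType k) (h : I -> V) := forall x, exists c, x = \sum_i c i *: h i.

Definition linindep (V : lmodType k) (h : I -> V) :=
  forall c, \sum_i c i *: h i = 0 -> forall i, c i = 0.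

Lemma linindep_inj (V : lmodType k) (h : I -> V) (c d : I -> k) : linindep h ->
  \sum_i c i *: h i = \sum_i d i *: h i -> c =1 d.
Proof.
move=> hfree E i; apply/eqP; rewrite -subr_eq0; apply/eqP.
apply: (hfree (fun i => c i - d i)); under eq_bigr do rewrite scalerBl.
by rewrite sumrB E subrr.
Qed.

(** The homology is only an lmodType, so bases are families with [linindep] and [spans]. Coordinates
    are obtained by choice, and independence makes them linear. *)
Lemma linear_bijection (V T : lmodType k) (h : I -> V) (t : I -> T) :
    linindep h -> spans h -> linindep t -> spans t ->
  exists theta : {linear V -> T}, [/\ bijective theta, forall i, theta (h i) = t i
    & forall f : {linear V -> T}, (forall i, f (h i) = t i) -> f =1 theta].
Proof.
move=> hfree hspan tfree tspan.
have choose (X : lmodType k) (g : I -> X) : spans g ->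
    exists co : X -> I -> k, forall x, x = \sum_i co x i *: g i.
  move=> gspan; pose wit x := ClassicalEpsilon.constructive_indefinite_description _ (gspan x).
  by exists (fun x => proj1_sig (wit x)) => x; apply: (proj2_sig (wit x)).
have [cV cVE] := choose V h hspan; have [cT cTE] := choose T t tspan.
pose g x := \sum_i cV x i *: t i.
have glin : linear g.
  move=> a x y; rewrite /g scaler_sumr -big_split; apply: eq_bigr => i _ /=.
  rewrite scalerA -scalerDl; congr (_ *: _).
  apply: (linindep_inj (d := fun i => a * cV x i + cV y i) hfree); rewrite -cVE.
  under eq_bigr do rewrite scalerDl -scalerA.
  by rewrite big_split -scaler_sumr /= -!cVE.
pose theta : {linear V -> T} := HB.pack g (GRing.isLinear.Build _ _ _ _ g glin).
have gE (c : I -> k) : g (\sum_i c i *: h i) = \sum_i c i *: t i.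
  apply: eq_bigr => i _; congr (_ *: _).
  by apply: (linindep_inj hfree); rewrite -cVE.
exists theta; split.
- exists (fun y => \sum_i cT y i *: h i) => [x|y] /=; last by rewrite gE -cTE.
  rewrite [RHS]cVE; apply: eq_bigr => i _; congr (_ *: _).
  by apply: (linindep_inj tfree); rewrite -cTE.
- move=> i /=; have hE : h i = \sum_j (j == i)%:R *: h j.
    rewrite (bigD1 i)//= eqxx scale1r big1 ?addr0// => j /negPf ->.
    by rewrite scale0r.
  rewrite hE gE (bigD1 i)//= eqxx scale1r big1 ?addr0// => j /negPf ->.
  by rewrite scale0r.
- move=> f fh x; rewrite /= /g {1}(cVE x) linear_sum; apply: eq_bigr => i _.
  by rewrite linearZ fh.
Qed.

Lemma spans_dim (V : vectType k) (h : I -> V) : linindep h -> #|I| = \dim {:V} -> spans h.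
Proof.
move=> hfree dimV x; have fh : indp h [set: I].
  by apply/indpP => mu [_ sum0]; apply: hfree.
have full : spn h [set: I] = fullv.
  by apply/eqP; rewrite eqEdim subvf (indp_dim fh) cardsT dimV /=.
have : x \in spn h [set: I] by rewrite full memvf.
by move=> /spnP[c _ ->]; exists c.
Qed.

End LinearExtension.

Section QuotientClasses.
Variables (k : fieldType) (V : vectType k) (X : {vspace V}).

Lemma quotv_class0 : quotv_class X 0 = 0.
Proof. by apply: (addrI (quotv_class X 0)); rewrite addr0 -quotv_classD addr0. Qed.

Lemma quotv_class_sum (I : finType) (c : I -> k) (u : I -> V) :
  quotv_class X (\sum_i c i *: u i) = \sum_i c i *: quotv_class X (u i).
Proof.
apply: (big_rec2 (fun x y => quotv_class X x = y)) => [|i y x _ <-].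
  exact: quotv_class0.
by rewrite quotv_classD quotv_classZ.
Qed.

End QuotientClasses.

(** * The classes of the cycles form a basis of the homology *)

Section HomologyBasis.
Variables (k : fieldType) (disp : Order.disp_t) (S : finOrderType disp).
Variables (U W : vectType k) (e : S -> U) (phi : 'Hom(U, W)) (A : {set S}) (m : S).
Variable l : nat.
Local Notation N := (restriction (rep_matroid e phi) A).
Local Notation Delta := (reduced_bc (dual_matroid N)).
Local Notation I := {B : {set S} | B \in beta_nbc_dual N}.
Hypothesis mP : is_min m A.
Hypothesis card_A : #|A| = (rk e phi A + l).+1.
Variable deg : int.
Hypothesis degE : deg + 1 = l%:Z.

Lemma mem_cyclesP (z : chain k S) : reflect
  ((forall G, z G != 0 -> G \in Delta /\ #|G| = l) /\ bd k S z = 0) (z \in cycles k Delta deg).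
Proof.
rewrite memv_cap memv_ker mem_span_face; apply: (iffP andP) => -[zP /eqP bdz]; split=> //.
  move=> G zG; have := implyP (forallP zP G) zG.
  by rewrite inE degE => /andP[GD /eqP[]].
apply/forallP => G; apply/implyP => /zP[GD cG].
by rewrite inE degE GD cG eqxx.
Qed.

Lemma boundaries_top : boundaries k Delta deg = 0%VS.
Proof.
rewrite /boundaries /chains.
have -> : [set F in Delta | #|F|%:Z == deg + 1 + 1] = set0.
  apply/setP => F; rewrite [RHS]inE inE degE; apply/negbTE; rewrite negb_and.
  have [FD|//] := boolP (F \in Delta); have := reduced_bc_card mP card_A FD.
  by apply: contra => /eqP; rewrite -PoszD addn1 => -[->].
by rewrite /image_mem enum_set0 span_nil limg0.
Qed.

Lemma sigma_cycles B : B \in beta_nbc_dual N -> sigma k N B \in cycles k Delta deg.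
Proof.
move=> Bb; apply/mem_cyclesP; split.
  exact: (sigma_face mP card_A Bb).
exact: (bd_sigma mP Bb).
Qed.

(** At B \ m, for the heaviest B with a nonzero coefficient, every other term vanishes. *)
Lemma sigma_tri (c : I -> k) :
    {in beta_nbc_dual N, forall B, (\sum_i c i *: sigma k N (val i) : chain k S) (B :\ m) = 0} ->
  forall i, c i = 0.
Proof.
move=> sum0 i0; apply/eqP; apply: contraT => ci0.
have [i ci maxi] := @arg_maxnP _ i0 (fun i => c i != 0) (fun i => weight (val i :\ m)) ci0.
have := sum0 _ (valP i); rewrite sum_ffunE (bigD1 i)//= ffunE big1 ?addr0 => [|j ji].
  have [sB _] := sigma_lead mP (valP i).
  by move/eqP; rewrite mulf_eq0 (negPf ci) (negPf sB).
rewrite ffunE; have [_ leadj] := sigma_lead mP (valP j).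
have [/eqP|/leadj[E|ltw]] := boolP (sigma k N (val j) (val i :\ m) == 0).
- by move=> ->; apply: mulr0.
- case/eqP: ji; apply/val_inj.
  by rewrite -(setD1K (beta_min_in mP (valP j))) -E setD1K// (beta_min_in mP (valP i)).
- have [->|cj] := eqVneq (c j) 0; first exact: mul0r.
  by have := maxi j cj; rewrite /= leqNgt ltw.
Qed.

Lemma cycles_spanned z : z \in cycles k Delta deg ->
  exists c : I -> k, z = \sum_i c i *: sigma k N (val i).
Proof.
move=> /mem_cyclesP[zsupp bdz].
(* The rows of the square matrix of values of the cycles at the faces B \ m. They are independent,
   so some combination of cycles agrees with z at these faces, and [cycle_eq0] applies to the
   difference. *)
pose R (i : I) : {ffun I -> k^o} := [ffun j => sigma k N (val i) (val j :\ m)].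
have Rfree : linindep R.
  move=> c sum0; apply: sigma_tri => B Bb; rewrite sum_ffunE.
  have /ffunP/(_ (exist _ B Bb)) := sum0; rewrite sum_ffunE ffunE => sum0B.
  by rewrite -[RHS]sum0B; apply: eq_bigr => i _; rewrite !ffunE.
have dimR : #|{: I}| = \dim {: {ffun I -> k^o}} by rewrite dimvf /dim /= muln1.
have [c zc] := spans_dim Rfree dimR [ffun j : I => z (val j :\ m)].
exists c; apply/eqP; rewrite -subr_eq0; apply/eqP.
apply: (cycle_eq0 mP card_A) => [G|| B Bb].
- rewrite !ffunE sum_ffunE => zG; apply: NNPP => nG.
  case/negP: zG; apply/eqP.
  have [/eqP ->|/zsupp//] := boolP (z G == 0); rewrite sub0r big1 ?oppr0// => i _.
  rewrite ffunE; have [/eqP ->|] := boolP (sigma k N (val i) G == 0); first exact: mulr0.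
  by move=> /(sigma_face mP card_A (valP i)).
- rewrite linearB /= bdz sub0r linear_sum big1 ?oppr0// => i _.
  by rewrite linearZ /= (bd_sigma mP (valP i)) scaler0.
- rewrite !ffunE sum_ffunE; have /ffunP/(_ (exist _ B Bb)) := zc.
  rewrite !ffunE sum_ffunE /= => ->; apply/eqP; rewrite subr_eq0; apply/eqP.
  by apply: eq_bigr => i _; rewrite !ffunE.
Qed.

Local Notation cls i := (homology_class Delta deg (sigma k N (val i))).

Lemma homology_linindep : linindep (fun i : I => cls i : homology k Delta deg).
Proof.
move=> c; rewrite -quotv_class_sum => /eqP.
rewrite -[X in _ == X](quotv_class0 _) eq_quotv_class subr0 -memv_preim boundaries_top memv0.
rewrite lfunE /= linear_sum /= => /eqP sum0; apply: sigma_tri => B Bb.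
have -> : (\sum_i c i *: sigma k N (val i) : chain k S) = 0; last by rewrite ffunE.
rewrite -[RHS]sum0; apply: eq_bigr => i _; rewrite vsprojK//.
exact: sigma_cycles (valP i).
Qed.

Lemma homology_spans : spans (fun i : I => cls i : homology k Delta deg).
Proof.
move=> q; pose z := repr (q : Quotient.quot _).
have [c zE] := cycles_spanned (subvsP z).
exists c; rewrite -quotv_class_sum -[LHS]quotv_classK -/z; congr (quotv_class _ _).
by rewrite -[LHS]vsvalK zE linear_sum; apply: eq_bigr => i _; rewrite linearZ.
Qed.

End HomologyBasis.

Lemma dim_dual (k : fieldType) (V : vectType k) : \dim {: dual V} = \dim {: V}.
Proof.
have k1 : \dim {: k^o} = 1%N by rewrite dimvf.
by rewrite dim_hom k1 muln1.
Qed.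

Lemma dim_tensor (k : fieldType) (V1 V2 : vectType k) :
  \dim {: tensor V1 V2} = (\dim {: V1} * \dim {: V2})%N.
Proof. by rewrite dim_hom dim_dual. Qed.

Lemma linindep_free (k : fieldType) (I : finType) (V : vectType k) (h : I -> V) :
  linindep h -> free (codom_tuple h).
Proof.
move=> hfree; have : indp h [set: I] by apply/indpP => mu [_ sum0]; apply: hfree.
by rewrite /indp /image_mem enum_setT -enumT /= codomE.
Qed.

Lemma dual_basis1_neq0 (k : fieldType) (V : vectType k) (w : V) :
  w != 0 -> dual_basis (fun _ : unit => w) tt != 0.
Proof.
move=> w0; have fw : linindep (fun _ : unit => w).
  move=> c; rewrite (bigD1 tt)//= big1 => [|[]//]; rewrite addr0 => /eqP.
  by rewrite scaler_eq0 (negPf w0) orbF => /eqP c0 [].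
apply: contra_eq_neq (dual_basisE tt tt (linindep_free fw)) => ->.
by rewrite zero_lfunE eqxx eq_sym oner_eq0.
Qed.

(** * The corresponding basis of T_A *)

Section TSpaceBasis.
Variables (k : fieldType) (disp : Order.disp_t) (S : finOrderType disp).
Variables (U W : vectType k) (e : S -> U) (phi : 'Hom(U, W)) (A : {set S}) (m : S).
Local Notation N := (restriction (rep_matroid e phi) A).
Local Notation I := {B : {set S} | B \in beta_nbc_dual N}.
Hypothesis e_free : indp e [set: S].
Hypothesis mP : is_min m A.
Hypothesis card_A : #|A| = (rk e phi A + `|level e phi A|).+1.

Local Notation x := (fun C : I => vsproj (S_space e phi A) (x_elt e phi A (val C))).
Local Notation eps := (e_wedge e A).
Local Notation nu := (fun C : I => v_dual e phi A (A :\: val C)).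

Lemma x_sub_linindep : linindep x.
Proof.
move=> c sum0; pose mu B := if insub B is Some i then c i else 0 : k.
have muE (i : I) : mu (val i) = c i by rewrite /mu valK.
move=> i; rewrite -muE; have /indpP := x_elt_free e_free mP card_A; apply.
have mu0 B : B \notin beta_nbc_dual N -> mu B = 0 by move=> ?; rewrite /mu insubN.
split=> //; rewrite (sum_supp (x_elt e phi A) mu0).
have := congr1 vsval sum0; rewrite linear0 linear_sum => sum1; rewrite -[RHS]sum1.
rewrite big_sub; apply: eq_bigr => i' _; rewrite [RHS]linearZ /= muE vsprojK//.
exact: (x_elt_S_space e_free mP card_A (valP i')).
Qed.

Lemma x_sub_free : free (codom_tuple x).
Proof. exact: linindep_free x_sub_linindep. Qed.

Lemma sorted_elts_free (V : vectType k) (v : S -> V) (X : {set S}) :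
  indp v X -> free [seq v a | a <- sorted_elts X].
Proof.
by move=> fX; rewrite (perm_free (Y := [seq v a | a in X]))// perm_map// perm_sort.
Qed.

Lemma e_wedge_top : \dim {: extpow #|A| (subvs_of (Uspan e A))} = 1%N /\ eps != 0.
Proof.
have fA : indp e A := indpS (subsetT A) e_free.
have dimA : #|A| = \dim {: subvs_of (Uspan e A)} by rewrite dimvf -(indp_dim fA).
split; first exact: dim_extpow_top.
apply: wedge_neq0 dimA _; apply: free_nth_sum; last by rewrite size_map size_sorted_elts.
apply: sorted_elts_free; apply/indpP => mu [mu0 sum0]; apply: (indpP _ _ fA).
split=> //; have := congr1 vsval sum0; rewrite linear0 linear_sum => sum1.
rewrite -[RHS]sum1; apply: eq_bigr => i _; rewrite linearZ /=.
have [iA|/mu0 ->] := boolP (i \in A); last by rewrite !scale0r.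
by rewrite vsprojK// mem_spn.
Qed.

Lemma v_dual_neq0 (i : I) : nu i != 0.
Proof.
have [BA fB sB] := beta_cobasis mP (valP i).
have cB : rk e phi A = #|A :\: val i| by rewrite -(indp_dim fB) sB.
apply: dual_basis1_neq0.
have dimV : rk e phi A = \dim {: subvs_of (Vspan e phi A)} by rewrite dimvf.
apply: wedge_neq0 dimV _; apply: free_nth_sum; last by rewrite size_map size_sorted_elts.
apply: sorted_elts_free; apply/indpP => mu [mu0 sum0]; apply: (indpP _ _ fB).
split=> //; have := congr1 vsval sum0; rewrite linear0 linear_sum => sum1.
rewrite -[RHS]sum1; apply: eq_bigr => a _; rewrite linearZ /=.
have [aAB|/mu0 ->] := boolP (a \in A :\: val i); last by rewrite !scale0r.
by rewrite vsprojK// -[Vspan e phi A]/(spn _ A) -sB mem_spn.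
Qed.

Lemma target_linindep :
  linindep (fun B : I => tens (tens (x_dual B) eps) (nu B) : T_space e phi A).
Proof.
have [_ eps0] := e_wedge_top.
by move=> c; apply: (tens_dual_free x_sub_free eps0 v_dual_neq0).
Qed.

(** Both exterior factors are lines, so T_A has the dimension of S_A, the cardinality of beta
    nbc. *)
Lemma target_spans :
  spans (fun B : I => tens (tens (x_dual B) eps) (nu B) : T_space e phi A).
Proof.
apply: spans_dim target_linindep _.
have [dimE _] := e_wedge_top; rewrite !dim_tensor !dim_dual dimE muln1.
rewrite dim_extpow_top ?muln1; last by rewrite dimvf.
have A0 : A != set0 by apply/set0Pn; exists m; apply: min_in mP.
have bS : \dim (S_space e phi A) = #|beta_nbc_dual N|.
  apply/eqP; rewrite eqn_leq (dim_S_space mP card_A A0) /=.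
  rewrite -(indp_dim (x_elt_free e_free mP card_A)) dimvS//.
  by apply: spn_sub => B; apply: x_elt_S_space e_free mP card_A B.
by rewrite dimvf [RHS](_ : _ = \dim (S_space e phi A))// bS card_sig.
Qed.

End TSpaceBasis.

Theorem theorem5p6 (disp : Order.disp_t) (S : finOrderType disp)
    (k : fieldType) (U W : vectType k) (e : S -> U) (phi : 'Hom(U, W))
    (A : {set S}) :
  basis_of {:U} [seq e i | i : S] ->
  Tflat (rep_matroid e phi) A ->
  let N := restriction (rep_matroid e phi) A in
  let Delta := reduced_bc (dual_matroid N) in
  let deg : int := level e phi A - 1 in
  [/\ forall B, B \in beta_nbc_dual N -> sigma k N B \in cycles k Delta deg,
      basis_of (S_space e phi A) [seq x_elt e phi A B | B in beta_nbc_dual N]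
    & exists theta : {linear homology k Delta deg -> T_space e phi A},
        let spec (f : homology k Delta deg -> T_space e phi A) :=
          forall B : {B : {set S} | B \in beta_nbc_dual N},
            f (homology_class Delta deg (sigma k N (val B))) =
            tens (tens (x_dual B) (e_wedge e A)) (v_dual e phi A (A :\: val B))
        in
        [/\ bijective theta,
            spec theta
          & forall f : {linear homology k Delta deg -> T_space e phi A},
              spec f -> f =1 theta]].
Proof.
move=> eb TA N Delta deg.
have e_free : indp e [set: S].
  by have := basis_free eb; rewrite /indp /image_mem enum_setT -enumT.
have [levelE card_A] := Tflat_card TA.
have A0 : A != set0 by case/andP: TA.
have [m mP] := is_min_exists A0.
have degE : deg + 1 = `|level e phi A|%N%:Z by rewrite /deg subrK.
split.
- exact: sigma_cycles mP card_A deg degE.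
- exact: x_elt_basis e_free mP card_A A0.
- have hfree := homology_linindep mP card_A degE; have hspan := homology_spans mP card_A degE.
  have tfree := target_linindep e_free mP card_A; have tspan := target_spans e_free mP card_A.
  by have [theta thetaP] := linear_bijection hfree hspan tfree tspan; exists theta.
Qed.
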